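(* Let $\tau \in i\mathbb{R}_{>0}$ and $n_{k}\in \mathbb{Z}_{\geq 0}$ for $k=0,1,2,3$ with $\max_k n_k\geq1$. Suppose that all zeros of $Q^{(n_{0}, n_{1}, n_{2}, n_{3})}(\cdot;\tau)$ are real and distinct. Then the monodromy representation of the generalized Lam\'e equation $$y^{\prime \prime}(z)=I(z;E)y(z)=\Big[\sum_{k=0}^{3}n_{k}(n_{k}+1)\wp\big(z+\tfrac{\omega_{k}}{2};\tau\big)+E\Big]y(z)$$ is not unitary for any $E\in\mathbb{C}$.
   Context: $\omega_0=0$, $\omega_1=1$, $\omega_2=\tau$, $\omega_3=1+\tau$; $E_\tau=\mathbb{C}/(\mathbb{Z}+\mathbb{Z}\tau)$; $\wp(z;\tau)$ is the Weierstrass elliptic function with periods $1,\tau$. Monodromy. The local monodromy of the equation at every $\frac{\omega_k}{2}$ is the identity, so all solutions are meromorphic on $\mathbb{C}$ and the monodromy representation is a homomorphism $\rho(\cdot;E):\pi_1(E_\tau)\to SL(2,\mathbb{C})$, given by the matrices of the translations $z\mapsto z+1$, $z\mapsto z+\tau$ on a basis of solutions. It is unitary if its image is contained in $SU(2)$ up to a common conjugation. Definition of the spectral polynomial. For every $E\in\mathbb{C}$ the equation $\Phi'''(z)-4I(z;E)\Phi'(z)-2I'(z;E)\Phi(z)=0$ has a one-dimensional space of even elliptic solutions, and it is spanned by a solution of the form $$\Phi(z;E)=c_0(E)+\sum_{k=0}^{3}\sum_{j=0}^{n_k-1}b^{(k)}_j(E)\,\wp(z+\tfrac{\omega_k}{2};\tau)^{n_k-j},$$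 where $c_0(E)$ and $b_j^{(k)}(E)$ are polynomials in $E$ without common divisors, $c_0$ is monic, and $\deg b_j^{(k)}<g:=\deg c_0$. Then $$Q^{(n_0,n_1,n_2,n_3)}(E;\tau):=I(z;E)\Phi(z;E)^2+\tfrac14\Phi'(z;E)^2-\tfrac12\Phi(z;E)\Phi''(z;E)$$ is independent of $z$ and is a monic polynomial in $E$ of degree $2g+1$. *)

(* Defs.v *)
From HB Require Import structures.
From mathcomp Require Import all_boot all_order all_algebra.
From mathcomp Require Import all_classical all_reals all_analysis.
From mathcomp.real_closed Require Import complex.

Set Implicit Arguments.
Unset Strict Implicit.
Unset Printing Implicit Defensive.

Import Order.TTheory GRing.Theory Num.Theory.
Import numFieldNormedType.Exports.

Local Open Scope classical_set_scope.
Local Open Scope ring_scope.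

(* [R[i]] carries its topology through the alias [R[i]^o]; the derivatives
   below are therefore derivatives with respect to a complex variable. *)
Definition cderivable (R : realType) (f : R[i] -> R[i]) (z : R[i]) : Prop :=
  derivable (f : R[i]^o -> R[i]^o) z 1.

Definition cderive (R : realType) (f : R[i] -> R[i]) : R[i] -> R[i] :=
  derive1 (f : R[i]^o -> R[i]^o).

(* The value at the centre [a] is irrelevant, so that meromorphic functions are
   total functions with arbitrary values at their singular points. *)
Definition meromorphic (R : realType) (f : R[i] -> R[i]) : Prop :=
  forall a : R[i], exists (m : nat) (g : R[i] -> R[i]),
    (\forall z \near (a : R[i]^o), cderivable g z) /\
    (\forall z \near (a : R[i]^o)^', f z = g z / (z - a) ^+ m).

Definition lattice_pt (R : realType) (tau : R[i]) (a b : int) : R[i] :=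
  a%:~R + b%:~R * tau.

(* Partial sum over the periods a + b tau with |a|, |b| <= N. The Weierstrass
   series converges absolutely, so its sum is the limit over these squares.
   At a period [z], [wp tau z] is a meaningless value, never used below. *)
Definition wp_partial (R : realType) (tau z : R[i]) (N : nat) : R[i] :=
  (z ^+ 2)^-1 +
  \sum_(i < N.*2.+1) \sum_(j < N.*2.+1 |
      lattice_pt tau (i%:Z - N%:Z) (j%:Z - N%:Z) != 0)
    (((z - lattice_pt tau (i%:Z - N%:Z) (j%:Z - N%:Z)) ^+ 2)^-1
     - ((lattice_pt tau (i%:Z - N%:Z) (j%:Z - N%:Z)) ^+ 2)^-1).

Definition wp (R : realType) (tau z : R[i]) : R[i] :=
  lim ((fun N => wp_partial tau z N : R[i]^o) @ \oo).

Definition omega (R : realType) (tau : R[i]) (k : 'I_4) : R[i] :=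
  tnth [tuple 0; 1; tau; 1 + tau] k.

Definition regular_pt (R : realType) (tau : R[i]) (n : 'I_4 -> nat)
    (z : R[i]) : Prop :=
  forall k : 'I_4, (0 < n k)%N ->
    forall a b : int, z + omega tau k / 2 <> lattice_pt tau a b.

Definition potential (R : realType) (tau : R[i]) (n : 'I_4 -> nat)
    (E z : R[i]) : R[i] :=
  (\sum_(k < 4) (n k * (n k).+1)%N%:R * wp tau (z + omega tau k / 2)) + E.

Definition lame_solution (R : realType) (tau : R[i]) (n : 'I_4 -> nat)
    (E : R[i]) (y : R[i] -> R[i]) : Prop :=
  meromorphic y /\
  forall z, regular_pt tau n z ->
    [/\ cderivable y z, cderivable (cderive y) z &
        cderive (cderive y) z = potential tau n E z * y z].

(* Functions are identified when they agree at all regular points. *)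
Definition lame_basis (R : realType) (tau : R[i]) (n : 'I_4 -> nat)
    (E : R[i]) (y : 'I_2 -> R[i] -> R[i]) : Prop :=
  [/\ forall i, lame_solution tau n E (y i),
      forall c : 'I_2 -> R[i],
        (forall z, regular_pt tau n z -> \sum_i c i * y i z = 0) ->
        forall i, c i = 0 &
      forall f, lame_solution tau n E f ->
        exists c : 'I_2 -> R[i],
          forall z, regular_pt tau n z -> f z = \sum_i c i * y i z].

(* pi_1(E_tau) is the period lattice: [rho a b] is the matrix, in some basis of
   solutions, of the translation z |-> z + a + b tau. *)
Definition is_monodromy (R : realType) (tau : R[i]) (n : 'I_4 -> nat)
    (E : R[i]) (rho : int -> int -> 'M[R[i]]_2) : Prop :=
  exists y : 'I_2 -> R[i] -> R[i], lame_basis tau n E y /\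
    forall (a b : int) (z : R[i]), regular_pt tau n z ->
      forall i, y i (z + lattice_pt tau a b) = \sum_j rho a b i j * y j z.

Definition SU2 (R : realType) (U : 'M[R[i]]_2) : Prop :=
  U \is unitarymx /\ \det U = 1.

Definition unitary_rep (R : realType) (rho : int -> int -> 'M[R[i]]_2) : Prop :=
  exists P : 'M[R[i]]_2, P \in unitmx /\
    forall a b : int, SU2 (P *m rho a b *m invmx P).

Definition third_order_solution (R : realType) (tau : R[i]) (n : 'I_4 -> nat)
    (E : R[i]) (f : R[i] -> R[i]) : Prop :=
  forall z, regular_pt tau n z ->
    [/\ cderivable f z, cderivable (cderive f) z,
        cderivable (cderive (cderive f)) z &
        cderive (cderive (cderive f)) z
        - 4 * potential tau n E z * cderive f z
        - 2 * cderive (potential tau n E) z * f z = 0].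

Definition even_elliptic (R : realType) (tau : R[i]) (n : 'I_4 -> nat)
    (f : R[i] -> R[i]) : Prop :=
  meromorphic f /\
  forall z, regular_pt tau n z ->
    [/\ f (z + 1) = f z, f (z + tau) = f z & f (- z) = f z].

Definition Phi (R : realType) (tau : R[i]) (n : 'I_4 -> nat)
    (c0 : {poly R[i]}) (b : forall k : 'I_4, 'I_(n k) -> {poly R[i]})
    (E z : R[i]) : R[i] :=
  c0.[E] + \sum_(k < 4) \sum_(j < n k)
    (b k j).[E] * wp tau (z + omega tau k / 2) ^+ (n k - j).

Definition is_Phi_coefs (R : realType) (tau : R[i]) (n : 'I_4 -> nat)
    (c0 : {poly R[i]}) (b : forall k : 'I_4, 'I_(n k) -> {poly R[i]}) : Prop :=
  [/\ c0 \is monic,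
      forall k j, (size (b k j) < size c0)%N,
      forall d : {poly R[i]}, d %| c0 -> (forall k j, d %| b k j) ->
        size d = 1%N,
      forall E, even_elliptic tau n (Phi tau c0 b E) /\
        third_order_solution tau n E (Phi tau c0 b E) &
      forall E f, even_elliptic tau n f -> third_order_solution tau n E f ->
        exists c : R[i], forall z, regular_pt tau n z ->
          f z = c * Phi tau c0 b E z].

Definition is_spectral_poly (R : realType) (tau : R[i]) (n : 'I_4 -> nat)
    (Q : {poly R[i]}) : Prop :=
  exists (c0 : {poly R[i]}) (b : forall k : 'I_4, 'I_(n k) -> {poly R[i]}),
    is_Phi_coefs tau c0 b /\
    forall E z, regular_pt tau n z ->
      let F := Phi tau c0 b E in
      Q.[E] = potential tau n E z * F z ^+ 2
              + 4^-1 * cderive F z ^+ 2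
              - 2^-1 * F z * cderive (cderive F) z.

(* Main.v *)
(* On a horizontal or vertical line [z = z0 + zeta x], with [zeta] equal to [1]
   or [i], the equation reads [y'' = (q + E) y] with [q] periodic and
   [conj (q (- x)) = q x]; this uses that [Phi] and [Q] are invariant under
   complex conjugation, because [tau] is purely imaginary.
   The matrix [M = [[- Phi'/2, Phi], [(q + E) Phi - Phi''/2, Phi'/2]]] satisfies
   [M^2 = Q(E)] and is transported by the equation, so the transfer matrix over
   a period is [alpha + beta M], with [alpha^2 - 1 = beta^2 Q] and
   [d alpha / dE = beta P / 2], where [P] is the integral of [Phi] over a period.
   If the zeros of [Q] are real and simple, [beta^2 Q >= 0] vanishes at both ends
   of every bounded interval on which [Q > 0], so [P] has a zero inside each of
   them, and these are all its zeros. By this interlacing the larger eigenvalue of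
   the transfer matrix grows in modulus away from the real axis, and the transfer
   matrix can be conjugate to an element of SU(2) only if [Q(E)] is real and
   negative. Passing to a vertical line exchanges [(E, Q(E))] with
   [(- E, - Q(E))], so a unitary monodromy would give both [Q(E) < 0] and
   [Q(E) > 0]. *)
Require Import Defs.
From HB Require Import structures.
From mathcomp Require Import all_boot all_order all_algebra.
From mathcomp Require Import all_classical all_reals all_analysis.
From mathcomp.real_closed Require Import complex.
From mathcomp Require Import separable qpoly.
From mathcomp Require Import ring lra zify.

Set Implicit Arguments.
Unset Strict Implicit.
Unset Printing Implicit Defensive.

Import Order.TTheory GRing.Theory Num.Theory.
Import numFieldNormedType.Exports.

Local Open Scope classical_set_scope.
Local Open Scope ring_scope.

Local Notation Re := complex.Re.
Local Notation Im := complex.Im.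
Local Notation normc := ComplexField.Normc.normc.
Local Notation "x %:C" := (real_complex _ x) (format "x %:C") : ring_scope.

(** * Calculus along curves in the complex plane *)

Section CurveCalculus.
Context {R : realType}.
Local Notation C := R[i].
Implicit Types (f g : R -> R) (u v : R -> C) (x y t : R) (a b l m : C).

Lemma ReM a b : Re (a * b) = Re a * Re b - Im a * Im b.
Proof. by case: a b => [? ?] []. Qed.

Lemma ImM a b : Im (a * b) = Re a * Im b + Im a * Re b.
Proof. by case: a b => [? ?] []. Qed.

Lemma ReD a b : Re (a + b) = Re a + Re b.
Proof. by case: a b => [? ?] []. Qed.

Lemma ImD a b : Im (a + b) = Im a + Im b.
Proof. by case: a b => [? ?] []. Qed.

Lemma ReN a : Re (- a) = - Re a.
Proof. by case: a. Qed.

Lemma ImN a : Im (- a) = - Im a.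
Proof. by case: a. Qed.

Lemma complex_ext a b : Re a = Re b -> Im a = Im b -> a = b.
Proof. by case: a b => [? ?] [? ?] /= -> ->. Qed.

Lemma conjD a b : ((a + b)^*)%C = (a^*)%C + (b^*)%C.
Proof. exact: rmorphD. Qed.

Lemma conjB a b : ((a - b)^*)%C = (a^*)%C - (b^*)%C.
Proof. exact: rmorphB. Qed.

Lemma conjM a b : ((a * b)^*)%C = (a^*)%C * (b^*)%C.
Proof. exact: rmorphM. Qed.

Lemma conjV a : ((a^-1)^*)%C = (a^*)%C^-1.
Proof. exact: fmorphV. Qed.

Lemma conj_nat k : ((k%:R : C)^*)%C = k%:R.
Proof. exact: (rmorph_nat conjc k). Qed.

Lemma normcE2 a : normc a ^+ 2 = Re a ^+ 2 + Im a ^+ 2.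
Proof. by case: a => p q /=; rewrite sqr_sqrtr// addr_ge0// sqr_ge0. Qed.

Lemma normc_ge0 a : 0 <= normc a.
Proof. by case: a => p q; exact: sqrtr_ge0. Qed.

Lemma normc_Re a : `|Re a| <= normc a.
Proof.
by case: a => p q /=; rewrite -sqrtr_sqr ler_wsqrtr// lerDl sqr_ge0.
Qed.

Lemma normc_Im a : `|Im a| <= normc a.
Proof.
by case: a => p q /=; rewrite -sqrtr_sqr ler_wsqrtr// lerDr sqr_ge0.
Qed.

Lemma normc_le_ReIm a : normc a <= `|Re a| + `|Im a|.
Proof.
rewrite -(ler_pXn2r (n := 2))// ?nnegrE ?normc_ge0 ?addr_ge0//.
rewrite normcE2 -[Re a ^+ 2]real_normK ?num_real// -[Im a ^+ 2]real_normK ?num_real//.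
by have := mulr_ge0 (normr_ge0 (Re a)) (normr_ge0 (Im a)); nra.
Qed.

Lemma normcD a b : normc (a + b) <= normc a + normc b.
Proof. exact: le_normcD. Qed.

Lemma normcB a b : normc (a - b) <= normc a + normc b.
Proof. by rewrite -(normcN b); exact: le_normcD. Qed.

Lemma normcM a b : normc (a * b) = normc a * normc b.
Proof. exact: ComplexField.Normc.normcM. Qed.

Lemma normc_real x : normc x%:C = `|x|.
Proof. by rewrite /= expr0n/= addr0 sqrtr_sqr. Qed.

Lemma normcJ a : normc a^*%C = normc a.
Proof. by case: a => p q /=; rewrite sqrrN. Qed.

Lemma normc0_eq0 a : normc a = 0 -> a = 0.
Proof. exact: ComplexField.Normc.eq0_normc. Qed.

Lemma normc_eq0 a : (normc a == 0) = (a == 0).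
Proof.
apply/eqP/eqP => [/normc0_eq0//|->]; exact: ComplexField.Normc.normc0.
Qed.

Lemma normc_gt0 a : (0 < normc a) = (a != 0).
Proof. by rewrite lt0r normc_ge0 andbT normc_eq0. Qed.

Lemma normC_normc a : `|a| = (normc a)%:C.
Proof. by case: a. Qed.

Lemma is_derive_mul f g x p q : is_derive x 1 f p -> is_derive x 1 g q ->
  is_derive x 1 (fun t => f t * g t) (f x * q + p * g x).
Proof.
by move=> df dg; have := is_deriveM df dg; rewrite /GRing.scale/= [g x * p]mulrC.
Qed.

Lemma is_derive_add f g x p q : is_derive x 1 f p -> is_derive x 1 g q ->
  is_derive x 1 (fun t => f t + g t) (p + q).
Proof. exact: is_deriveD. Qed.

Lemma is_derive_sub f g x p q : is_derive x 1 f p -> is_derive x 1 g q ->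
  is_derive x 1 (fun t => f t - g t) (p - q).
Proof. exact: is_deriveB. Qed.

(* Curves in the complex plane are differentiated componentwise: [R[i]] is not
   a normed module over [R] in the library. *)
Definition cder u x l :=
  is_derive x 1 (fun t => Re (u t)) (Re l) /\
  is_derive x 1 (fun t => Im (u t)) (Im l).

Lemma cder_eq u x l m : cder u x l -> l = m -> cder u x m.
Proof. by move=> ? <-. Qed.

Lemma cder_uniq u x l m : cder u x l -> cder u x m -> l = m.
Proof.
by move=> [[_ h1] [_ h2]] [[_ h3] [_ h4]]; apply: complex_ext;
  [rewrite -h1 -h3|rewrite -h2 -h4].
Qed.

Lemma cder_cst a x : cder (fun=> a) x 0.
Proof. by split; exact: is_derive_cst. Qed.

Lemma cderD u v x l m : cder u x l -> cder v x m ->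
  cder (fun t => u t + v t) x (l + m).
Proof.
move=> [u1 u2] [v1 v2]; split.
  under eq_fun do rewrite ReD; rewrite ReD; exact: is_deriveD.
under eq_fun do rewrite ImD; rewrite ImD; exact: is_deriveD.
Qed.

Lemma cderN u x l : cder u x l -> cder (fun t => - u t) x (- l).
Proof.
move=> [u1 u2]; split.
  under eq_fun do rewrite ReN; rewrite ReN; exact: is_deriveN.
under eq_fun do rewrite ImN; rewrite ImN; exact: is_deriveN.
Qed.

Lemma cderB u v x l m : cder u x l -> cder v x m ->
  cder (fun t => u t - v t) x (l - m).
Proof. by move=> du dv; apply: cderD => //; exact: cderN. Qed.

Lemma cderM u v x l m : cder u x l -> cder v x m ->
  cder (fun t => u t * v t) x (l * v x + u x * m).
Proof.
move=> [u1 u2] [v1 v2]; split.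
  under eq_fun do rewrite ReM.
  apply: is_derive_eq (is_derive_sub (is_derive_mul u1 v1) (is_derive_mul u2 v2)) _.
  by rewrite ReD !ReM; ring.
under eq_fun do rewrite ImM.
apply: is_derive_eq (is_derive_add (is_derive_mul u1 v2) (is_derive_mul u2 v1)) _.
by rewrite ImD !ImM; ring.
Qed.

Lemma cderMl a u x l : cder u x l -> cder (fun t => a * u t) x (a * l).
Proof.
move=> du; apply: cder_eq; first exact: (cderM (cder_cst a x) du).
by rewrite mul0r add0r.
Qed.

Lemma cderMr a u x l : cder u x l -> cder (fun t => u t * a) x (l * a).
Proof.
by move=> du; under eq_fun do rewrite mulrC; rewrite mulrC; exact: cderMl.
Qed.

Lemma cder_sum (I : Type) (r : seq I) (u : I -> R -> C) x (l : I -> C) :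
  (forall i, cder (u i) x (l i)) ->
  cder (fun t => \sum_(i <- r) u i t) x (\sum_(i <- r) l i).
Proof.
move=> du; elim: r => [|i r IH].
  by under eq_fun do rewrite big_nil; rewrite big_nil; exact: cder_cst.
by under eq_fun do rewrite big_cons; rewrite big_cons; exact: cderD.
Qed.

Lemma cderJ u x l : cder u x l -> cder (fun t => (u t)^*%C) x l^*%C.
Proof.
move=> [u1 u2]; split.
  suff -> : (fun t => Re (u t)^*%C) = (fun t => Re (u t)) by case: l u1 u2.
  by apply/funext => t; case: (u t).
have -> : (fun t => Im (u t)^*%C) = (fun t => - Im (u t)).
  by apply/funext => t; case: (u t).
by have -> : Im l^*%C = - Im l; [case: l {u1 u2}|exact: is_deriveN].
Qed.

Lemma cder_real f x p : is_derive x 1 f p -> cder (fun t => (f t)%:C) x p%:C.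
Proof. by move=> df; split => //=; exact: is_derive_cst. Qed.

Lemma cder_id x : cder (fun t => t%:C) x 1.
Proof. by apply: cder_eq; [exact: cder_real (is_derive_id _ _)|]. Qed.

Lemma cder_line a b x : cder (fun t => a + b * t%:C) x b.
Proof.
apply: cder_eq; first exact: cderD (cder_cst a x) (cderMl b (cder_id x)).
by rewrite add0r mulr1.
Qed.

Lemma cder_comp u f x l p : cder u (f x) l -> is_derive x 1 f p ->
  cder (fun t => u (f t)) x (l * p%:C).
Proof.
move=> [u1 u2] df; split.
  have := is_derive1_comp u1 df; rewrite ReM /= mulr0 subr0; exact.
have := is_derive1_comp u2 df; rewrite ImM /= mulr0 add0r; exact.
Qed.

Lemma cder_opp u x l : cder u (- x) l -> cder (fun t => u (- t)) x (- l).
Proof.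
move=> du; apply: cder_eq; first exact: (cder_comp du (is_deriveNid _ _)).
by rewrite rmorphN1 mulrN1.
Qed.

Lemma cder_shift u x y l : cder u (x + y) l -> cder (fun t => u (t + y)) x l.
Proof.
move=> du; apply: cder_eq; first exact: (cder_comp (f := fun t => t + y) du (is_derive_shift x 1 y)).
by rewrite rmorph1 mulr1.
Qed.

Lemma cder_poly (p : {poly C}) u x l : cder u x l ->
  cder (fun t => p.[u t]) x (l * (p^`()).[u x]).
Proof.
move=> du; elim/poly_ind: p => [|p a IH].
  under eq_fun do rewrite horner0; rewrite deriv0 horner0 mulr0; exact: cder_cst.
under eq_fun do rewrite hornerMXaddC.
apply: cder_eq; first exact: cderD (cderM IH du) (cder_cst a x).
by rewrite derivMXaddC hornerD hornerMX; ring.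
Qed.

Lemma cder_inv u x l : u x != 0 -> cder u x l ->
  cder (fun t => (u t)^-1) x (- l / u x ^+ 2).
Proof.
move=> ux0 [u1 u2].
pose n t := Re (u t) ^+ 2 + Im (u t) ^+ 2.
have nx0 : n x != 0 by rewrite /n -normcE2 expf_eq0/= normc_eq0.
have uE t : (u t)^-1 = ((u t)^*)%C * ((n t)^-1)%:C.
  rewrite /n; case: (u t) => p q /=; apply: complex_ext; rewrite ?ReM ?ImM /=; ring.
have dn : is_derive x 1 n (2 * (Re (u x) * Re l + Im (u x) * Im l)).
  apply: is_derive_eq (is_derive_add (is_derive_mul u1 u1) (is_derive_mul u2 u2)) _.
  by ring.
under eq_fun do rewrite uE.
apply: cder_eq.
  apply: cderM; first by apply: cderJ; split; [exact: u1|exact: u2].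
  by apply: cder_real; apply: is_deriveV => //; exact: dn.
rewrite /GRing.scale/= -!exprVn uE; set w := (n x)^-1.
have wn : w%:C = (n x)%:C * w%:C ^+ 2 :> C.
  by rewrite -rmorphXn -rmorphM /w expr2 mulVKf.
have key : (l^*)%C * (n x)%:C -
    ((u x)^*)%C * (2 * (Re (u x) * Re l + Im (u x) * Im l))%:C =
    - l * ((u x)^*)%C ^+ 2.
  rewrite /n; case: (u x) l {u1 u2 dn} => p q [p' q'] /=.
  by apply: complex_ext; rewrite ?expr2 ?(ReM,ImM,ReD,ImD,ReN,ImN) /= ?(ReM,ImM)/=; ring.
have -> : - l * (((u x)^*)%C * w%:C) ^+ 2 = (- l * ((u x)^*)%C ^+ 2) * w%:C ^+ 2.
  by ring.
rewrite -key {1}wn mulNr rmorphN rmorphM rmorphXn/=; ring.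
Qed.

Lemma cder_cont u x l : cder u x l ->
  {for x, continuous (fun t => Re (u t))} /\ {for x, continuous (fun t => Im (u t))}.
Proof.
by move=> [[u1 _] [u2 _]]; split; apply: differentiable_continuous;
  exact/derivable1_diffP.
Qed.

Lemma cder0_cst u x y : (forall t, cder u t 0) -> u x = u y.
Proof.
move=> du; apply: complex_ext.
  by apply: (is_derive_0_is_cst (f := fun t => Re (u t))) => t; case: (du t).
by apply: (is_derive_0_is_cst (f := fun t => Im (u t))) => t; case: (du t).
Qed.

Lemma is_derive_ler f df x y : x <= y ->
  (forall t, x <= t <= y -> is_derive t 1 f (df t)) ->
  (forall t, x <= t <= y -> 0 <= df t) -> f x <= f y.
Proof.
move=> xy d dge0.
have [|//|c cxy] := @MVT_segment R f df x y xy.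
- by move=> t; rewrite in_itv/= => /andP[? ?]; apply: d; rewrite !ltW.
- apply: derivable_within_continuous => t; rewrite in_itv/= => /d[]; exact.
- move=> fE; rewrite -subr_ge0 fE mulr_ge0 ?subr_ge0//; apply: dge0.
  by rewrite in_itv in cxy.
Qed.

Lemma is_derive0_eq f x y : x <= y ->
  (forall t, x <= t <= y -> is_derive t 1 f 0) -> f x = f y.
Proof.
move=> xy df; apply/eqP; rewrite eq_le; apply/andP; split.
  exact: (is_derive_ler (df := fun=> 0)).
rewrite -lerN2; apply: (is_derive_ler (f := fun t => - f t) (df := fun=> 0)) => //.
by move=> t /df d; rewrite -oppr0; exact: is_deriveN.
Qed.

(* Rotating [u y - u x] onto the positive real axis reduces the estimate to the
   real case. *)
Lemma cder_mvt u du g dg x y : x <= y ->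
  (forall t, x <= t <= y -> cder u t (du t)) ->
  (forall t, x <= t <= y -> is_derive t 1 g (dg t)) ->
  (forall t, x <= t <= y -> normc (du t) <= dg t) ->
  normc (u y - u x) <= g y - g x.
Proof.
move=> xy hu hg hle; set D := u y - u x.
have dg0 t : x <= t <= y -> 0 <= dg t.
  by move=> /hle; apply: le_trans; exact: normc_ge0.
have gxy : g x <= g y by apply: is_derive_ler (hg) (dg0).
have [D0|D0] := eqVneq D 0.
  by rewrite D0 ComplexField.Normc.normc0 subr_ge0.
have nD : 0 < normc D by rewrite normc_gt0.
have key : g x * normc D - Re (D^*%C * u x) <= g y * normc D - Re (D^*%C * u y).
  apply: (is_derive_ler (f := fun t => g t * normc D - Re (D^*%C * u t))
    (df := fun t => dg t * normc D - Re (D^*%C * du t))) => // t txy.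
    apply: is_derive_sub; last by have [] := cderMl D^*%C (hu _ txy).
    apply: is_derive_eq (is_derive_mul (hg _ txy) (is_derive_cst _ _ _)) _.
    by rewrite mulr0 add0r.
  rewrite subr_ge0; apply: le_trans (ler_norm _) _.
  apply: le_trans (normc_Re _) _.
  by rewrite normcM normcJ mulrC ler_wpM2r ?normc_ge0 ?hle.
have -> : normc D = normc D ^+ 2 / normc D by rewrite expr2 mulfK ?gt_eqF.
rewrite ler_pdivrMr//.
suff -> : normc D ^+ 2 = Re (D^*%C * u y) - Re (D^*%C * u x) by move: key; rewrite mulrBl; lra.
rewrite normcE2 !ReM /D; case: (u x) (u y) => ? ? [? ?] /=; ring.
Qed.

Lemma primitive_locally f (N : R) : continuous f -> 0 < N ->
  exists F, F 0 = 0 /\ forall x, - N < x < N -> is_derive x 1 F (f x).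
Proof.
move=> cf N0.
pose G x := (\int[lebesgue_measure]_(t in `[- N, x]) (f t))%R.
exists (fun x => G x - G 0); split; first by rewrite subrr.
move=> x /andP[x1 x2].
have fi : lebesgue_measure.-integrable `[- N, N] (EFin \o f).
  by apply: continuous_compact_integrable; [exact: segment_compact|
    exact: continuous_subspaceT].
have [dG <-] := continuous_FTC1_closed x2 fi x1 (cf x).
apply: is_derive_eq (is_derive_sub (derivableP dG) (is_derive_cst _ _ _)) _.
by rewrite subr0 derive1E.
Qed.

End CurveCalculus.

(** * Linear differential equations of order two *)

Section LinearODE.
Context {R : realType}.
Local Notation C := R[i].
Implicit Types (f g : R -> R) (u v q : R -> C) (x y t : R) (a b l m : C).

Lemma primitive_exists f : continuous f ->
  exists F, F 0 = 0 /\ forall x, is_derive x 1 F (f x).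
Proof.
move=> cf.
have /choice[G GP] : forall N : nat, exists F, F 0 = 0 /\
    forall x, - N.+1%:R < x < N.+1%:R -> is_derive x 1 F (f x).
  by move=> N; apply: primitive_locally.
have agree N M x : (N <= M)%N -> `|x| < N.+1%:R -> G N x = G M x.
  move=> NM xN.
  have [GN0 GN] := GP N; have [GM0 GM] := GP M.
  pose D t := G N t - G M t.
  have dD t : `|t| <= `|x| -> is_derive t 1 D 0.
    move=> tx; have tN := le_lt_trans tx xN.
    have tM : `|t| < M.+1%:R by rewrite (lt_le_trans tN)// ler_nat.
    rewrite -(subrr (f t)); apply: is_derive_sub.
      by apply: GN; rewrite -ltr_norml.
    by apply: GM; rewrite -ltr_norml.
  have D0 : D 0 = 0 by rewrite /D GN0 GM0 subrr.
  apply/eqP; rewrite -subr_eq0 -/(D x); apply/eqP.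
  have [x0|/ltW x0] := leP 0 x; rewrite -D0.
    by apply/esym; apply: is_derive0_eq => // t /andP[? ?]; apply: dD; rewrite !ger0_norm.
  apply: is_derive0_eq => // t /andP[? ?]; apply: dD.
  by rewrite !ler0_norm// lerN2.
have agree2 N M x : `|x| < N.+1%:R -> `|x| < M.+1%:R -> G N x = G M x.
  move=> xN xM; have [NM|/ltnW MN] := leqP N M; first exact: agree.
  by apply/esym/agree.
exists (fun x => G (Num.truncn `|x|) x); split; first by case: (GP (Num.truncn `|0 : R|)).
move=> x; pose M := (Num.truncn `|x|).+1.
have tr (z : R) : `|z| < (Num.truncn `|z|).+1%:R by rewrite truncnS_gt.
apply: (near_eq_is_derive (f := G M)); last first.
  apply: (GP M).2; rewrite -ltr_norml (lt_le_trans (tr x))// ler_nat /M.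
  by rewrite ltnW.
near=> t; apply: agree2 => //.
have tx : `|x - t| < 1 by near: t; exact: nbhsx_ballx.
rewrite distrC in tx. move: (ler_normD (t - x) x); rewrite subrK => h.
rewrite (le_lt_trans h)// /M -natr1 addrC ltrD// tr//.
Unshelve. all: by end_near. Qed.

Definition ccontinuous u :=
  continuous (fun t => Re (u t)) /\ continuous (fun t => Im (u t)).

Lemma cder_ccontinuous u v : (forall x, cder u x (v x)) -> ccontinuous u.
Proof. by move=> du; split=> x; case: (cder_cont (du x)). Qed.

Lemma ccontinuousD u v : ccontinuous u -> ccontinuous v ->
  ccontinuous (fun t => u t + v t).
Proof.
move=> [u1 u2] [v1 v2]; split.
  by under eq_fun do rewrite ReD; move=> x; apply: cvgD; [exact: u1|exact: v1].
by under eq_fun do rewrite ImD; move=> x; apply: cvgD; [exact: u2|exact: v2].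
Qed.

Lemma ccontinuousM u v : ccontinuous u -> ccontinuous v ->
  ccontinuous (fun t => u t * v t).
Proof.
move=> [u1 u2] [v1 v2]; split.
  under eq_fun do rewrite ReM; move=> x; apply: cvgB; apply: cvgM;
    by first [exact: u1|exact: v1|exact: u2|exact: v2].
under eq_fun do rewrite ImM; move=> x; apply: cvgD; apply: cvgM;
  by first [exact: u1|exact: v1|exact: u2|exact: v2].
Qed.

Lemma ccontinuous_cst a : ccontinuous (fun=> a).
Proof. by split=> x; exact: cvg_cst. Qed.

Lemma cprimitive_exists u : ccontinuous u ->
  exists U : R -> C, U 0 = 0 /\ forall x, cder U x (u x).
Proof.
move=> [/primitive_exists[F [F0 dF]] /primitive_exists[G [G0 dG]]].
exists (fun x => (F x +i* G x)%C); split; first by rewrite F0 G0.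
by move=> x; split; [exact: dF|exact: dG].
Qed.

Lemma cder_bound u du g dg x : u 0 = 0 -> (forall t, cder u t (du t)) ->
  (forall t, is_derive t 1 g (dg t)) ->
  (forall t, normc (du t) <= dg `|t|) -> normc (u x) <= g `|x| - g 0.
Proof.
move=> u0 hu hg hle; have [x0|x0] := leP 0 x.
  rewrite ger0_norm// -[u x]subr0 -u0.
  apply: (cder_mvt (du := du) (dg := dg)) => // t /andP[t0 _].
  by rewrite -[in dg t](ger0_norm t0).
rewrite ltr0_norm//.
have := @cder_mvt _ (fun t => u (- t)) (fun t => - du (- t)) g dg 0 (- x).
rewrite opprK oppr0 u0 subr0; apply => //.
- by rewrite oppr_ge0 ltW.
- by move=> t _; exact: cder_opp.
- by move=> t /andP[t0 _]; rewrite normcN -[in dg t](ger0_norm t0) -normrN.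
Qed.

Lemma geo_cauchy (r : nat -> R) c : (forall k, `|r k.+1 - r k| <= c / 2 ^+ k) ->
  exists s : R, forall k, `|r k - s| <= 2 * c / 2 ^+ k.
Proof.
move=> hr.
have p2 k : (0 : R) < 2 ^+ k by rewrite exprn_gt0.
have c0 : 0 <= c by have := le_trans (normr_ge0 _) (hr 0%N); rewrite expr0 divr1.
have half k : c / 2 ^+ k = 2 * c / 2 ^+ k - 2 * c / 2 ^+ k.+1.
  by rewrite exprS; field; rewrite gt_eqF.
pose lo k := r k - 2 * c / 2 ^+ k; pose hi k := r k + 2 * c / 2 ^+ k.
have lo_step k : lo k <= lo k.+1.
  by have := hr k; rewrite half ler_norml /lo => /andP[]; lra.
have hi_step k : hi k.+1 <= hi k.
  by have := hr k; rewrite half ler_norml /hi => /andP[]; lra.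
have lo_mono k j : lo k <= lo (k + j)%N.
  by elim: j => [|j IH]; rewrite ?addn0// addnS (le_trans IH).
have hi_mono k j : hi (k + j)%N <= hi k.
  by elim: j => [|j IH]; rewrite ?addn0// addnS (le_trans _ IH).
have lohi k j : lo k <= hi j.
  rewrite (le_trans (lo_mono k j))// (le_trans _ (hi_mono j k))// addnC /lo /hi.
  have : 0 <= 2 * c / 2 ^+ (j + k) by rewrite divr_ge0 ?mulr_ge0// ltW.
  by lra.
have hs : has_sup (range lo).
  by split; [exists (lo 0%N), 0%N|exists (hi 0%N) => _ [k _ <-]].
exists (sup (range lo)) => k.
have h1 : lo k <= sup (range lo) by apply: ub_le_sup; [exact: hs.2|exists k].
have h2 : sup (range lo) <= hi k by apply: ge_sup => [|_ [j _ <-]]; [exact: hs.1|].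
by move: h1 h2; rewrite /lo /hi ler_norml => h1 h2; apply/andP; lra.
Qed.

Lemma geo_cauchyC (r : nat -> C) c :
  (forall k, normc (r k.+1 - r k) <= c / 2 ^+ k) ->
  exists l, forall k, normc (r k - l) <= 4 * c / 2 ^+ k.
Proof.
move=> hr.
have [l1 h1] : exists s : R, forall k, `|Re (r k) - s| <= 2 * c / 2 ^+ k.
  apply: geo_cauchy => k; apply: le_trans (hr k).
  by rewrite -ReN -ReD normc_Re.
have [l2 h2] : exists s : R, forall k, `|Im (r k) - s| <= 2 * c / 2 ^+ k.
  apply: geo_cauchy => k; apply: le_trans (hr k).
  by rewrite -ImN -ImD normc_Im.
exists (l1 +i* l2)%C => k; apply: le_trans (normc_le_ReIm _) _.
rewrite ReD ImD ReN ImN /=; have := h1 k; have := h2 k.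
by rewrite -!mulrA -/(_ / _); lra.
Qed.

Lemma geo_le0 (r c : R) : (forall k, r <= c / 2 ^+ k) -> r <= 0.
Proof.
move=> h; rewrite leNgt; apply/negP => r0.
have c0 : 0 < c by have := h 0%N; rewrite expr0 divr1; exact: lt_le_trans.
pose k := Num.truncn (c / r).
have ck : c / r < k.+1%:R by rewrite truncnS_gt.
have : k.+1%:R <= 2 ^+ k.+1 :> R by rewrite -natrX ler_nat ltnW// ltn_expl.
have := h k.+1; rewrite ler_pdivlMr ?exprn_gt0// => h1 h2.
move: ck; rewrite ltr_pdivrMr// => h3.
have := lt_le_trans h3 (ler_wpM2r (ltW r0) h2).
by rewrite mulrC ltNge h1.
Qed.

Lemma continuous_geo_limit (fk : nat -> R -> R) f g :
  (forall k, continuous (fk k)) -> (forall s t, s <= t -> g s <= g t) ->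
  (forall k t, `|fk k t - f t| <= g `|t| / 2 ^+ k) -> continuous f.
Proof.
move=> cf gmono hf x; apply/cvgrPdist_le => e e0.
pose B := g (`|x| + 1).
have [k hk] : exists k, B / 2 ^+ k <= e / 3.
  apply: contrapT => /forallNP h.
  have : e / 3 <= 0.
    by apply: (@geo_le0 _ B) => k; apply: ltW; rewrite ltNge; apply/negP/h.
  by apply/negP; rewrite -ltNge divr_gt0.
have bnd t : `|t| <= `|x| + 1 -> `|fk k t - f t| <= e / 3.
  move=> ht; apply: le_trans (hf k t) _; apply: le_trans hk.
  by rewrite ler_wpM2r ?invr_ge0 ?exprn_ge0// gmono.
near=> t.
have tx : `|t - x| <= 1.
  by rewrite distrC ltW//; near: t; exact: nbhsx_ballx.
have h1 : `|fk k t - f t| <= e / 3.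
  by apply: bnd; have := ler_normD (t - x) x; rewrite subrK; lra.
have h2 : `|fk k x - f x| <= e / 3 by apply: bnd; rewrite lerDl.
have h3 : `|fk k x - fk k t| <= e / 3.
  by near: t; have /cvgrPdist_le := cf k x; apply; rewrite divr_gt0.
move: h1 h2 h3; rewrite !ler_norml => /andP[? ?] /andP[? ?] /andP[? ?].
by apply/andP; lra.
Unshelve. all: by end_near. Qed.

Lemma expRmul_derive (A c t : R) :
  is_derive t 1 (fun s => A * expR (c * s)) (A * (c * expR (c * t))).
Proof.
have d : is_derive t 1 (fun s => c * s) c.
  apply: is_derive_eq (is_derive_mul (is_derive_cst c t 1) (is_derive_id t 1)) _.
  by rewrite mul0r addr0 mulr1.
have h := is_derive1_comp (is_derive_expR (c * t)) d.
apply: is_derive_eq (is_derive_mul (is_derive_cst A t 1) h) _.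
by rewrite mul0r addr0 [expR _ * c]mulrC.
Qed.

Lemma ode_exists q (K : R) a b : ccontinuous q ->
  (forall x, normc (q x) <= K) ->
  exists u v : R -> C, [/\ u 0 = a, v 0 = b, forall x, cder u x (v x) &
    forall x, cder v x (q x * u x)].
Proof.
move=> cq qK0; wlog K1 : K qK0 / 1 <= K.
  move=> /(_ (Num.max 1 K)); apply => [x|]; last by rewrite le_max lexx.
  by rewrite le_max qK0 orbT.
have prim (u : {u | ccontinuous u}) := cid (cprimitive_exists (svalP u)).
have cprim u : ccontinuous u -> exists U : {U | ccontinuous U},
    sval U 0 = 0 /\ forall x, cder (sval U) x (u x).
  move=> /cprimitive_exists[U [U0 dU]].
  by exists (exist _ U (cder_ccontinuous dU)).
have cstep (p : {u | ccontinuous u} * {v | ccontinuous v}) :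
    exists p' : {u | ccontinuous u} * {v | ccontinuous v},
    [/\ sval p'.1 0 = a, sval p'.2 0 = b,
      forall x, cder (sval p'.1) x (sval p.2 x) &
      forall x, cder (sval p'.2) x (q x * sval p.1 x)].
  have [U [U0 dU]] := cprimitive_exists (svalP p.2).
  have [V [V0 dV]] := cprimitive_exists (ccontinuousM cq (svalP p.1)).
  have dU' x : cder (fun t => a + U t) x (sval p.2 x).
    by apply: cder_eq; [exact: cderD (cder_cst a x) (dU x)|rewrite add0r].
  have dV' x : cder (fun t => b + V t) x (q x * sval p.1 x).
    by apply: cder_eq; [exact: cderD (cder_cst b x) (dV x)|rewrite add0r].
  exists (exist _ _ (cder_ccontinuous dU'), exist _ _ (cder_ccontinuous dV')).
  by split => //=; rewrite ?U0 ?V0 addr0.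
move: cstep => /choice[step stepP] {cprim prim}.
pose p0 : {u | ccontinuous u} * {v | ccontinuous v} :=
  (exist _ _ (ccontinuous_cst a), exist _ _ (ccontinuous_cst b)).
pose p k := iter k step p0.
pose yk k := sval (p k).1; pose zk k := sval (p k).2.
have yk0 k : yk k 0 = a by case: k => [|k] //; case: (stepP (p k)).
have zk0 k : zk k 0 = b by case: k => [|k] //; case: (stepP (p k)).
have dyk k x : cder (yk k.+1) x (zk k x) by case: (stepP (p k)).
have dzk k x : cder (zk k.+1) x (q x * yk k x) by case: (stepP (p k)).
pose A := normc a + normc b.
have A0 : 0 <= A by rewrite addr_ge0 ?normc_ge0.
have K0 : 0 <= K by rewrite (le_trans ler01).
pose G (t : R) := A * expR (2 * K * t).
have G1 (t : R) : 0 <= t -> A <= G t.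
  by move=> t0; rewrite ler_peMr// -expR0 ler_expR mulr_ge0// mulr_ge0.
have G0 t : 0 <= G t by rewrite mulr_ge0// expR_ge0.
have p2 k : (0 : R) < 2 ^+ k by rewrite exprn_gt0.
have dG k t : is_derive t 1 (fun t => G t / 2 ^+ k.+1) (K * (G t / 2 ^+ k)).
  apply: is_derive_eq (is_derive_mul (expRmul_derive A (2 * K) t) (is_derive_cst ((2 : R) ^+ k.+1)^-1 t 1)) _.
  by rewrite /cst mulr0 add0r /G exprS; field; rewrite gt_eqF.
have KG k t : G t / 2 ^+ k <= K * (G t / 2 ^+ k).
  by rewrite ler_peMl// divr_ge0// ltW.
have bound k x :
    normc (yk k.+1 x - yk k x) <= G `|x| / 2 ^+ k /\
    normc (zk k.+1 x - zk k x) <= G `|x| / 2 ^+ k.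
  elim: k x => [|k IH] x.
    pose g (t : R) := G t / 2 ^+ 0 - A.
    have dg (t : R) : is_derive t 1 g (2 * (K * G t)).
      apply: is_derive_eq (is_derive_sub (is_derive_mul (expRmul_derive A (2 * K) t) (is_derive_cst ((2 : R) ^+ 0)^-1 t 1)) (is_derive_cst A t 1)) _.
      by rewrite /cst expr0 mulr0 subr0 add0r invr1 mulr1 /G; ring.
    have g00 : g 0 = 0 by rewrite /g expr0 divr1 /G mulr0 expR0 mulr1 subrr.
    have gle (t : R) : g t <= G t / 2 ^+ 0 by rewrite gerBl.
    have hA (t : R) : 0 <= t -> K * A <= 2 * (K * G t).
      move=> t0; have h := ler_wpM2l K0 (G1 _ t0).
      by have := mulr_ge0 K0 (G0 t); lra.
    have KA : A <= K * A by rewrite ler_peMl.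
    have gle2 : g `|x| - g 0 <= G `|x| / 2 ^+ 0 by rewrite g00 subr0.
    split; apply: le_trans gle2.
      apply: (cder_bound (u := fun t => yk 1 t - yk 0 t) (g := g) (du := fun t => zk 0 t - 0) (dg := fun t => 2 * (K * G t))) => //.
      - by rewrite !yk0 subrr.
      - by move=> t; apply: cderB (dyk 0 t) (cder_cst _ _).
      - move=> t; rewrite subr0 /zk/=; apply: le_trans (hA _ (normr_ge0 t)).
        by apply: le_trans KA; rewrite lerDr normc_ge0.
    apply: (cder_bound (u := fun t => zk 1 t - zk 0 t) (g := g) (du := fun t => q t * yk 0 t - 0) (dg := fun t => 2 * (K * G t))) => //.
    - by rewrite !zk0 subrr.
    - by move=> t; apply: cderB (dzk 0 t) (cder_cst _ _).
    - move=> t; rewrite subr0 /yk/= normcM; apply: le_trans (hA _ (normr_ge0 t)).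
      by rewrite ler_pM ?normc_ge0// lerDl normc_ge0.
  have gle (t : R) : G t / 2 ^+ k.+1 - G 0 / 2 ^+ k.+1 <= G t / 2 ^+ k.+1.
    by rewrite gerBl divr_ge0// ltW.
  split; apply: le_trans (gle _).
    apply: (cder_bound (u := fun t => yk k.+2 t - yk k.+1 t) (du := fun t => zk k.+1 t - zk k t) (g := fun t => G t / 2 ^+ k.+1)
      (dg := fun t => K * (G t / 2 ^+ k))) => //.
    - by rewrite !yk0 subrr.
    - by move=> t; apply: cderB (dyk _ t) (dyk _ _).
    - by move=> t; apply: le_trans (KG _ _); case: (IH t).
  apply: (cder_bound (u := fun t => zk k.+2 t - zk k.+1 t) (du := fun t => q t * yk k.+1 t - q t * yk k t) (g := fun t => G t / 2 ^+ k.+1)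
      (dg := fun t => K * (G t / 2 ^+ k))) => //.
  - by rewrite !zk0 subrr.
  - by move=> t; apply: cderB (dzk _ t) (dzk _ _).
  - by move=> t; rewrite -mulrBr normcM ler_pM ?normc_ge0//; case: (IH t).
have /choice[Y hY] : forall x, exists l, forall k, normc (yk k x - l) <= 4 * G `|x| / 2 ^+ k.
  by move=> x; apply: geo_cauchyC => k; case: (bound k x).
have /choice[Z hZ] : forall x, exists l, forall k, normc (zk k x - l) <= 4 * G `|x| / 2 ^+ k.
  by move=> x; apply: geo_cauchyC => k; case: (bound k x).
have Gmono (s t : R) : s <= t -> 4 * G s <= 4 * G t.
  by move=> st; rewrite ler_wpM2l// ler_wpM2l// ler_expR ler_wpM2l// mulr_ge0.
have limc (wk : nat -> R -> C) (W : R -> C) : (forall k, ccontinuous (wk k)) ->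
    (forall x k, normc (wk k x - W x) <= 4 * G `|x| / 2 ^+ k) -> ccontinuous W.
  move=> cw hw; split.
    apply: (@continuous_geo_limit (fun k t => Re (wk k t)) _ (fun t => 4 * G t)) => //.
      by move=> k; case: (cw k).
    by move=> k t; rewrite -ReN -ReD (le_trans (normc_Re _)).
  apply: (@continuous_geo_limit (fun k t => Im (wk k t)) _ (fun t => 4 * G t)) => //.
    by move=> k; case: (cw k).
  by move=> k t; rewrite -ImN -ImD (le_trans (normc_Im _)).
have cY : ccontinuous Y by apply: limc hY => k; exact: svalP.
have cZ : ccontinuous Z by apply: limc hZ => k; exact: svalP.
have [U [U0 dU]] := cprimitive_exists cZ.
have [V [V0 dV]] := cprimitive_exists (ccontinuousM cq cY).
have ident (W w W' : R -> C) (wk wk' : nat -> R -> C) c :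
    (forall x, cder W x (w x)) -> (forall k x, cder (wk k.+1) x (wk' k x)) ->
    (forall k x, normc (wk' k x - w x) <= K * (4 * G `|x| / 2 ^+ k)) ->
    (forall k, wk k 0 = c) -> W 0 = 0 ->
    (forall x k, normc (wk k x - W' x) <= 4 * G `|x| / 2 ^+ k) ->
    forall x, W' x = c + W x.
  move=> dW dwk hw wk0 W0 hW' x.
  apply/eqP; rewrite -subr_eq0 -normc_eq0 eq_le normc_ge0 andbT.
  apply: (@geo_le0 _ (4 * G `|x|)) => k.
  have h1 : normc (wk k.+1 x - (c + W x)) <= 4 * G `|x| / 2 ^+ k.+1.
    have : 4 * (G `|x| / 2 ^+ k.+1) - 4 * (G 0 / 2 ^+ k.+1) <= 4 * G `|x| / 2 ^+ k.+1.
      by rewrite mulrA gerBl mulr_ge0// divr_ge0// ltW.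
    apply: le_trans.
    apply: (cder_bound (u := fun t => wk k.+1 t - (c + W t))
      (du := fun t => wk' k t - (0 + w t)) (g := fun t => 4 * (G t / 2 ^+ k.+1))
      (dg := fun t => K * (4 * G t / 2 ^+ k))) => //.
    - by rewrite wk0 W0 addr0 subrr.
    - move=> t; apply: cderB (dwk _ t) _; apply: cderD (cder_cst _ _) (dW t).
    - move=> t; apply: is_derive_eq (is_derive_mul (is_derive_cst (4 : R) t 1) (dG k t)) _.
      by rewrite /cst; ring.
    - by move=> t; rewrite add0r.
  have := normcD (W' x - wk k.+1 x) (wk k.+1 x - (c + W x)).
  rewrite addrA subrK -normcN opprB => h2; apply: le_trans h2 _.
  rewrite -(normcN (W' x - _)) opprB.
  apply: le_trans (lerD (hW' x k.+1) h1) _.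
  rewrite -mulrDl exprS le_eqVlt; apply/orP; left; apply/eqP.
  by field; rewrite gt_eqF.
have YE := ident U Z Y yk zk a dU dyk (fun k x => le_trans (hZ x k) (ler_peMl (divr_ge0 (mulr_ge0 (ler0n _ 4) (G0 _)) (ltW (p2 k))) K1)) yk0 U0 hY.
have hqY k x : normc (q x * yk k x - q x * Y x) <= K * (4 * G `|x| / 2 ^+ k).
  by rewrite -mulrBr normcM ler_pM ?normc_ge0.
have ZE := ident V _ Z zk _ b dV dzk hqY zk0 V0 hZ.
exists Y, Z; split.
- by rewrite YE U0 addr0.
- by rewrite ZE V0 addr0.
- move=> x; rewrite [X in cder X](funext YE); apply: cder_eq.
    exact: cderD (cder_cst a x) (dU x).
  by rewrite add0r.
move=> x; rewrite [X in cder X](funext ZE); apply: cder_eq.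
  exact: cderD (cder_cst b x) (dV x).
by rewrite add0r.
Qed.

End LinearODE.

Section Gronwall.
Context {R : realType}.
Local Notation C := R[i].
Implicit Types (f g : R -> R) (u v q : R -> C) (x y t : R) (a b l m : C).

Lemma Re_conjM a b : Re a * Re b + Im a * Im b <= normc a * normc b.
Proof.
have -> : Re a * Re b + Im a * Im b = Re ((a^*)%C * b).
  by rewrite ReM; case: a b => [? ?] [? ?] /=; ring.
by apply: le_trans (ler_norm _) _; rewrite (le_trans (normc_Re _))// normcM normcJ.
Qed.

Lemma gronwall q (K L F : R) (f u v : R -> C) : 0 <= L -> 0 <= F -> 
  (forall x, 0 <= x <= L -> [/\ cder u x (v x), cder v x (q x * u x + f x),
     normc (q x) <= K & normc (f x) <= F]) ->
  forall x, 0 <= x <= L -> normc (u x) ^+ 2 + normc (v x) ^+ 2 <=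
    (normc (u 0) ^+ 2 + normc (v 0) ^+ 2 + F ^+ 2 * L) * expR ((2 + K) * L).
Proof.
move=> L0 F0 hyp x /andP[x0 xL].
have K0 : 0 <= K.
  by have [|_ _ + _] := hyp 0; [rewrite lexx|apply: le_trans; exact: normc_ge0].
pose N t := normc (u t) ^+ 2 + normc (v t) ^+ 2.
pose D t := 2 * (Re (u t) * Re (v t) + Im (u t) * Im (v t)) +
  2 * (Re (v t) * Re (q t * u t + f t) + Im (v t) * Im (q t * u t + f t)).
have dN t : 0 <= t <= x -> is_derive t 1 N (D t).
  move=> /andP[t0 tx].
  have [|[u1 u2] [v1 v2] _ _] := hyp t; first by rewrite t0 (le_trans tx).
  have -> : N = fun t => (Re (u t) * Re (u t) + Im (u t) * Im (u t)) +
      (Re (v t) * Re (v t) + Im (v t) * Im (v t)).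
    by apply/funext => s; rewrite /N !normcE2 !expr2.
  apply: is_derive_eq (is_derive_add
    (is_derive_add (is_derive_mul u1 u1) (is_derive_mul u2 u2))
    (is_derive_add (is_derive_mul v1 v1) (is_derive_mul v2 v2))) _.
  by rewrite /D; ring.
have Dle t : 0 <= t <= x -> D t <= (2 + K) * N t + F ^+ 2.
  move=> /andP[t0 tx].
  have [|_ _ hq hf] := hyp t; first by rewrite t0 (le_trans tx).
  have h1 := Re_conjM (u t) (v t).
  have h2 := Re_conjM (v t) (q t * u t + f t).
  have h3 : normc (q t * u t + f t) <= K * normc (u t) + F.
    apply: le_trans (normcD _ _) _; rewrite normcM lerD//.
    by rewrite ler_wpM2r ?normc_ge0.
  have h4 := ler_wpM2l (normc_ge0 (v t)) h3.
  have a0 := normc_ge0 (u t); have b0 := normc_ge0 (v t).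
  have s1 := sqr_ge0 (normc (u t) - normc (v t)).
  have s2 := mulr_ge0 K0 s1; have s3 := sqr_ge0 (normc (v t) - F).
  have s4 := sqr_ge0 (normc (u t)).
  rewrite /D /N; nra.
pose M t := N t * expR (- (2 + K) * t).
have dE t : is_derive t 1 (fun s => expR (- (2 + K) * s)) (- (2 + K) * expR (- (2 + K) * t)).
  have := expRmul_derive 1 (- (2 + K)) t.
  by rewrite mul1r; under eq_fun do rewrite mul1r.
have : F ^+ 2 * 0 - M 0 <= F ^+ 2 * x - M x.
  apply: (is_derive_ler (f := fun t => F ^+ 2 * t - M t)
    (df := fun t => F ^+ 2 - (D t - (2 + K) * N t) * expR (- (2 + K) * t))) => // t tx.
    have dl : is_derive t 1 (fun t => F ^+ 2 * t) (F ^+ 2).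
      apply: is_derive_eq (is_derive_mul (is_derive_cst (F ^+ 2) t 1) (is_derive_id t 1)) _.
      by rewrite /cst mul0r addr0 mulr1.
    apply: is_derive_eq (is_derive_sub dl (is_derive_mul (dN t tx) (dE t))) _.
    by ring.
  have e0 := expR_ge0 (- (2 + K) * t).
  have e1 : expR (- (2 + K) * t) <= 1.
    by move/andP: tx => [t0 _]; rewrite expR_le1 mulNr oppr_le0 mulr_ge0// addr_ge0.
  have F2 := sqr_ge0 F.
  rewrite subr_ge0; apply: le_trans (_ : F ^+ 2 * expR (- (2 + K) * t) <= _).
    by rewrite ler_wpM2r// lerBlDl Dle.
  by rewrite ler_piMr.
rewrite mulr0 sub0r {1}/M mulr0 expR0 mulr1 => hM.
have NE : N x = M x * expR ((2 + K) * x).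
  by rewrite /M -mulrA -expRD mulNr addNr expR0 mulr1.
rewrite -/(N x) NE -/(N 0).
have M0 : 0 <= M x by rewrite mulr_ge0 ?expR_ge0// addr_ge0 ?sqr_ge0.
apply: ler_pM; rewrite ?expR_ge0//.
  by have := ler_wpM2l (sqr_ge0 F) xL; lra.
by rewrite ler_expR ler_wpM2l// addr_ge0.
Qed.

Lemma ode_unique q (K : R) u v : (forall x, normc (q x) <= K) ->
  (forall x, cder u x (v x)) -> (forall x, cder v x (q x * u x)) ->
  u 0 = 0 -> v 0 = 0 -> forall x, u x = 0 /\ v x = 0.
Proof.
move=> qK du dv u0 v0.
have pos q' u' v' : (forall x, normc (q' x) <= K) ->
    (forall x, cder u' x (v' x)) -> (forall x, cder v' x (q' x * u' x)) ->
    u' 0 = 0 -> v' 0 = 0 -> forall x, 0 <= x -> u' x = 0 /\ v' x = 0.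
  move=> q'K du' dv' u'0 v'0 x x0.
  have := @gronwall q' K x 0 (fun=> 0) u' v' x0 (lexx 0).
  have h t : 0 <= t <= x -> [/\ cder u' t (v' t), cder v' t (q' t * u' t + 0),
     normc (q' t) <= K & normc (0 : C) <= 0].
    by move=> _; rewrite addr0 ComplexField.Normc.normc0.
  move=> /(_ h x); rewrite x0 lexx u'0 v'0 ComplexField.Normc.normc0.
  rewrite expr0n/= mul0r !addr0 mul0r => /(_ isT) hle.
  have : normc (u' x) ^+ 2 == 0 /\ normc (v' x) ^+ 2 == 0.
    have h1 := sqr_ge0 (normc (u' x)); have h2 := sqr_ge0 (normc (v' x)).
    by split; rewrite eq_le ?h1 ?h2 andbT; lra.
  by rewrite !expf_eq0/= !normc_eq0 => -[/eqP -> /eqP ->].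
move=> x; have [x0|/ltW x0] := leP 0 x; first exact: (pos q).
have [] := pos (fun t => q (- t)) (fun t => u (- t)) (fun t => - v (- t)) _ _ _ _ _ (- x).
- by move=> t.
- by move=> t; exact: cder_opp.
- move=> t; apply: cder_eq; first exact: cderN (cder_opp (dv (- t))).
  by rewrite opprK.
- by rewrite oppr0.
- by rewrite oppr0 v0 oppr0.
- by rewrite oppr_ge0.
by rewrite opprK => -> /eqP; rewrite oppr_eq0 => /eqP.
Qed.

Lemma is_derive_littleo f x p :
  (forall e : R, 0 < e -> exists2 d, 0 < d & forall h, `|h| < d ->
     `|f (x + h) - f x - h * p| <= e * `|h|) -> is_derive x 1 f p.
Proof.
move=> hyp.
have lim : h^-1 *: ((f \o shift x) (h *: (1 : R)) - f x) @[h --> 0^'] --> p.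
  apply/cvgrPdist_le => e e0; have [d d0 hd] := hyp e e0.
  near=> h.
  have h0 : h != 0 by near: h; exact: nbhs_dnbhs_neq.
  have hlt : `|h| < d by near: h; exact: dnbhs0_lt.
  have := hd h hlt; rewrite /= /GRing.scale/= mulr1 [h + x]addrC => hle.
  have -> : p - h^-1 * (f (x + h) - f x) = - (h^-1 * (f (x + h) - f x - h * p)).
    by field.
  rewrite normrN normrM normfV mulrC ler_pdivrMr ?normr_gt0//.
apply: DeriveDef; first by apply/cvg_ex; exists p.
exact: cvg_lim.
Unshelve. all: by end_near. Qed.

Definition cdiff (h : C -> C) (z l : C) := forall e : R, 0 < e ->
  exists2 d : R, 0 < d & forall k, normc k < d ->
    normc (h (z + k) - h z - k * l) <= e * normc k.

Lemma cdiff_cder (h : C -> C) (z a l : C) t : cdiff h (z + a * t%:C) l ->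
  cder (fun s => h (z + a * s%:C)) t (a * l).
Proof.
move=> hd.
have key (e : R) : 0 < e -> exists2 d, 0 < d & forall s : R, `|s| < d ->
   normc (h (z + a * (t + s)%:C) - h (z + a * t%:C) - s%:C * (a * l)) <= e * `|s|.
  move=> e0; have na := normc_ge0 a.
  have e'0 : 0 < e / (normc a + 1) by rewrite divr_gt0// ltr_wpDl.
  have [d d0 hd'] := hd _ e'0.
  exists (d / (normc a + 1)); first by rewrite divr_gt0// ltr_wpDl.
  move=> s; rewrite ltr_pdivlMr ?ltr_wpDl// => sd.
  have := hd' (a * s%:C).
  rewrite normcM normc_real rmorphD mulrDr addrA [s%:C * _]mulrCA mulrA => hle.
  have s0 := normr_ge0 s.
  apply: le_trans (hle _) _; first by rewrite mulrC (le_lt_trans _ sd)// mulrDr mulr1 lerDl.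
  rewrite mulrA ler_wpM2r// mulrAC ler_pdivrMr ?ltr_wpDl// ler_wpM2l ?ltW//.
  by rewrite ltrDl.
split; apply: is_derive_littleo => e e0; have [d d0 hd'] := key e e0;
  exists d => // s /hd'; apply: le_trans.
  suff -> : Re (h (z + a * (t + s)%:C)) - Re (h (z + a * t%:C)) - s * Re (a * l)
    = Re (h (z + a * (t + s)%:C) - h (z + a * t%:C) - s%:C * (a * l)).
    exact: normc_Re.
  by rewrite !(ReD, ReN) [Re (s%:C * _)]ReM /= mul0r subr0.
suff -> : Im (h (z + a * (t + s)%:C)) - Im (h (z + a * t%:C)) - s * Im (a * l)
    = Im (h (z + a * (t + s)%:C) - h (z + a * t%:C) - s%:C * (a * l)).
  exact: normc_Im.
by rewrite !(ImD, ImN) [Im (s%:C * _)]ImM /= mul0r addr0.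
Qed.

Lemma cdiff_quadratic (h : C -> C) (z l : C) (B : R) :
  (forall k, normc k <= 1 -> normc (h (z + k) - h z - k * l) <= B * normc k ^+ 2) ->
  cdiff h z l.
Proof.
move=> hB e e0.
have B0 : 0 < `|B| + 1 by rewrite ltr_wpDl.
exists (Num.min 1 (e / (`|B| + 1))); first by rewrite lt_min ltr01 divr_gt0.
move=> k; rewrite lt_min => /andP[k1 k2].
apply: le_trans (hB _ (ltW k1)) _.
rewrite expr2 mulrA ler_wpM2r ?normc_ge0//.
move: k2; rewrite ltr_pdivlMr// => /ltW; apply: le_trans.
rewrite mulrC ler_wpM2l ?normc_ge0//.
by have := ler_norm B; lra.
Qed.

End Gronwall.

Section ParameterODE.
Context {R : realType}.
Local Notation C := R[i].
Variables (q : R -> C) (K w : R).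
Hypotheses (qK : forall x, normc (q x) <= K) (w0 : 0 <= w).
Variables (y y1 : C -> R -> C) (D D1 : R -> C) (E : C).
Hypotheses (dy : forall E x, cder (y E) x (y1 E x))
  (dy1 : forall E x, cder (y1 E) x ((q x + E) * y E x))
  (y0 : forall E', y E' 0 = y E 0) (y10 : forall E', y1 E' 0 = y1 E 0)
  (dD : forall x, cder D x (D1 x))
  (dD1 : forall x, cder D1 x ((q x + E) * D x + y E x))
  (D0 : D 0 = 0) (D10 : D1 0 = 0).

Let sqD (u v : C) (B H : R) : 0 <= B -> 0 <= H ->
  normc u ^+ 2 + normc v ^+ 2 <= (0 ^+ 2 + 0 ^+ 2 + B ^+ 2 * w) * expR H ->
  normc u <= B * Num.sqrt (w * expR H) /\ normc v <= B * Num.sqrt (w * expR H).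
Proof.
move=> B0 H0; rewrite expr0n/= !add0r => hle.
have s0 : 0 <= w * expR H by rewrite mulr_ge0 ?expR_ge0.
have hu := sqr_ge0 (normc u); have hv := sqr_ge0 (normc v).
by split; rewrite -(ler_pXn2r (n := 2))// ?nnegrE ?normc_ge0 ?mulr_ge0 ?sqrtr_ge0//
  exprMn sqr_sqrtr//; lra.
Qed.

(* If [D] solves the equation differentiated in [E], the remainder
   [y (E + k) - y E - k D] solves the inhomogeneous equation with right-hand
   side [k (y (E + k) - y E)], which is quadratically small. *)
Lemma parameter_derivative :
  cdiff (fun E => y E w) E (D w) /\ cdiff (fun E => y1 E w) E (D1 w).
Proof.
have K0 : 0 <= K by apply: le_trans (qK 0); exact: normc_ge0.
pose K' := K + normc E + 1.
have K'0 : 0 <= K' by rewrite !addr_ge0 ?normc_ge0.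
have qE k x : normc k <= 1 -> normc (q x + E + k) <= K'.
  move=> k1; apply: le_trans (normcD _ _) _; rewrite lerD//.
  by apply: le_trans (normcD _ _) _; rewrite lerD.
have qE0 x : normc (q x + E) <= K'.
  by rewrite -[q x + E]addr0 qE// ComplexField.Normc.normc0.
have qK' x : normc (q x) <= K' by apply: le_trans (qK x) _; rewrite /K' -addrA lerDl addr_ge0 ?normc_ge0.
pose H := (2 + K') * w.
have H0 : 0 <= H by rewrite mulr_ge0// addr_ge0.
pose Y := Num.sqrt ((normc (y E 0) ^+ 2 + normc (y1 E 0) ^+ 2) * expR H).
have Y0 : 0 <= Y by exact: sqrtr_ge0.
have yY x : 0 <= x <= w -> normc (y E x) <= Y.
  move=> xw; have := @gronwall _ (fun x => q x + E) K' w 0 (fun=> 0) (y E) (y1 E) w0 (lexx 0).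
  have h t : 0 <= t <= w -> [/\ cder (y E) t (y1 E t),
      cder (y1 E) t ((q t + E) * y E t + 0),
      normc (q t + E) <= K' & normc (0 : C) <= 0].
    by move=> _; rewrite addr0 ComplexField.Normc.normc0.
  move=> /(_ h x xw); rewrite expr0n/= mul0r addr0 -/H => hle.
  rewrite -(ler_pXn2r (n := 2))// ?nnegrE ?normc_ge0// sqr_sqrtr.
    by apply: le_trans hle; rewrite lerDl sqr_ge0.
  by rewrite mulr_ge0 ?expR_ge0// addr_ge0 ?sqr_ge0.
pose S := Num.sqrt (w * expR H).
have S0 : 0 <= S by exact: sqrtr_ge0.
have zbound k x : normc k <= 1 -> 0 <= x <= w ->
    normc (y (E + k) x - y E x) <= normc k * Y * S.
  move=> k1 xw.
  have := @gronwall _ (fun x => q x + E + k) K' w (normc k * Y) (fun x => k * y E x)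
    (fun x => y (E + k) x - y E x) (fun x => y1 (E + k) x - y1 E x) w0.
  have kY0 : 0 <= normc k * Y by rewrite mulr_ge0 ?normc_ge0.
  move=> /(_ kY0) hg.
  have /hg/(_ x xw) : forall t, 0 <= t <= w ->
     [/\ cder (fun x => y (E + k) x - y E x) t (y1 (E + k) t - y1 E t),
        cder (fun x => y1 (E + k) x - y1 E x) t
          ((q t + E + k) * (y (E + k) t - y E t) + k * y E t),
        normc (q t + E + k) <= K' & normc (k * y E t) <= normc k * Y].
    move=> t tw; split; [exact: cderB| |exact: qE|].
      by apply: cder_eq; [exact: cderB (dy1 _ _) (dy1 _ _)|ring].
    by rewrite normcM ler_wpM2l ?normc_ge0// yY.
  rewrite (y0 (E + k)) (y10 (E + k)) !subrr ComplexField.Normc.normc0 -/H.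
  by move=> /(sqD kY0 H0)[].
have main k : normc k <= 1 ->
    normc (y (E + k) w - y E w - k * D w) <= Y * S * S * normc k ^+ 2 /\
    normc (y1 (E + k) w - y1 E w - k * D1 w) <= Y * S * S * normc k ^+ 2.
  move=> k1; pose F := normc k * (normc k * Y * S).
  have F0 : 0 <= F by rewrite !mulr_ge0 ?normc_ge0.
  have := @gronwall _ (fun x => q x + E) K' w F (fun x => k * (y (E + k) x - y E x))
    (fun x => y (E + k) x - y E x - k * D x) (fun x => y1 (E + k) x - y1 E x - k * D1 x) w0 F0.
  move=> hg.
  have /hg/(_ w) : forall t, 0 <= t <= w ->
     [/\ cder (fun x => y (E + k) x - y E x - k * D x) t (y1 (E + k) t - y1 E t - k * D1 t),
        cder (fun x => y1 (E + k) x - y1 E x - k * D1 x) t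
          ((q t + E) * (y (E + k) t - y E t - k * D t) + k * (y (E + k) t - y E t)),
        normc (q t + E) <= K' & normc (k * (y (E + k) t - y E t)) <= F].
    move=> t tw; split; [by apply: cderB; [exact: cderB|exact: cderMl]| |exact: qE0|].
      apply: cder_eq; first exact: cderB (cderB (dy1 _ _) (dy1 _ _)) (cderMl k (dD1 t)).
      by ring.
    by rewrite normcM ler_wpM2l ?normc_ge0// zbound.
  rewrite w0 lexx (y0 (E + k)) (y10 (E + k)) !subrr D0 D10 !mulr0 !subr0.
  rewrite ComplexField.Normc.normc0 -/H => /(_ isT)/(sqD F0 H0)[].
  have -> : F * Num.sqrt (w * expR H) = Y * S * S * normc k ^+ 2 by rewrite /F /S; ring.
  by [].
by split; apply: (cdiff_quadratic (B := Y * S * S)) => k /main[].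
Qed.

End ParameterODE.

(** * The transfer matrix over a period *)

Section Transfer.
Context {R : realType}.
Local Notation C := R[i].
Variables (q : R -> C) (K w : R).
Hypotheses (cq : ccontinuous q) (qK : forall x, normc (q x) <= K) (w_gt0 : 0 < w)
  (q_per : forall x, q (x + w) = q x) (q_conj : forall x, (q (- x))^*%C = q x).

Lemma fundamental_solutions : exists c c1 s s1 : C -> R -> C, forall E : C,
  [/\ (c E 0 = 1 /\ c1 E 0 = 0) /\ (s E 0 = 0 /\ s1 E 0 = 1),
    forall x, cder (c E) x (c1 E x), forall x, cder (c1 E) x ((q x + E) * c E x),
    forall x, cder (s E) x (s1 E x) & forall x, cder (s1 E) x ((q x + E) * s E x)].
Proof.
have ex (a b : C) : exists yy : C -> (R -> C) * (R -> C), forall E : C,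
    [/\ (yy E).1 0 = a, (yy E).2 0 = b, forall x, cder (yy E).1 x ((yy E).2 x) &
    forall x, cder (yy E).2 x ((q x + E) * (yy E).1 x)].
  suff /choice[yy yyP] : forall E : C, exists p : (R -> C) * (R -> C),
      [/\ p.1 0 = a, p.2 0 = b, forall x, cder p.1 x (p.2 x) &
        forall x, cder p.2 x ((q x + E) * p.1 x)] by exists yy.
  move=> E; have [|x|u [v uv]] := @ode_exists _ (fun x => q x + E) (K + normc E) a b.
  - exact: ccontinuousD cq (ccontinuous_cst E).
  - by apply: le_trans (normcD _ _) _; rewrite lerD2r.
  - by exists (u, v).
have [cc ccP] := ex 1 0; have [ss ssP] := ex 0 1.
exists (fun E => (cc E).1), (fun E => (cc E).2), (fun E => (ss E).1), (fun E => (ss E).2).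
by move=> E; have [? ? ? ?] := ccP E; have [? ? ? ?] := ssP E.
Qed.

Variables (c c1 s s1 : C -> R -> C).
Hypotheses (c0 : forall E, c E 0 = 1) (c10 : forall E, c1 E 0 = 0)
  (s0 : forall E, s E 0 = 0) (s10 : forall E, s1 E 0 = 1)
  (dc : forall E x, cder (c E) x (c1 E x))
  (dc1 : forall E x, cder (c1 E) x ((q x + E) * c E x))
  (ds : forall E x, cder (s E) x (s1 E x))
  (ds1 : forall E x, cder (s1 E) x ((q x + E) * s E x)).

Lemma wronskian E x : c E x * s1 E x - s E x * c1 E x = 1.
Proof.
have := @cder0_cst _ (fun x => c E x * s1 E x - s E x * c1 E x) x 0.
rewrite c0 c10 s0 s10 mulr1 mulr0 subr0; apply=> t.
apply: cder_eq.
  exact: cderB (cderM (dc E t) (ds1 E t)) (cderM (ds E t) (dc1 E t)).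
by ring.
Qed.

Lemma solution_expand E (y y1 : R -> C) : (forall x, cder y x (y1 x)) ->
  (forall x, cder y1 x ((q x + E) * y x)) -> forall x,
  y x = y 0 * c E x + y1 0 * s E x /\ y1 x = y 0 * c1 E x + y1 0 * s1 E x.
Proof.
move=> dy dy1 x.
have [] := @ode_unique _ (fun x => q x + E) (K + normc E)
  (fun x => y x - (y 0 * c E x + y1 0 * s E x))
  (fun x => y1 x - (y 0 * c1 E x + y1 0 * s1 E x)) _ _ _ _ _ x.
- by move=> t; apply: le_trans (normcD _ _) _; rewrite lerD2r.
- by move=> t; apply: cderB (dy t) (cderD (cderMl _ (dc E t)) (cderMl _ (ds E t))).
- move=> t; apply: cder_eq.
    exact: cderB (dy1 t) (cderD (cderMl _ (dc1 E t)) (cderMl _ (ds1 E t))).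
  by ring.
- by rewrite c0 s0 mulr1 mulr0 addr0 subrr.
- by rewrite c10 s10 mulr1 mulr0 add0r subrr.
by move=> /subr0_eq ? /subr0_eq.
Qed.

Lemma transfer_conj E : s1 E w = ((c (E^*)%C w)^*)%C /\
  s E w = ((s (E^*)%C w)^*)%C /\ c1 E w = ((c1 (E^*)%C w)^*)%C.
Proof.
have conjq x : ((q (- x) + (E^*)%C)^*)%C = q x + E.
  by rewrite rmorphD/= q_conj conjcK.
have refl (y y1 : R -> C) : (forall x, cder y x (y1 x)) ->
    (forall x, cder y1 x ((q x + (E^*)%C) * y x)) ->
    (forall x, cder (fun t => (y (- t))^*%C) x (- (y1 (- x))^*%C)) /\
    (forall x, cder (fun t => - (y1 (- t))^*%C) x ((q x + E) * (y (- x))^*%C)).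
  move=> dy dy1; split=> x.
    by apply: cder_eq; [exact: cderJ (cder_opp (dy (- x)))|rewrite rmorphN].
  apply: cder_eq; first exact: cderN (cderJ (cder_opp (dy1 (- x)))).
  by rewrite rmorphN opprK rmorphM/= conjq.
have [dC dC1] := refl _ _ (dc (E^*)%C) (dc1 (E^*)%C).
have [dS dS1] := refl _ _ (ds (E^*)%C) (ds1 (E^*)%C).
have [hc hc1] := solution_expand dC dC1 (- w).
have [hs hs1] := solution_expand dS dS1 (- w).
rewrite /= oppr0 opprK c0 c10 conjc1 conjc0 oppr0 !mul1r !mul0r !addr0 in hc hc1.
rewrite /= oppr0 opprK s0 s10 conjc1 conjc0 !mul0r !add0r !mulN1r in hs hs1.
(* Translating by the period expresses the values at [-w] through those at [w]. *)
have per (y y1 : R -> C) : (forall x, cder y x (y1 x)) ->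
    (forall x, cder y1 x ((q x + E) * y x)) ->
    (forall x, cder (fun t => y (t + w)) x (y1 (x + w))) /\
    (forall x, cder (fun t => y1 (t + w)) x ((q x + E) * y (x + w))).
  move=> dy dy1; split=> x; first exact: cder_shift.
  by rewrite -q_per; apply: (cder_shift (dy1 (x + w))).
have [dC' dC1'] := per _ _ (dc E) (dc1 E).
have [dS' dS1'] := per _ _ (ds E) (ds1 E).
have [pc pc1] := solution_expand dC' dC1' (- w).
have [ps ps1] := solution_expand dS' dS1' (- w).
rewrite /= addNr add0r c0 c10 in pc pc1.
rewrite /= addNr add0r s0 s10 in ps ps1.
have W := wronskian E w.
have W' := wronskian E (- w).
have e1 : c E (- w) = s1 E w.
  apply: subr0_eq; transitivity (s1 E w * (c E w * c E (- w) + c1 E w * s E (- w) - 1)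
    - c1 E w * (s E w * c E (- w) + s1 E w * s E (- w))
    - c E (- w) * (c E w * s1 E w - s E w * c1 E w - 1)); first by ring.
  by rewrite -pc -ps W !subrr !mulr0 !subr0.
have e2 : s E (- w) = - s E w.
  apply: subr0_eq; transitivity (c E w * (s E w * c E (- w) + s1 E w * s E (- w))
    - s E w * (c E w * c E (- w) + c1 E w * s E (- w) - 1)
    - s E (- w) * (c E w * s1 E w - s E w * c1 E w - 1)); first by ring.
  by rewrite -pc -ps W !subrr !mulr0 !subr0.
have e3 : c1 E (- w) = - c1 E w.
  apply: subr0_eq; transitivity (s1 E w * (c E w * c1 E (- w) + c1 E w * s1 E (- w))
    - c1 E w * (s E w * c1 E (- w) + s1 E w * s1 E (- w) - 1)
    - c1 E (- w) * (c E w * s1 E w - s E w * c1 E w - 1)); first by ring.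
  by rewrite -pc1 -ps1 W !subrr !mulr0 !subr0.
split; first by rewrite -e1 hc.
split.
  by apply: oppr_inj; rewrite -e2 -[LHS]opprK -hs.
by apply: oppr_inj; rewrite -e3 -hc1.
Qed.

Variables (F F1 G : R -> C -> C) (p12 p11 p21 P Q : {poly C}).
Hypotheses (dF : forall E x, cder (F^~ E) x (F1 x E))
  (dF1 : forall E x, cder (F1^~ E) x (2 * ((q x + E) * F x E - G x E)))
  (dG : forall E x, cder (G^~ E) x (- (q x + E) * F1 x E))
  (F0p : forall E, F 0 E = p12.[E]) (F10p : forall E, F1 0 E = p11.[E])
  (G0p : forall E, G 0 E = p21.[E])
  (QE : Q = p12 * p21 + 4^-1 *: p11 ^+ 2)
  (Q_simple : forall E, root Q E -> ~~ root Q^`() E)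
  (F_per : forall E, F w E = F 0 E) (F1_per : forall E, F1 w E = F1 0 E)
  (G_per : forall E, G w E = G 0 E)
  (F_conj : forall E, ((F 0 (E^*)%C)^*)%C = F 0 E)
  (F1_conj : forall E, ((F1 0 (E^*)%C)^*)%C = - F1 0 E)
  (G_conj : forall E, ((G 0 (E^*)%C)^*)%C = G 0 E)
  (P_int : forall E (U : R -> C), U 0 = 0 -> (forall x, cder U x (F x E)) -> U w = P.[E]).

(* The entries of [U^-1 M U] are constant, where [U] is the fundamental matrix
   and [M = [[-F1/2, F], [G, F1/2]]]. *)
Lemma lax_invariants E x :
  [/\ F x E * s1 E x ^+ 2 - F1 x E * s E x * s1 E x - G x E * s E x ^+ 2 = F 0 E,
      G x E * c E x ^+ 2 + F1 x E * c E x * c1 E x - F x E * c1 E x ^+ 2 = G 0 E &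
      F1 x E * (s1 E x * c E x + s E x * c1 E x) - 2 * F x E * s1 E x * c1 E x
        + 2 * G x E * s E x * c E x = F1 0 E].
Proof.
split.
- have := @cder0_cst _ (fun x => F x E * (s1 E x * s1 E x) -
    F1 x E * (s E x * s1 E x) - G x E * (s E x * s E x)) x 0.
  rewrite s10 s0 !(mulr0, mul0r, subr0, mulr1) => <- /=; first by ring.
  move=> t; apply: cder_eq.
    exact: cderB (cderB (cderM (dF E t) (cderM (ds1 E t) (ds1 E t)))
      (cderM (dF1 E t) (cderM (ds E t) (ds1 E t))))
      (cderM (dG E t) (cderM (ds E t) (ds E t))).
  by rewrite /=; ring.
- have := @cder0_cst _ (fun x => G x E * (c E x * c E x) +
    F1 x E * (c E x * c1 E x) - F x E * (c1 E x * c1 E x)) x 0.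
  rewrite c10 c0 !(mulr0, mul0r, subr0, mulr1, addr0) => <- /=; first by ring.
  move=> t; apply: cder_eq.
    exact: cderB (cderD (cderM (dG E t) (cderM (dc E t) (dc E t)))
      (cderM (dF1 E t) (cderM (dc E t) (dc1 E t))))
      (cderM (dF E t) (cderM (dc1 E t) (dc1 E t))).
  by rewrite /=; ring.
have := @cder0_cst _ (fun x => F1 x E * (s1 E x * c E x + s E x * c1 E x) -
    2 * (F x E * (s1 E x * c1 E x)) + 2 * (G x E * (s E x * c E x))) x 0.
rewrite s0 s10 c10 c0 !(mulr0, mul0r, subr0, mulr1, addr0) => <- /=; first by ring.
move=> t; apply: cder_eq.
  exact: cderD (cderB (cderM (dF1 E t) (cderD (cderM (ds1 E t) (dc E t)) (cderM (ds E t) (dc1 E t))))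
      (cderMl 2 (cderM (dF E t) (cderM (ds1 E t) (dc1 E t)))))
      (cderMl 2 (cderM (dG E t) (cderM (ds E t) (dc E t)))).
by rewrite /=; ring.
Qed.

Lemma F_quadratic E x :
  F x E = F 0 E * c E x ^+ 2 + F1 0 E * (c E x * s E x) - G 0 E * s E x ^+ 2.
Proof.
have [<- <- <-] := lax_invariants E x; have W := wronskian E x.
transitivity (F x E * (c E x * s1 E x - s E x * c1 E x) ^+ 2); last by ring.
by rewrite W expr1n mulr1.
Qed.

Lemma transfer_commute E :
  [/\ s E w * G 0 E = F 0 E * c1 E w,
      (c E w - s1 E w) * F 0 E = - F1 0 E * s E w &
      (c E w - s1 E w) * G 0 E = - F1 0 E * c1 E w].
Proof.
have [h1 h2 h3] := lax_invariants E w; have W := wronskian E w.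
rewrite F_per F1_per G_per in h1 h2 h3.
have W0 : c E w * s1 E w - s E w * c1 E w - 1 = 0 by rewrite W subrr.
move/eqP: h1; rewrite -subr_eq0 => /eqP h1; move/eqP: h2; rewrite -subr_eq0 => /eqP h2.
move/eqP: h3; rewrite -subr_eq0 => /eqP h3.
move: h1 h2 h3 W0; set z1 := (X in X = 0 -> _); set z2 := (X in _ -> X = 0 -> _).
set z3 := (X in _ -> _ -> X = 0 -> _); set z4 := (X in _ -> _ -> _ -> X = 0 -> _).
move=> h1 h2 h3 h4; split; apply: subr0_eq.
- transitivity (- (c E w * (- z3 / 2) + s E w * z2 -
    z4 * (- F1 0 E / 2 * c E w + F 0 E * c1 E w))); first by rewrite /z2 /z3 /z4; field.
  by rewrite h2 h3 h4 oppr0 !mul0r !mulr0 !addr0 subr0 oppr0.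
- transitivity (- (c E w * z1 + s E w * (z3 / 2) -
    z4 * (- F1 0 E / 2 * s E w + F 0 E * s1 E w))); first by rewrite /z1 /z3 /z4; field.
  by rewrite h1 h3 h4 !mul0r !mulr0 !addr0 subr0 oppr0.
transitivity (c1 E w * (- z3 / 2) + s1 E w * z2 -
    z4 * (G 0 E * c E w + F1 0 E / 2 * c1 E w)); first by rewrite /z2 /z3 /z4; field.
by rewrite h2 h3 h4 oppr0 !mul0r !mulr0 !addr0 subr0.
Qed.

Lemma horner_Q E : Q.[E] = F 0 E * G 0 E + F1 0 E ^+ 2 / 4.
Proof. by rewrite QE F0p F10p G0p hornerD hornerM hornerZ horner_exp [4^-1 * _]mulrC. Qed.

Lemma lax_neq0 E : F 0 E = 0 -> G 0 E = 0 -> F1 0 E = 0 -> False.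
Proof.
rewrite F0p G0p F10p => /eqP; rewrite -rootE => /factor_theorem[r12 e12].
move=> /eqP; rewrite -rootE => /factor_theorem[r21 e21].
move=> /eqP; rewrite -rootE => /factor_theorem[r11 e11].
have QE2 : Q = (r12 * r21 + 4^-1 *: r11 ^+ 2) * ('X - E%:P) ^+ 2.
  by rewrite QE e12 e21 e11 -!mul_polyC; ring.
have rQ : root Q E by rewrite QE2 rootM root_exp_XsubC eqxx orbT.
have double r : ((r * ('X - E%:P) ^+ 2)^`()).[E] = 0.
  by rewrite expr2 !derivM derivXsubC !hornerE /=; ring.
by have := Q_simple rQ; rewrite rootE QE2 double eqxx.
Qed.

Definition half_trace E := (c E w + s1 E w) / 2.

Definition transfer_coef E := if F 0 E != 0 then s E w / F 0 E
  else if G 0 E != 0 then c1 E w / G 0 E else (s1 E w - c E w) / F1 0 E.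

Notation al := half_trace.
Notation be := transfer_coef.

Lemma transfer_coefE E : [/\ s E w = be E * F 0 E, c1 E w = be E * G 0 E &
  s1 E w - c E w = be E * F1 0 E].
Proof.
have [h1 h2 h3] := transfer_commute E; rewrite /be.
have {}h2 : (s1 E w - c E w) * F 0 E = F1 0 E * s E w.
  by rewrite -[s1 E w - _]opprB mulNr h2 mulNr opprK.
have {}h3 : (s1 E w - c E w) * G 0 E = F1 0 E * c1 E w.
  by rewrite -[s1 E w - _]opprB mulNr h3 mulNr opprK.
have [F0|F0] := eqVneq (F 0 E) 0; last first.
  rewrite /= divfK//; split=> //; apply: (mulIf F0); rewrite ?h2; last by field.
  by rewrite mulrC -h1; field.
have [G0|G0] := eqVneq (G 0 E) 0; last first.
  rewrite /= divfK//; split=> //; apply: (mulIf G0); rewrite ?h3; last by field.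
  by rewrite h1 F0 mul0r mulr0 mul0r.
have F10 : F1 0 E != 0 by apply/eqP => /(lax_neq0 F0 G0).
rewrite /= divfK// F0 G0 !mulr0; split=> //; apply: (mulfI F10).
  by rewrite -h2 F0 !mulr0.
by rewrite -h3 G0 !mulr0.
Qed.

Lemma transfer_entries E : c E w = al E - be E * F1 0 E / 2 /\
  s1 E w = al E + be E * F1 0 E / 2.
Proof. by have [_ _ <-] := transfer_coefE E; rewrite /al; split; field. Qed.

Lemma pell E : al E ^+ 2 - 1 = be E ^+ 2 * Q.[E].
Proof.
have [es ec1 _] := transfer_coefE E; have [ec es1] := transfer_entries E.
by rewrite -(wronskian E w) es ec1 ec es1 horner_Q; field.
Qed.

Lemma transfer_trace E : be E * Q.[E] =
  2^-1 * (s E w * p21.[E] + c1 E w * p12.[E] + (s1 E w - c E w) * p11.[E] / 2).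
Proof.
have [-> -> ->] := transfer_coefE E.
by rewrite horner_Q F0p G0p F10p; field.
Qed.

Lemma transfer_cdiff E : exists Icc Ics Iss : C,
  [/\ cdiff (c^~ w) E (- c E w * Ics + s E w * Icc) /\
        cdiff (c1^~ w) E (- c1 E w * Ics + s1 E w * Icc),
      cdiff (s^~ w) E (- c E w * Iss + s E w * Ics) /\
        cdiff (s1^~ w) E (- c1 E w * Iss + s1 E w * Ics) &
      P.[E] = F 0 E * Icc + F1 0 E * Ics - G 0 E * Iss].
Proof.
have cc : ccontinuous (c E) := cder_ccontinuous (dc E).
have cs : ccontinuous (s E) := cder_ccontinuous (ds E).
have [Icc [Icc0 dIcc]] := cprimitive_exists (ccontinuousM cc cc).
have [Ics [Ics0 dIcs]] := cprimitive_exists (ccontinuousM cc cs).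
have [Iss [Iss0 dIss]] := cprimitive_exists (ccontinuousM cs cs).
exists (Icc w), (Ics w), (Iss w).
have vary (y y1 : C -> R -> C) (A B : R -> C) :
    (forall E x, cder (y E) x (y1 E x)) ->
    (forall E x, cder (y1 E) x ((q x + E) * y E x)) ->
    (forall E', y E' 0 = y E 0) -> (forall E', y1 E' 0 = y1 E 0) ->
    A 0 = 0 -> B 0 = 0 -> (forall x, cder A x (s E x * y E x)) ->
    (forall x, cder B x (c E x * y E x)) ->
    cdiff (y^~ w) E (- c E w * A w + s E w * B w) /\
    cdiff (y1^~ w) E (- c1 E w * A w + s1 E w * B w).
  move=> dy dy1 y0 y10 A0 B0 dA dB.
  apply: (@parameter_derivative _ q K w qK (ltW w_gt0) y y1
    (fun x => - c E x * A x + s E x * B x) (fun x => - c1 E x * A x + s1 E x * B x) E) => //.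
  - move=> x; apply: cder_eq.
      exact: cderD (cderM (cderN (dc E x)) (dA x)) (cderM (ds E x) (dB x)).
    by rewrite /=; ring.
  - move=> x; apply: cder_eq.
      exact: cderD (cderM (cderN (dc1 E x)) (dA x)) (cderM (ds1 E x) (dB x)).
    rewrite /= -[X in _ = _ + X]mul1r -(wronskian E x); ring.
  - by rewrite A0 B0 !mulr0 addr0.
  - by rewrite A0 B0 !mulr0 addr0.
have dIcs' x : cder Ics x (s E x * c E x) by rewrite mulrC.
split.
- by apply: vary => // E'; rewrite ?c0 ?c10.
- by apply: vary => // E'; rewrite ?s0 ?s10.
rewrite -(P_int (U := fun x => F 0 E * Icc x + F1 0 E * Ics x - G 0 E * Iss x))//.
  by rewrite Icc0 Ics0 Iss0 !mulr0 addr0 subr0.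
move=> x; apply: cder_eq.
  exact: cderB (cderD (cderMl _ (dIcc x)) (cderMl _ (dIcs x))) (cderMl _ (dIss x)).
by rewrite [RHS]F_quadratic !expr2.
Qed.

Lemma half_trace_cder (E0 a : C) (t : R) (E := E0 + a * t%:C) :
  cder (fun t => al (E0 + a * t%:C)) t (a * (be E * P.[E] / 2)).
Proof.
have [Icc [Ics [Iss [[hc hc1] [hs hs1] ->]]]] := transfer_cdiff E.
apply: cder_eq.
  exact: cderMr (cderD (cdiff_cder hc) (cdiff_cder hs1)).
rewrite -/E; have [es ec1 ed] := transfer_coefE E.
transitivity (a * (((s1 E w - c E w) * Ics + s E w * Icc - c1 E w * Iss) / 2)).
  by field.
by rewrite es ec1 ed; field.
Qed.

Lemma transfer_trace_cder (E0 a : C) (t : R) (E := E0 + a * t%:C) :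
  cder (fun t => be (E0 + a * t%:C) * Q.[E0 + a * t%:C]) t
    (a * ((al E * P.[E] + be E * Q^`().[E]) / 2)).
Proof.
have [Icc [Ics [Iss [[hc hc1] [hs hs1] PE]]]] := transfer_cdiff E.
under eq_fun do rewrite transfer_trace.
have dp p := cder_poly p (cder_line E0 a t).
apply: cder_eq.
  apply: cderMl; apply: cderD; first apply: cderD.
  - exact: cderM (cdiff_cder hs) (dp p21).
  - exact: cderM (cdiff_cder hc1) (dp p12).
  - exact: cderMr (cderM (cderB (cdiff_cder hs1) (cdiff_cder hc)) (dp p11)).
rewrite -/E /=.
have -> : Q^`().[E] = p12^`().[E] * p21.[E] + p12.[E] * p21^`().[E]
   + p11.[E] * p11^`().[E] / 2.
  rewrite QE derivD derivM derivZ expr2 derivM !(hornerD, hornerM, hornerZ).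
  by field.
rewrite PE F0p F10p G0p.
have [es ec1 _] := transfer_coefE E; have [ec es1] := transfer_entries E.
by rewrite es ec1 ec es1 F0p F10p G0p; field.
Qed.

Lemma transfer_coef_zero E : Q.[E] = 0 -> be E = 0 -> P.[E] = 0.
Proof.
move=> Q0 be0.
have E1 : E + 1 * (0 : R)%:C = E by rewrite mul1r addr0.
have dk := transfer_trace_cder E 1 0; rewrite /= E1 be0 !mul1r mul0r addr0 in dk.
have al1 : al E ^+ 2 = 1 by apply: subr0_eq; rewrite pell be0 expr0n/= mul0r.
have al0 : al E != 0 by rewrite -sqrf_eq0 al1 oner_eq0.
suff /eqP : al E * P.[E] / 2 = 0.
  by rewrite mulf_eq0 invr_eq0 pnatr_eq0 orbF mulf_eq0 (negPf al0) => /eqP.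
(* Each entry [N] of [T] is [be * m] with [m] the entry of [M]: differentiating
   [(be Q) m = N Q] at [E] gives [(be Q)' m = 0], and some [m] is nonzero. *)
have key (N : C -> C) (p : {poly C}) (l : C) : (forall E, N E = be E * p.[E]) -> cdiff N E l ->
    p.[E] != 0 -> al E * P.[E] / 2 = 0.
  move=> NE dN p0.
  have dN1 : cder (fun t => N (E + 1 * t%:C)) 0 (1 * l) by apply: cdiff_cder; rewrite E1.
  have dp p := cder_poly p (cder_line E 1 0).
  have d1 := cderM dk (dp p); have d2 := cderM dN1 (dp Q).
  have fE : (fun t => N (E + 1 * t%:C) * Q.[E + 1 * t%:C]) =
     (fun t => be (E + 1 * t%:C) * Q.[E + 1 * t%:C] * p.[E + 1 * t%:C]).
    by apply/funext => t; rewrite NE; ring.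
  rewrite fE in d2; have := cder_uniq d1 d2.
  rewrite /= E1 NE be0 Q0 !mul0r mulr0 !addr0 => /eqP.
  by rewrite mulf_eq0 (negPf p0) orbF => /eqP.
have [Icc [Ics [Iss [[hc hc1] [hs hs1] _]]]] := transfer_cdiff E.
have [p12E|] := eqVneq p12.[E] 0; last first.
  by apply: (key _ _ _ _ hs) => E'; rewrite -F0p; case: (transfer_coefE E').
have [p21E|] := eqVneq p21.[E] 0; last first.
  by apply: (key _ _ _ _ hc1) => E'; rewrite -G0p; case: (transfer_coefE E').
have [p11E|p11E] := eqVneq p11.[E] 0.
  by have [] := @lax_neq0 E; rewrite ?F0p ?G0p ?F10p.
apply: (key (fun E => s1 E w - c E w) _ _ _ _ p11E) => [E'|].
  by rewrite -F10p; case: (transfer_coefE E').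
move=> e e0; have e2 : 0 < e / 2 by rewrite divr_gt0.
have [d1 d10 h1] := hs1 _ e2; have [d2 d20 h2] := hc _ e2.
exists (Num.min d1 d2); first by rewrite lt_min d10.
move=> k; rewrite lt_min => /andP[/h1 k1 /h2 k2].
have := normcB (s1 (E + k) w - s1 E w - k * (- c1 E w * Iss + s1 E w * Ics))
  (c (E + k) w - c E w - k * (- c E w * Ics + s E w * Icc)).
have -> : e * normc k = e / 2 * normc k + e / 2 * normc k by field.
move=> h; apply: le_trans (lerD k1 k2); apply: le_trans h.
rewrite le_eqVlt; apply/orP; left; apply/eqP; congr normc.
instantiate (1 := (- c1 E w * Iss + s1 E w * Ics) - (- c E w * Ics + s E w * Icc)).
by ring.
Qed.

Lemma half_trace_conj E : al (E^*)%C = ((al E)^*)%C.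
Proof.
have [h1 _] := transfer_conj E; have [h2 _] := transfer_conj (E^*)%C.
by rewrite /al rmorphM rmorphD fmorphV rmorph_nat /= h1 h2 !conjcK addrC.
Qed.

Lemma transfer_coef_conj E : be (E^*)%C = ((be E)^*)%C.
Proof.
have [h1 [h2 h3]] := transfer_conj E; have [h1' _] := transfer_conj (E^*)%C.
have [es ec1 ed] := transfer_coefE E; have [es' ec1' ed'] := transfer_coefE (E^*)%C.
have conj_inj (a b : C) : ((a^*)%C = (b^*)%C) -> a = b by move=> /(congr1 conjc); rewrite !conjcK.
apply: conj_inj; rewrite conjcK.
have [F0|F0] := eqVneq (F 0 E) 0; last first.
  by apply: (mulIf F0); rewrite -es h2 es' rmorphM/= F_conj.
have [G0|G0] := eqVneq (G 0 E) 0; last first.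
  by apply: (mulIf G0); rewrite -ec1 h3 ec1' rmorphM/= G_conj.
have F10 : F1 0 E != 0 by apply/eqP => /(lax_neq0 F0 G0).
apply: (mulIf F10); rewrite -ed h1.
have -> : c E w = ((s1 (E^*)%C w)^*)%C by rewrite h1' !conjcK.
by rewrite -[F1 0 E]opprK -F1_conj mulrN -rmorphM/= -ed' rmorphB/= opprB.
Qed.

End Transfer.

(** * Location of the bands *)

Section RealDerivatives.
Context {R : realType}.
Implicit Types (f df : R -> R) (u v x y p : R).

Lemma is_derive_neg_left f x p u : is_derive x 1 f p -> p < 0 -> u < x ->
  exists2 y, u < y < x & f x < f y.
Proof.
move=> [cv pE] p0 ux.
have lim : h^-1 *: ((f \o shift x) (h *: (1 : R)) - f x) @[h --> 0^'-] --> p.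
  by apply: cvg_dnbhs_at_left; rewrite -pE.
have np0 : 0 < - p by rewrite oppr_gt0.
have /cvgrPdist_lt/(_ _ np0) hn := lim.
near (0 : R)^'- => h.
have h0 : h < 0 by near: h; exact: nbhs_left_lt.
have hu : u - x < h by near: h; apply: nbhs_left_gt; rewrite subr_lt0.
have : `|p - h^-1 *: ((f \o shift x) (h *: (1 : R)) - f x)| < - p by near: h.
rewrite /= /GRing.scale/= mulr1 => hlt.
exists (h + x); first by apply/andP; split; lra.
have hneg : h^-1 * (f (h + x) - f x) < 0 by move: hlt; rewrite ltr_norml => /andP[]; lra.
by rewrite -subr_gt0; move: hneg; rewrite nmulr_rlt0// invr_lt0.
Unshelve. all: by end_near. Qed.

Lemma is_derive_pos_right f x p v : is_derive x 1 f p -> 0 < p -> x < v ->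
  exists2 y, x < y < v & f x < f y.
Proof.
move=> d p0 xv.
have d' : is_derive (- x) 1 (fun t => f (- t)) (- p).
  have := @is_derive1_comp R f -%R (- x) p (-1).
  by rewrite opprK mulrN1; apply.
have [||y /andP[y1 y2]] := @is_derive_neg_left (fun t => f (- t)) (- x) (- p) (- v) d'.
- by rewrite oppr_lt0.
- by rewrite ltrN2.
rewrite opprK => fy; exists (- y) => //; apply/andP; split; lra.
Qed.

Lemma is_derive_ltr f df x y : x < y ->
  (forall t, x <= t <= y -> is_derive t 1 f (df t)) ->
  (forall t, x <= t <= y -> 0 < df t) -> f x < f y.
Proof.
move=> xy d dgt0.
have [|//|c cxy] := @MVT R f df x y xy.
- by move=> t; rewrite in_itv/= => /andP[? ?]; apply: d; rewrite !ltW.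
- apply: derivable_within_continuous => t; rewrite in_itv/= => /d[]; exact.
- move=> fE; rewrite -subr_gt0 fE mulr_gt0 ?subr_gt0//; apply: dgt0.
  by move: cxy; rewrite in_itv/= => /andP[/ltW -> /ltW ->].
Qed.

Lemma interior_max f df u v y : u < y < v ->
  (forall t : R, is_derive t (1 : R) f (df t)) -> f u < f y -> f v < f y ->
  exists x, [/\ u < x < v, df x = 0 & f y <= f x].
Proof.
move=> /andP[uy yv] d fu fv; have uv := lt_trans uy yv.
have cont : {within `[u, v], continuous f}.
  by apply: derivable_within_continuous => t _; case: (d t).
have [x + xmax] := EVT_max (ltW uv) cont.
rewrite in_itv/= => /andP[ux xv].
have fyx : f y <= f x by apply: xmax; rewrite in_itv/= (ltW uy) ltW.
have {}ux : u < x.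
  by rewrite lt_neqAle ux andbT; apply: contraTneq fyx => <-; rewrite -ltNge.
have {}xv : x < v.
  by rewrite lt_neqAle xv andbT; apply: contraTneq fyx => ->; rewrite -ltNge.
exists x; split=> //; first by rewrite ux.
have [|||_ dx] := @derive1_at_max R f u v x (ltW uv).
- by move=> t _; case: (d t).
- by rewrite in_itv/= ux.
- by move=> t; rewrite in_itv/= => /andP[? ?]; apply: xmax; rewrite in_itv/= !ltW.
by have [_ <-] := d x.
Qed.

End RealDerivatives.

Section Interlacing.
Context {R : realType}.
Local Notation C := R[i].
Implicit Types (x y c r : R) (z : C) (ts : seq (R * R)).

Definition partial_fractions c ts z : C :=
  c%:C - \sum_(p <- ts) p.1%:C / (z - p.2%:C).

Lemma sub_real_neq0 z x : 0 < Im z -> z - x%:C != 0.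
Proof.
move=> z0; apply/eqP => /(congr1 (@Im R)) /eqP.
by case: z z0 => p r /=; rewrite oppr0 addr0 => /gt_eqF ->.
Qed.

Lemma Im_inv_sub z x : 0 < Im z -> Im ((z - x%:C)^-1) < 0.
Proof.
case: z => p r /= r0; rewrite oppr0 addr0 oppr_lt0 divr_gt0//.
by rewrite ltr_wpDl ?sqr_ge0// exprn_gt0.
Qed.

Lemma Im_partial_fractions c ts z : 0 < Im z -> all (fun p => 0 < p.1) ts ->
  0 <= Im (partial_fractions c ts z) /\
  (ts != [::] -> 0 < Im (partial_fractions c ts z)).
Proof.
move=> z0 tpos; rewrite /partial_fractions ImD /= add0r.
elim: ts tpos => [|p ts IH] /=; first by rewrite big_nil /= oppr0.
move=> /andP[p0 /IH[h _]]; rewrite big_cons ImN ImD opprD.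
have h2 : 0 < - Im (p.1%:C / (z - p.2%:C)).
  rewrite ImM /= mul0r addr0 -mulrN mulr_gt0// oppr_gt0.
  exact: Im_inv_sub.
by move: h; rewrite ImN => h; split=> [|_]; [rewrite addr_ge0// ltW|rewrite ltr_wpDr].
Qed.

(* Multiplying by [(z - d) / (z - a)] with [a < d] below all poles keeps the
   residues negative. *)
Lemma partial_fractions_mul c ts a d : 0 <= c -> (0 < c) || (ts != [::]) ->
  a < d -> all (fun p => (0 < p.1) && (d < p.2)) ts ->
  exists ts', [/\ all (fun p => (0 < p.1) && (a <= p.2)) ts', ts' != [::] &
    forall z, 0 < Im z -> partial_fractions c ts' z =
      partial_fractions c ts z * ((z - d%:C) / (z - a%:C))].
Proof.
move=> c0 cts ad tsP.
pose r := (d - a) * (c + \sum_(p <- ts) p.1 / (p.2 - a)).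
have r0 : 0 < r.
  rewrite mulr_gt0 ?subr_gt0//.
  have term p : (0 < p.1) && (d < p.2) -> 0 < p.1 / (p.2 - a).
    by move=> /andP[? ?]; rewrite divr_gt0// subr_gt0 (lt_trans ad).
  have sge0 ts' : all (fun p => (0 < p.1) && (d < p.2)) ts' ->
      0 <= \sum_(p <- ts') p.1 / (p.2 - a).
    elim: ts' => [|p ts' IH] /=; first by rewrite big_nil.
    by move=> /andP[/term/ltW ? /IH ?]; rewrite big_cons addr_ge0.
  case/orP: cts => [c1|]; first by rewrite ltr_wpDr// sge0.
  case: (ts) tsP => [//|p ts'] /= /andP[/term ? /sge0 ?] _.
  by rewrite ltr_wpDl// big_cons ltr_wpDr.
exists ((r, a) :: [seq (p.1 * (p.2 - d) / (p.2 - a), p.2) | p <- ts]); split=> //.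
  rewrite /= r0 lexx /= all_map; apply: sub_all tsP => p /= /andP[p0 dp].
  have ap : a < p.2 := lt_trans ad dp.
  by rewrite divr_gt0 ?mulr_gt0 ?subr_gt0//= ltW.
move=> z z0; have za := sub_real_neq0 a z0.
rewrite /partial_fractions big_cons /= big_map /= /r.
have -> : \sum_(p <- ts) (p.1 * (p.2 - d) / (p.2 - a))%:C / (z - p.2%:C) =
   (\sum_(p <- ts) p.1%:C / (z - p.2%:C)) * ((z - d%:C) / (z - a%:C)) -
   (d - a)%:C * (\sum_(p <- ts) p.1 / (p.2 - a))%:C / (z - a%:C).
  rewrite rmorph_sum/= mulr_suml mulr_sumr mulr_suml -sumrB.
  have := tsP; elim: (ts) => [|p ts' IH] /=; first by rewrite !big_nil.
  move=> /andP[/andP[p0 dp] /IH {}IH]; rewrite !big_cons IH; congr (_ + _).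
  have ap : (p.2%:C - a%:C : C) != 0.
    by rewrite -rmorphB fmorph_eq0 subr_eq0 gt_eqF// (lt_trans ad).
  have zp := sub_real_neq0 p.2 z0.
  by rewrite !(rmorphM, rmorphB, fmorphV) /= ?rmorphB; field; rewrite ap zp za.
rewrite rmorphM rmorphB rmorphD /=.
by field.
Qed.

Lemma partial_fractions_prod (g : nat) (a d : nat -> R) c ts :
  0 <= c -> (0 < c) || (ts != [::]) -> all (fun p => 0 < p.1) ts ->
  (forall i, (i < g)%N -> a i < d i) ->
  (forall i, (i < g)%N -> all (fun p => d i < p.2) ts) ->
  (forall i j, (i < j < g)%N -> d j < a i) ->
  exists ts', [/\ all (fun p => 0 < p.1) ts', (ts != [::]) -> ts' != [::] &
   forall z, 0 < Im z -> partial_fractions c ts' z =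
     partial_fractions c ts z * \prod_(i < g) ((z - (d i)%:C) / (z - (a i)%:C))].
Proof.
move=> c0 cts tpos ad tsd da.
suff /(_ g (leqnn g)) [ts' [h1 h2 _ h3]] : forall k, (k <= g)%N ->
    exists ts', [/\ all (fun p => 0 < p.1) ts',
      ((0 < c) || (ts' != [::])) && ((ts != [::]) ==> (ts' != [::])),
      forall i, (k <= i < g)%N -> all (fun p => d i < p.2) ts' &
      forall z, 0 < Im z -> partial_fractions c ts' z =
        partial_fractions c ts z * \prod_(i < k) ((z - (d i)%:C) / (z - (a i)%:C))].
  by exists ts'; split=> // tsn; move: h2 => /andP[_ /implyP]; exact.
elim=> [_|k IH kg].
  exists ts; split=> //; first by rewrite cts implybb.
  by move=> z _; rewrite big_ord0 mulr1.
have [ts1 [h1 /andP[h2 h2'] h3 h4]] := IH (ltnW kg).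
have all1 : all (fun p => (0 < p.1) && (d k < p.2)) ts1.
  by rewrite all_predI h1 h3// leqnn kg.
have [ts2 [k1 k2 k3]] := partial_fractions_mul c0 h2 (ad k kg) all1.
exists ts2; split.
- by apply: sub_all k1 => p /andP[].
- by rewrite k2 orbT implybT.
- move=> i /andP[ki ig]; apply: sub_all k1 => p /andP[_].
  by apply: lt_le_trans; rewrite da// ki.
by move=> z z0; rewrite k3// h4// big_ord_recr /= -[LHS]mulrA.
Qed.

End Interlacing.

Section PrincipalRoot.
Context {R : realType}.
Local Notation C := R[i].
Implicit Types (z l : C) (u v : R -> C) (t : R).

Lemma cder_near u v t l : (\forall s \near t, u s = v s) -> cder u t l -> cder v t l.
Proof.
by move=> uv [d1 d2]; split; [apply: near_eq_is_derive d1|apply: near_eq_is_derive d2];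
  apply: filterS uv => s ->.
Qed.

(* The square root with positive real part, off the negative real axis; the
   cut is described by [normc z + Re z = 0]. *)
Definition principal_root z : C :=
  let p := Num.sqrt ((normc z + Re z) / 2) in (p +i* (Im z / (2 * p)))%C.

Lemma principal_rootP z : 0 < normc z + Re z ->
  0 < Re (principal_root z) /\ principal_root z ^+ 2 = z.
Proof.
move=> hz; rewrite /principal_root; set w := (normc z + Re z) / 2.
have w0 : 0 < w by rewrite divr_gt0.
have p0 : 0 < Num.sqrt w by rewrite sqrtr_gt0.
have pw : Num.sqrt w ^+ 2 = w by rewrite sqr_sqrtr ?ltW.
have p_neq0 : Num.sqrt w != 0 by rewrite gt_eqF.
split=> //; apply: complex_ext; rewrite expr2 ?ReM ?ImM /=; last by field.
have -> : Num.sqrt w * Num.sqrt w = w by rewrite -expr2.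
have -> : Im z / (2 * Num.sqrt w) * (Im z / (2 * Num.sqrt w)) = Im z ^+ 2 / (4 * w).
  by rewrite -{3}pw; field.
have e : Im z ^+ 2 = (normc z + Re z) * (normc z - Re z).
  by have := normcE2 z; lra.
have w_neq0 : w != 0 by rewrite gt_eqF.
have -> : Im z ^+ 2 / (4 * w) = (normc z - Re z) / 2.
  by rewrite e /w; field; rewrite gt_eqF.
by rewrite /w; field.
Qed.

Lemma cder_principal_root u t l : 0 < normc (u t) + Re (u t) -> cder u t l ->
  cder (fun s => principal_root (u s)) t (l / (2 * principal_root (u t))).
Proof.
move=> h0 du; have [du1 du2] := du.
have [p0 psq] := principal_rootP h0.
have n0 : 0 < Re (u t) ^+ 2 + Im (u t) ^+ 2.
  rewrite -normcE2 exprn_gt0// normc_gt0; apply: contraTneq h0 => ->.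
  by rewrite ComplexField.Normc.normc0 addr0 ltxx.
have dsq := is_derive_add (is_derive_mul du1 du1) (is_derive_mul du2 du2).
have n0' : 0 < Re (u t) * Re (u t) + Im (u t) * Im (u t) by rewrite -!expr2.
have dn := @is_derive1_comp R Num.sqrt
  (fun s => Re (u s) * Re (u s) + Im (u s) * Im (u s)) t _ _ (is_derive1_sqrt n0') dsq.
have nE : (fun s => normc (u s)) =
    Num.sqrt \o (fun s => Re (u s) * Re (u s) + Im (u s) * Im (u s)).
  by apply/funext => s /=; rewrite -!expr2; case: (u s).
rewrite -nE in dn.
have dw := is_derive_mul (is_derive_add dn du1) (is_derive_cst (2^-1 : R) t 1).
have w0 : 0 < (normc (u t) + Re (u t)) / 2 by rewrite divr_gt0.
have w0' : 0 < (normc (u t) + Re (u t)) * cst (2^-1) t by [].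
have dp := @is_derive1_comp R Num.sqrt
  (fun s => (normc (u s) + Re (u s)) * cst (2^-1) s) t _ _ (is_derive1_sqrt w0') dw.
have p0' : 2 * Num.sqrt ((normc (u t) + Re (u t)) / 2) != 0.
  by rewrite mulf_neq0// gt_eqF// sqrtr_gt0.
have [b dp2] : exists b : R, is_derive t 1
    (fun s : R => 2 * Num.sqrt ((normc (u s) + Re (u s)) / 2)) b.
  by eexists; exact: (is_derive_mul (is_derive_cst (2 : R) t 1) dp).
have dq := is_derive_mul du2 (@is_deriveV R (fun s => 2 * Num.sqrt ((normc (u s) + Re (u s)) / 2)) t b 1 p0' dp2).
have [l' dl'] : exists l', cder (fun s => principal_root (u s)) t l'.
  by eexists (_ +i* _)%C; split; [exact: dp|exact: dq].
apply: (cder_eq dl').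
have dsq' := cderM dl' dl'.
have near_sq : \forall s \near t, principal_root (u s) * principal_root (u s) = u s.
  have cw : {for t, continuous (fun s => normc (u s) + Re (u s))}.
    by apply: differentiable_continuous; apply/derivable1_diffP; case: (is_derive_add dn du1).
  have hn : \forall s \near t, 0 < normc (u s) + Re (u s) by exact: (cvgr_gt _ cw).
  apply: filterS hn => s hs.
  by rewrite -expr2; case: (principal_rootP hs).
have := cder_uniq (cder_near near_sq dsq') du => <-.
have pr0 : principal_root (u t) != 0.
  by apply: contraTneq p0 => ->; rewrite ltxx.
by field.
Qed.

End PrincipalRoot.

Section RealArithmetic.
Context {R : realType}.
Implicit Types s n c p X Y : R.

Lemma branch_sign s n n' c c' p p' : s * s = 1 -> 0 < s * n ->
  0 < - (p * p - p' * p') -> 0 < s * c - s * c' -> 0 < s * c + s * c' -> 0 < p ->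
  0 < (p * p - p' * p') * n' + (p * p' + p' * p) * n -> 0 <= n' ->
  0 <= c * p' + c' * p.
Proof.
move=> s2 sn rr c1 c2 p0 I1 n0.
have i1 : 0 < (p * p' + p' * p) * n by nra.
have i2 : 0 < s * s * (p * p' + p' * p) * n by rewrite s2 mul1r.
have i3 : 0 < (s * n) * ((2 * p) * (s * p')) by lra.
have im_pos : 0 < s * p' by move: i3; rewrite pmulr_rgt0// pmulr_rgt0// mulr_gt0.
have im_big : p < s * p'.
  have : p ^+ 2 < (s * p') ^+ 2 by rewrite !expr2 mulrACA s2 mul1r; lra.
  by rewrite ltr_pXn2r// nnegrE ltW.
have -> : c * p' = (s * c) * (s * p') by rewrite mulrACA s2 mul1r.
have -> : c' * p = (s * c') * (s * p) by rewrite mulrACA s2 mul1r.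
have cs : 0 < s * c by lra.
have k1 : (s * c) * p <= (s * c) * (s * p') by rewrite ler_wpM2l// ltW.
have s1 : (s == 1) || (s == -1).
  by rewrite -subr_eq0 -[s == -1]subr_eq0 opprK -mulf_eq0 -subr_sqr expr1n expr2 s2 subrr.
have : 0 <= s * c * p + s * c' * (s * p); last by lra.
case/orP: s1 c1 c2 => /eqP -> d1 d2;
  by have := mulr_gt0 d1 p0; have := mulr_gt0 d2 p0; lra.
Qed.

Lemma sum_inverse_bound X Y eps : 0 < X -> X * Y = 1 -> 0 < eps ->
  X + Y - 2 < eps ^+ 2 -> 1 - eps < X.
Proof.
move=> X0 XY eps0 h; rewrite ltNge; apply/negP => Xle.
have e1 : (1 - X) ^+ 2 = X * (X + Y - 2) by rewrite mulrBr mulrDr XY; ring.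
have e2 : eps ^+ 2 <= (1 - X) ^+ 2 by rewrite ler_pXn2r// ?nnegrE; lra.
have e4 : X * (X + Y - 2) <= X + Y - 2.
  rewrite ler_piMl//; last by lra.
  by rewrite -(pmulr_rge0 _ X0) -e1 sqr_ge0.
by lra.
Qed.

End RealArithmetic.

Section Band.
Context {R : realType}.
Local Notation C := R[i].
Implicit Types (z E : C) (t x y u v : R) (i j : nat).
Variables (al be : C -> C) (P Q : {poly C}) (g : nat) (s0 ell : R) (d e : nat -> R).
Hypotheses
  (dal : forall (E0 a : C) (t : R) (E := E0 + a * t%:C),
    cder (fun t => al (E0 + a * t%:C)) t (a * (be E * P.[E] / 2)))
  (dka : forall (E0 a : C) (t : R) (E := E0 + a * t%:C),
    cder (fun t => be (E0 + a * t%:C) * Q.[E0 + a * t%:C]) t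
      (a * ((al E * P.[E] + be E * Q^`().[E]) / 2)))
  (pell_eq : forall E, al E ^+ 2 - 1 = be E ^+ 2 * Q.[E])
  (be_zero : forall E, Q.[E] = 0 -> be E = 0 -> P.[E] = 0)
  (al_conj : forall E, al (E^*)%C = ((al E)^*)%C)
  (be_conj : forall E, be (E^*)%C = ((be E)^*)%C)
  (QE : Q = ('X - s0%:C%:P) * \prod_(i < g) (('X - (d i)%:C%:P) * ('X - (e i)%:C%:P)))
  (P_size : size P = g.+1) (P_lead : lead_coef P = ell%:C) (ell_gt0 : 0 < ell)
  (ed : forall i, (i < g)%N -> e i < d i) (ds0 : forall i, (i < g)%N -> d i < s0)
  (de : forall i j, (i < j < g)%N -> d j < e i).

Let A x := Re (al x%:C).
Let B x := Re (be x%:C).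
Let h x := A x ^+ 2 - 1.
Let qr x := (x - s0) * \prod_(i < g) ((x - d i) * (x - e i)).

Let conj_fix (f : C -> C) x : (forall E, f (E^*)%C = ((f E)^*)%C) ->
  f x%:C = (Re (f x%:C))%:C.
Proof.
move=> /(_ x%:C); rewrite conjc_real; case: (f x%:C) => p r /= [] rE.
by congr Complex; lra.
Qed.

Let alE x : al x%:C = (A x)%:C. Proof. exact: conj_fix. Qed.
Let beE x : be x%:C = (B x)%:C. Proof. exact: conj_fix. Qed.

Let Q_real x : Q.[x%:C] = (qr x)%:C.
Proof.
rewrite QE hornerM hornerXsubC horner_prod /qr rmorphM rmorphB rmorph_prod /=.
congr (_ * _); apply: eq_bigr => i _.
by rewrite hornerM !hornerXsubC rmorphM !rmorphB.
Qed.

Let hE x : h x = B x ^+ 2 * qr x.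
Proof.
apply: (@complexI R); rewrite /h rmorphB rmorphXn rmorph1 rmorphM rmorphXn /=.
by rewrite -alE -beE -Q_real pell_eq.
Qed.

Let dal_real x : cder (fun t => al t%:C) x (be x%:C * P.[x%:C] / 2).
Proof.
have := dal 0 1 x; rewrite /= mul1r add0r mul1r.
by under eq_fun do rewrite add0r mul1r.
Qed.

Let dka_real x : cder (fun t => be t%:C * Q.[t%:C]) x
  ((al x%:C * P.[x%:C] + be x%:C * Q^`().[x%:C]) / 2).
Proof.
have := dka 0 1 x; rewrite /= mul1r add0r mul1r.
by under eq_fun do rewrite add0r mul1r.
Qed.

Let dh x : is_derive x 1 h (A x * B x * Re P.[x%:C]).
Proof.
have [dA _] := dal_real x.
have := is_derive_sub (is_derive_mul dA dA) (is_derive_cst (1 : R) x 1).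
have -> : (fun t => Re (al t%:C) * Re (al t%:C) - cst 1 t) = h.
  by apply/funext => t; rewrite /h expr2.
move=> dd; apply: is_derive_eq dd _.
rewrite beE -/(A x).
have -> : Re ((B x)%:C * P.[x%:C] / 2) = B x * Re P.[x%:C] / 2.
  have -> : (2^-1 : C) = (2^-1 : R)%:C by rewrite fmorphV rmorph_nat.
  by rewrite !ReM /=; ring.
by field.
Qed.

Let crit_root x : 0 < h x -> A x * B x * Re P.[x%:C] = 0 -> P.[x%:C] = 0.
Proof.
move=> h0 c0.
have A0 : A x != 0.
  by apply: contraTneq h0; rewrite /h => ->; rewrite expr0n/= sub0r -leNgt lerN10.
have B0 : B x != 0.
  by apply: contraTneq h0; rewrite hE => ->; rewrite expr0n/= mul0r ltxx.
have Re0 : Re P.[x%:C] = 0.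
  by move/eqP: c0; rewrite !mulf_eq0 (negPf A0) (negPf B0) /= => /eqP.
apply: complex_ext => //.
have [_ dI] := dal_real x.
have I0 : (fun t => Im (al t%:C)) = cst 0 by apply/funext => t; rewrite alE.
rewrite I0 in dI; have := is_derive_cst (0 : R) x (1 : R) => -[_ h1].
have [_ h2] := dI; move: h2; rewrite h1 beE.
have -> : (2^-1 : C) = (2^-1 : R)%:C by rewrite fmorphV rmorph_nat.
rewrite !ImM /= !mulr0 !mul0r !addr0 !add0r => /esym/eqP.
by rewrite !mulf_eq0 (negPf B0) invr_eq0 pnatr_eq0 /= orbF => /eqP.
Qed.

Let max_root u v y : u < y < v -> 0 <= h u -> h u < h y -> h v < h y ->
  exists2 x, u < x < v & P.[x%:C] = 0.
Proof.
move=> uyv hu huy hvy; have [x [uxv x0 hx]] := interior_max uyv dh huy hvy.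
by exists x => //; apply: crit_root => //; apply: lt_le_trans hx; exact: le_lt_trans huy.
Qed.

Let gap_root u v : u < v -> (forall x, u < x < v -> 0 < qr x) ->
  h u = 0 -> h v = 0 -> exists2 x, u < x < v & P.[x%:C] = 0.
Proof.
move=> uv qpos hu hv.
have [[y uyv hy]|noy] := pselect (exists2 y, u < y < v & 0 < h y).
  by apply: (max_root uyv); rewrite ?hu ?hv.
have B0 y : u < y < v -> B y = 0.
  move=> uyv; have := qpos _ uyv => qy; apply/eqP; rewrite -sqrf_eq0 eq_le sqr_ge0 andbT.
  rewrite leNgt; apply/negP => B2; apply: noy; exists y => //.
  by rewrite hE mulr_gt0.
pose m := (u + v) / 2; have um : u < m < v by apply/andP; rewrite /m; lra.
exists m => //.
have ka0 : \forall s \near m, 0 = be s%:C * Q.[s%:C].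
  have : \forall s \near m, s \in `]u, v[ by apply: near_in_itvoo; rewrite in_itv.
  by apply: filterS => s; rewrite in_itv/= => /B0 Bs; rewrite beE Bs mul0r.
have := cder_uniq (dka_real m) (cder_near ka0 (cder_cst 0 m)).
rewrite beE B0// mul0r addr0 => /eqP; rewrite mulf_eq0 invr_eq0 pnatr_eq0 orbF.
have := hE m; rewrite B0// expr0n/= mul0r /h => /eqP; rewrite subr_eq0 => /eqP A1.
have A0 : A m != 0 by rewrite -sqrf_eq0 A1 oner_eq0.
by rewrite mulf_eq0 alE fmorph_eq0 (negPf A0) => /eqP.
Qed.

Let e_lt_s0 i : (i < g)%N -> e i < s0.
Proof. by move=> ig; rewrite (lt_trans (ed ig))// ds0. Qed.

Let qr_out x : s0 < x -> 0 < qr x.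
Proof.
move=> sx; rewrite mulr_gt0 ?subr_gt0// prodr_gt0// => i _.
by rewrite mulr_gt0// subr_gt0 (lt_trans _ sx)// ?ds0 ?e_lt_s0.
Qed.

Let pair_pos i j x : (i < g)%N -> (j < g)%N -> i != j -> e i <= x <= d i ->
  0 < (x - d j) * (x - e j).
Proof.
move=> ig jg; rewrite neq_ltn => /orP[ij|ji] /andP[ex xd].
  have dx : d j < x by apply: lt_le_trans ex; rewrite de// ij.
  by rewrite mulr_gt0// subr_gt0// (lt_trans (ed jg)).
have xe : x < e j by apply: le_lt_trans xd _; rewrite de// ji.
by rewrite nmulr_rgt0 subr_lt0// (lt_trans xe)// ed.
Qed.

Let qr_gap i x : (i < g)%N -> e i < x < d i -> 0 < qr x.
Proof.
move=> ig /andP[ex xd]; rewrite /qr nmulr_rgt0 ?subr_lt0 ?(lt_trans xd)// ?ds0//.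
rewrite (bigD1 (Ordinal ig))//= nmulr_rlt0; last first.
  by rewrite nmulr_rlt0 ?subr_gt0// subr_lt0.
apply: prodr_gt0 => j ji; apply: (pair_pos (i := i)) => //; last by rewrite !ltW.
by rewrite eq_sym.
Qed.

Let qr_pos x : 0 < qr x -> s0 < x \/ exists2 i, (i < g)%N & e i < x < d i.
Proof.
move=> qx; have [|xs] := ltP s0 x; [by left|right].
apply: contrapT => no; move: qx; apply/negP; rewrite -leNgt.
rewrite mulr_le0_ge0 ?subr_le0//; apply: prodr_ge0 => i _.
have [xe|ex] := leP x (e i).
  by rewrite mulr_le0// subr_le0// (le_trans xe)// ltW// ed.
have [xd|dx] := ltP x (d i); last by rewrite mulr_ge0// subr_ge0// ltW.
by exfalso; apply: no; exists (i : nat) => //; rewrite ex.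
Qed.

Let h_end x : qr x = 0 -> h x = 0.
Proof. by rewrite hE => ->; rewrite mulr0. Qed.

Let qr_s0 : qr s0 = 0. Proof. by rewrite /qr subrr mul0r. Qed.

Let qr_d i : (i < g)%N -> qr (d i) = 0.
Proof.
by move=> ig; rewrite /qr (bigD1 (Ordinal ig))//= subrr !mul0r mulr0.
Qed.

Let qr_e i : (i < g)%N -> qr (e i) = 0.
Proof.
by move=> ig; rewrite /qr (bigD1 (Ordinal ig))//= subrr mulr0 mul0r mulr0.
Qed.

Let gap_zeros : exists a : nat -> R, forall i, (i < g)%N -> e i < a i < d i /\ P.[(a i)%:C] = 0.
Proof.
suff /choice[a aP] : forall i, exists x : R, (i < g)%N -> e i < x < d i /\ P.[x%:C] = 0.
  by exists a.
move=> i; have [ig|_] := boolP (i < g)%N; last by exists 0.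
have [x ex x0] := gap_root (ed ig) (fun x => qr_gap ig) (h_end (qr_e ig)) (h_end (qr_d ig)).
by exists x.
Qed.

Let a : nat -> R := sval (cid gap_zeros).
Let ea i : (i < g)%N -> e i < a i.
Proof. by move=> ig; have [/andP[]] := svalP (cid gap_zeros) _ ig. Qed.
Let ad i : (i < g)%N -> a i < d i.
Proof. by move=> ig; have [/andP[]] := svalP (cid gap_zeros) _ ig. Qed.
Let Pa i : (i < g)%N -> P.[(a i)%:C] = 0.
Proof. by move=> ig; have [] := svalP (cid gap_zeros) _ ig. Qed.

Let a_decr i j : (i < j < g)%N -> a j < a i.
Proof.
move=> /andP[ij jg]; have ig := ltn_trans ij jg.
by rewrite (lt_trans (ad jg))// (lt_trans _ (ea ig))// de// ij.
Qed.

Let Pt : {poly C} := \prod_(i < g) ('X - (a i)%:C%:P).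

Let PE : P = ell%:C *: Pt.
Proof.
pose rs := [seq (a i)%:C | i <- index_iota 0 g].
have -> : Pt = \prod_(z <- rs) ('X - z%:P) by rewrite big_map big_mkord.
rewrite -P_lead; apply: all_roots_prod_XsubC.
- by rewrite P_size size_map size_iota subn0.
- apply/allP => _ /mapP[i + ->]; rewrite mem_index_iota => /andP[_ /Pa].
  by move=> Pai; apply/eqP.
rewrite uniq_rootsE map_inj_in_uniq ?iota_uniq// => i j.
rewrite !mem_index_iota => /andP[_ ig] /andP[_ jg] /complexI aij.
have [ij|ji|//] := ltngtP i j.
  by have := @a_decr i j; rewrite ij jg aij ltxx => /(_ isT).
by have := @a_decr j i; rewrite ji ig aij ltxx => /(_ isT).
Qed.

Let P_root x : P.[x%:C] = 0 -> exists2 i, (i < g)%N & x = a i.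
Proof.
rewrite PE hornerZ horner_prod => /eqP; rewrite mulf_eq0 fmorph_eq0 gt_eqF//=.
move=> /prodf_eq0[i _]; rewrite hornerXsubC subr_eq0 => /eqP /complexI ->.
by exists i.
Qed.

Let gap_uniq i j x : (i < g)%N -> (j < g)%N -> e i < x < d i -> e j < x < d j -> i = j.
Proof.
move=> ig jg /andP[e1 d1] /andP[e2 d2]; apply/eqP; apply: contraT => ij.
have := @pair_pos i j x ig jg ij; rewrite !ltW// => /(_ isT).
by rewrite nmulr_rgt0 ?subr_lt0// ltNge ltW.
Qed.

Let root_in_gap i x : (i < g)%N -> e i < x < d i -> P.[x%:C] = 0 -> x = a i.
Proof.
move=> ig ex /P_root[j jg xa]; rewrite xa; congr a.
by apply: (gap_uniq jg ig _ ex); rewrite xa ea// ad.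
Qed.

Let no_root_out x : s0 < x -> P.[x%:C] = 0 -> False.
Proof.
move=> sx /P_root[j jg xa]; move: sx; rewrite xa ltNge ltW//.
by rewrite (lt_trans (ad jg))// ds0.
Qed.

Let h_pos x : 0 < qr x -> 0 < h x.
Proof.
move=> qx; rewrite lt_neqAle eq_sym hE mulr_ge0 ?sqr_ge0 ?andbT//; last exact: ltW.
rewrite -hE; apply/eqP => hx0.
case: (qr_pos qx) => [sx|[i ig /andP[ex xd]]].
  have [|y /andP[sy _] y0] := gap_root sx _ (h_end qr_s0) hx0.
    by move=> y /andP[sy _]; exact: qr_out.
  exact: no_root_out y0.
have [|y /andP[ey yx] y0] := gap_root ex _ (h_end (qr_e ig)) hx0.
  by move=> y /andP[ey yx]; apply: (qr_gap ig); rewrite ey (lt_trans yx).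
have [|y' /andP[xy yd] y0'] := gap_root xd _ hx0 (h_end (qr_d ig)).
  by move=> y' /andP[xy yd]; apply: (qr_gap ig); rewrite yd (lt_trans ex).
have e1 := root_in_gap ig _ y0; have e2 := root_in_gap ig _ y0'.
have := lt_trans yx xy; rewrite e1 ?ey ?(lt_trans yx)// e2 ?yd ?(lt_trans ex)//.
by rewrite ltxx.
Qed.

Let real_case x : `|A x| <= 1 -> (A x ^+ 2 = 1 -> B x = 0) -> qr x < 0.
Proof.
move=> A1 AB; have h0 : h x <= 0.
  by rewrite /h subr_le0 -[A x ^+ 2]real_normK ?num_real// expr_le1.
rewrite ltNge le_eqVlt; apply/negP => /orP[/eqP/esym q0|/h_pos]; last by rewrite ltNge h0.
have B0 : B x = 0 by apply: AB; apply/eqP; rewrite -subr_eq0 -/(h x) h_end.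
have /P_root[i ig xa] : P.[x%:C] = 0 by apply: be_zero; rewrite ?Q_real ?q0 ?beE ?B0.
by have := @qr_gap i x ig; rewrite {1 2}xa ea// ad// q0 ltxx => /(_ isT).
Qed.

Let pt x := \prod_(i < g) (x - a i).
Let dd x := \prod_(i < g) (x - d i).

Let Pt_real x : Pt.[x%:C] = (pt x)%:C.
Proof.
rewrite /Pt horner_prod rmorph_prod; apply: eq_bigr => i _.
by rewrite hornerXsubC /= rmorphB.
Qed.

Let sign_gap x : 0 < qr x -> P.[x%:C] != 0 -> 0 < A x * B x * dd x.
Proof.
move=> qx Px; have hx := h_pos qx.
have A0 : A x != 0.
  by apply: contraTneq hx; rewrite /h => ->; rewrite expr0n/= sub0r -leNgt lerN10.
have B0 : B x != 0.
  by apply: contraTneq hx; rewrite hE => ->; rewrite expr0n/= mul0r ltxx.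
have pt0 : pt x != 0.
  by apply: contraNneq Px => p0; rewrite PE hornerZ Pt_real p0 mulr0.
have RP : Re P.[x%:C] = ell * pt x by rewrite PE hornerZ Pt_real -rmorphM.
have ABpt : A x * B x * pt x != 0 by rewrite !mulf_neq0.
have left u : u < x -> h u = 0 -> (forall y, u < y < x -> P.[y%:C] <> 0) ->
    0 < A x * B x * pt x.
  move=> ux hu no; rewrite lt_neqAle eq_sym ABpt leNgt; apply/negP => neg.
  have dneg : A x * B x * Re P.[x%:C] < 0 by rewrite RP mulrCA pmulr_rlt0.
  have [y uyx hxy] := is_derive_neg_left (dh x) dneg ux.
  have [|||z uzx z0] := @max_root u x y uyx; rewrite ?hu//; last exact: no z0.
  exact: lt_trans hxy.
have ptdd : pt x * dd x = \prod_(i < g) ((x - a i) * (x - d i)) by rewrite -big_split.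
have pos_of : 0 < A x * B x * pt x -> 0 < pt x * dd x -> 0 < A x * B x * dd x.
  move=> h1 h2; have := mulr_gt0 h1 h2.
  have -> : A x * B x * pt x * (pt x * dd x) = pt x ^+ 2 * (A x * B x * dd x) by ring.
  by rewrite pmulr_rgt0// lt0r sqrf_eq0 pt0 sqr_ge0.
case: (qr_pos qx) => [sx|[i ig /andP[ex xd]]].
  apply: pos_of; first by apply: (left s0) => // [|y /andP[sy _]]; [exact: h_end|exact: no_root_out].
  rewrite ptdd; apply: prodr_gt0 => i _; have dx := lt_trans (ds0 (ltn_ord i)) sx.
  by rewrite mulr_gt0// subr_gt0// (lt_trans (ad _)).
have other j : (j < g)%N -> i != j -> 0 < (x - a j) * (x - d j).
  move=> jg ij; have := @pair_pos i j x ig jg ij; rewrite !ltW// => /(_ isT).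
  have := ea jg; have := ad jg => h1 h2.
  move: ij; rewrite neq_ltn => /orP[lij|lji] _.
    have dx : d j < x by apply: lt_trans ex; rewrite de// lij.
    by rewrite mulr_gt0// subr_gt0// (lt_trans h1).
  have xe : x < e j by apply: lt_trans xd _; rewrite de// lji.
  have xa : x < a j := lt_trans xe h2.
  by rewrite nmulr_rgt0 subr_lt0// (lt_trans xa).
have prod_other : 0 < \prod_(j < g | j != Ordinal ig) ((x - a j) * (x - d j)).
  by apply: prodr_gt0 => j ji; apply: other => //; rewrite eq_sym.
have [xa|xa] := ltP x (a i).
  apply: pos_of.
    apply: (left (e i)) => // [|y /andP[ey yx] y0]; first by rewrite h_end ?qr_e.
    have := root_in_gap ig _ y0; rewrite ey (lt_trans yx)// => /(_ isT) ya.
    by have := lt_trans yx xa; rewrite ya ltxx.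
  rewrite ptdd (bigD1 (Ordinal ig))//= mulr_gt0//.
  by rewrite nmulr_rgt0 subr_lt0.
have {}xa : a i < x.
  rewrite lt_neqAle xa andbT; apply: contraNneq Px => <-; exact/eqP/Pa.
have neg2 : pt x * dd x < 0.
  rewrite ptdd (bigD1 (Ordinal ig))//= pmulr_llt0//.
  by rewrite pmulr_rlt0 ?subr_gt0// subr_lt0.
have neg1 : A x * B x * pt x < 0.
  rewrite lt_neqAle ABpt leNgt; apply/negP => pos.
  have dpos : 0 < A x * B x * Re P.[x%:C] by rewrite RP mulrCA pmulr_rgt0.
  have [y xyd hxy] := is_derive_pos_right (dh x) dpos xd.
  have [|||z /andP[xz zd] z0] := @max_root x (d i) y xyd; rewrite ?ltW//.
    by rewrite h_end ?qr_d// (lt_trans hx).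
  have := root_in_gap ig _ z0; rewrite zd (lt_trans ex)// => /(_ isT) za.
  by have := lt_trans xa xz; rewrite za ltxx.
have : 0 < A x * B x * pt x * (pt x * dd x) by rewrite nmulr_rgt0.
have -> : A x * B x * pt x * (pt x * dd x) = pt x ^+ 2 * (A x * B x * dd x) by ring.
by rewrite pmulr_rgt0// lt0r sqrf_eq0 pt0 sqr_ge0.
Qed.

Let Dd : {poly C} := \prod_(i < g) ('X - (d i)%:C%:P).
Let Ee : {poly C} := ('X - s0%:C%:P) * \prod_(i < g) ('X - (e i)%:C%:P).

Let Q_split : Q = Dd * Ee.
Proof. by rewrite QE big_split /= mulrCA. Qed.

Let prod_neq0 (f : nat -> R) z : 0 < Im z -> (\prod_(i < g) ('X - (f i)%:C%:P)).[z] != 0.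
Proof.
by move=> z0; rewrite horner_prod; apply/prodf_neq0 => i _; rewrite hornerXsubC sub_real_neq0.
Qed.

Let Pt_neq0 z : 0 < Im z -> Pt.[z] != 0. Proof. exact: prod_neq0. Qed.
Let Dd_neq0 z : 0 < Im z -> Dd.[z] != 0. Proof. exact: prod_neq0. Qed.
Let Ee_neq0 z : 0 < Im z -> Ee.[z] != 0.
Proof.
by move=> z0; rewrite hornerM mulf_neq0 ?prod_neq0// hornerXsubC sub_real_neq0.
Qed.
Let Q_neq0 z : 0 < Im z -> Q.[z] != 0.
Proof. by move=> z0; rewrite Q_split hornerM mulf_neq0 ?Dd_neq0 ?Ee_neq0. Qed.

Let N1 z := - Pt.[z] / Ee.[z].
Let N2 z := Dd.[z] / Pt.[z].

Let Im_N1 z : 0 < Im z -> 0 < Im (N1 z).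
Proof.
move=> z0.
have h1 : all (fun p : R * R => 0 < p.1) [:: (1, s0)] by rewrite /= ltr01.
have h2 i : (i < g)%N -> all (fun p : R * R => a i < p.2) [:: (1, s0)].
  by move=> ig; rewrite /= andbT (lt_trans (ad ig))// ds0.
have h3 i j : (i < j < g)%N -> a j < e i.
  by move=> /andP[ij jg]; rewrite (lt_trans (ad jg))// de// ij.
have [ts [tpos tn tE]] :=
  partial_fractions_prod (lexx 0) (orbT _ : (0 < 0) || ([:: (1, s0)] != [::])) h1 ea h2 h3.
have -> : N1 z = partial_fractions 0 ts z.
  rewrite tE// /partial_fractions big_seq1 /= sub0r prodf_div /N1 hornerM !horner_prod.
  under eq_bigr do rewrite hornerXsubC; under [in X in _ / X]eq_bigr do rewrite hornerXsubC.
  by rewrite hornerXsubC invfM !mulNr div1r mulrCA mulrA.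
by have [_] := Im_partial_fractions 0 z0 tpos; apply; apply: tn.
Qed.

Let Im_N2 z : 0 < Im z -> 0 <= Im (N2 z).
Proof.
move=> z0.
have h3 i j : (i < j < g)%N -> d j < a i.
  by move=> /andP[ij jg]; rewrite (lt_trans _ (ea _)) ?de ?ij// (ltn_trans ij).
have h1 : (0 < 1 :> R) || ([::] != [::] :> seq (R * R)) by rewrite ltr01.
have [ts [tpos tn tE]] := @partial_fractions_prod R g a d 1 [::] ler01 h1 isT ad
  (fun _ _ => isT) h3.
have -> : N2 z = partial_fractions 1 ts z.
  rewrite tE// /partial_fractions big_nil subr0 mul1r prodf_div /N2 !horner_prod.
  by congr (_ / _); apply: eq_bigr => i _; rewrite hornerXsubC.
by have [] := Im_partial_fractions 1 z0 tpos.
Qed.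

Let rho2 z := N1 z / N2 z.
Let rho z := principal_root (rho2 z).

Let rho2_cut z : 0 < Im z -> 0 < normc (rho2 z) + Re (rho2 z).
Proof.
move=> z0; rewrite ltNge; apply/negP => hle.
have n0 := normc_ge0 (rho2 z); have sq := normcE2 (rho2 z).
have I2 := sqr_ge0 (Im (rho2 z)).
have I0 : Im (rho2 z) = 0 by apply/eqP; rewrite -sqrf_eq0; apply/eqP; nra.
have R0 : Re (rho2 z) <= 0 by lra.
have N2z : N2 z != 0 by rewrite mulf_neq0 ?Dd_neq0// invr_eq0 Pt_neq0.
have e1 : N1 z = rho2 z * N2 z by rewrite /rho2 divfK.
have := Im_N1 z0; rewrite e1 ImM I0 mul0r addr0 ltNge.
by rewrite mulr_le0_ge0// Im_N2.
Qed.

Let rho2E z : 0 < Im z -> rho2 z = - Pt.[z] ^+ 2 / Q.[z].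
Proof.
move=> z0; rewrite /rho2 /N1 /N2 Q_split (hornerM Dd Ee); field.
by rewrite Ee_neq0// Dd_neq0// Pt_neq0.
Qed.

Let rho_gt0 z : 0 < Im z -> 0 < Re (rho z).
Proof. by move=> /rho2_cut/principal_rootP[]. Qed.

Let rho_sq z : 0 < Im z -> rho z ^+ 2 = rho2 z.
Proof. by move=> /rho2_cut/principal_rootP[]. Qed.

Let ii : C := (0 +i* 1)%C.
Let ii2 : ii * ii = -1. Proof. exact: (sqr_i R). Qed.

Let rr z := rho z / Pt.[z].

Let rr_sq z : 0 < Im z -> rr z ^+ 2 * Q.[z] = -1.
Proof.
move=> z0; rewrite /rr exprMn rho_sq// rho2E//; field.
by rewrite Q_neq0// Pt_neq0.
Qed.

Let near_upper (E0 c : C) t : 0 < Im (E0 + c * t%:C) ->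
  \forall s \near t, 0 < Im (E0 + c * s%:C).
Proof.
move=> z0; have [_ cI] := cder_cont (cder_line E0 c t).
exact: (cvgr_gt _ cI).
Qed.

Let rr_cder (E0 c : C) t (E := E0 + c * t%:C) : 0 < Im E ->
  cder (fun s => rr (E0 + c * s%:C)) t (- rr E * c * Q^`().[E] / (2 * Q.[E])).
Proof.
move=> z0; have dp p := cder_poly p (cder_line E0 c t).
have [l dl] : exists l, cder (fun s => rr (E0 + c * s%:C)) t l.
  have Ez : Ee.[E] != 0 := Ee_neq0 z0; have Pz : Pt.[E] != 0 := Pt_neq0 z0.
  have Dz : Dd.[E] != 0 := Dd_neq0 z0.
  have N2z : N2 E != 0 by rewrite mulf_neq0// invr_eq0.
  have dN1 := cderM (cderN (dp Pt)) (cder_inv Ez (dp Ee)).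
  have dN2 := cderM (dp Dd) (cder_inv Pz (dp Pt)).
  have dr2 := cderM dN1 (cder_inv N2z dN2).
  have := cderM (cder_principal_root (rho2_cut z0) dr2) (cder_inv Pz (dp Pt)).
  by eexists; eassumption.
apply: (cder_eq dl).
have near1 : \forall s \near t,
    rr (E0 + c * s%:C) * rr (E0 + c * s%:C) * Q.[E0 + c * s%:C] = -1.
  by apply: filterS (near_upper z0) => s /rr_sq; rewrite expr2.
have := cder_uniq (cder_near near1 (cderM (cderM dl dl) (dp Q))) (cder_cst (-1) t).
rewrite -/E => h0.
have Q0 := Q_neq0 z0; have rr0 : rr E != 0.
  apply/eqP => r0; have := rr_sq z0; rewrite r0 expr0n/= mul0r => /eqP.
  by rewrite eq_sym oppr_eq0 oner_eq0.
apply: (mulIf (mulf_neq0 (mulf_neq0 rr0 Q0) (_ : (2 : C) != 0))); first by rewrite pnatr_eq0.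
apply: subr0_eq; rewrite -h0; field; exact: Q_neq0.
Qed.

Let lam z := al z - ii * (be z * Q.[z]) * rr z.

Let lam_sq z : 0 < Im z -> (lam z - al z) ^+ 2 = al z ^+ 2 - 1.
Proof.
move=> z0; rewrite pell_eq /lam.
have -> : (al z - ii * (be z * Q.[z]) * rr z - al z) ^+ 2 =
  (ii * ii) * be z ^+ 2 * Q.[z] * (rr z ^+ 2 * Q.[z]) by ring.
by rewrite ii2 rr_sq//; ring.
Qed.

Let lam_cder (E0 c : C) t (E := E0 + c * t%:C) : 0 < Im E ->
  cder (fun s => lam (E0 + c * s%:C)) t (c * (- ii * ell%:C / 2 * rho E) * lam E).
Proof.
move=> z0; apply: cder_eq.
  exact: cderB (dal E0 c t) (cderM (cderMl ii (dka E0 c t)) (rr_cder z0)).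
rewrite -/E /=; have rs := rr_sq z0; have Q0 := Q_neq0 z0.
have eP : ell%:C * rho E = P.[E] * rr E.
  by rewrite PE hornerZ /rr; field; exact: Pt_neq0.
have -> : c * (- ii * ell%:C / 2 * rho E) * lam E =
    c * (- ii * (ell%:C * rho E) / 2) * lam E by ring.
rewrite eP /lam.
transitivity (c * (be E * P.[E] / 2 - ii * al E * P.[E] * rr E / 2)); first by field.
have -> : c * (- ii * (P.[E] * rr E) / 2) * (al E - ii * (be E * Q.[E]) * rr E) =
  c * (- ii * al E * P.[E] * rr E / 2 + (ii * ii) * P.[E] * be E / 2 * (rr E ^+ 2 * Q.[E])).
  by field.
by rewrite rs ii2; field.
Qed.

Let zt x t := x%:C + ii * t%:C.
Let Im_zt x t : Im (zt x t) = t.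
Proof. by rewrite /zt ImD ImM /=; ring. Qed.

Let lam_inv z : 0 < Im z -> lam z * (2 * al z - lam z) = 1.
Proof.
move=> /lam_sq h0; apply: subr0_eq.
transitivity ((al z ^+ 2 - 1) - (lam z - al z) ^+ 2); first by ring.
by rewrite h0 subrr.
Qed.

Let lam_norm z : 0 < Im z ->
  [/\ 0 < normc (lam z), normc (lam z) * normc (2 * al z - lam z) = 1,
   normc (lam z) ^+ 2 + normc (2 * al z - lam z) ^+ 2 =
     2 * normc (al z) ^+ 2 + 2 * normc (al z ^+ 2 - 1) &
   normc (lam z) ^+ 2 - normc (2 * al z - lam z) ^+ 2 =
     4 * Re ((al z)^*%C * (lam z - al z))].
Proof.
move=> z0; have hi := lam_inv z0.
have n1 : normc (lam z) * normc (2 * al z - lam z) = 1.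
  by rewrite -normcM hi ComplexField.Normc.normc1.
have -> : normc (al z ^+ 2 - 1) = normc (lam z - al z) ^+ 2.
  by rewrite -lam_sq// !expr2 normcM.
move: (lam z) (al z) n1 => m b n1; rewrite !normcE2; split=> //.
- rewrite lt0r normc_ge0 andbT; apply/eqP => n0; move: n1.
  by rewrite n0 mul0r => /esym/eqP; rewrite oner_eq0.
- by case: m b {n1} => ? ? [? ?] /=; ring.
- by case: m b {n1} => ? ? [? ?] /=; ring.
Qed.

Let L x t := normc (lam (zt x t)) ^+ 2.

Let L_incr x t1 t2 : 0 < t1 -> t1 < t2 -> L x t1 < L x t2.
Proof.
move=> t10 t12.
apply: (is_derive_ltr (f := L x) (df := fun t => ell * Re (rho (zt x t)) * L x t)) => // t /andP[tt _].
  have t0 : 0 < t := lt_le_trans t10 tt.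
  have z0 : 0 < Im (x%:C + ii * t%:C) by rewrite -/(zt x t) Im_zt.
  have [d1 d2] := lam_cder z0.
  have := is_derive_add (is_derive_mul d1 d1) (is_derive_mul d2 d2).
  have -> : (fun t => Re (lam (x%:C + ii * t%:C)) * Re (lam (x%:C + ii * t%:C)) +
     Im (lam (x%:C + ii * t%:C)) * Im (lam (x%:C + ii * t%:C))) = L x.
    by apply/funext => s; rewrite /L normcE2 !expr2.
  move=> dL; apply: is_derive_eq dL _.
  rewrite /L normcE2 -/(zt x t).
  have -> : ii * (- ii * ell%:C / 2 * rho (zt x t)) * lam (zt x t) =
     (ell / 2)%:C * (rho (zt x t) * lam (zt x t)).
    transitivity (- (ii * ii) * ell%:C / 2 * rho (zt x t) * lam (zt x t)); first by ring.
    by rewrite ii2 rmorphM fmorphV rmorph_nat; ring.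
  by move: (rho _) (lam _) => [? ?] [? ?] /=; field.
have t0 : 0 < t := lt_le_trans t10 tt.
have z0 : 0 < Im (zt x t) by rewrite Im_zt.
have [l0 _ _ _] := lam_norm z0.
by rewrite /L mulr_gt0 ?exprn_gt0// mulr_gt0 ?rho_gt0.
Qed.

Let zt0 x : zt x 0 = x%:C. Proof. by rewrite /zt mulr0 addr0. Qed.

Let near_Re (u : R -> C) t l : cder u t l -> 0 < Re (u t) ->
  \forall s \near t, 0 < Re (u s).
Proof. by move=> /cder_cont[cu _] u0; exact: (cvgr_gt _ cu). Qed.

(* Near a gap point the branch of [rho] is controlled by the sign of [Re N2],
   which agrees with that of [ka / Pt] by [sign_gap]. *)
Let gap_limit x T : 0 < qr x -> P.[x%:C] != 0 -> 0 < T ->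
  exists2 t, 0 < t < T & 1 <= L x t.
Proof.
move=> qx Px T0; have sg := sign_gap qx Px.
have Px' : Pt.[x%:C] != 0 by apply: contraNneq Px => p0; rewrite PE hornerZ p0 mulr0.
have pt0 : pt x != 0 by rewrite Pt_real fmorph_eq0 in Px'.
have dd0 : dd x != 0 by apply: contraTneq sg => ->; rewrite mulr0 ltxx.
have DdE : Dd.[x%:C] = (dd x)%:C.
  rewrite /Dd horner_prod rmorph_prod; apply: eq_bigr => i _.
  by rewrite hornerXsubC /= rmorphB.
have Qx : Q.[x%:C] != 0 by rewrite Q_real fmorph_eq0 gt_eqF.
have Ex : Ee.[x%:C] != 0 by move: Qx; rewrite Q_split hornerM mulf_eq0 negb_or => /andP[].
have dp p := cder_poly p (cder_line x%:C ii 0).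
pose chi z := (al z)^*%C * (be z * Q.[z]) / Pt.[z].
have x0 : x%:C + ii * (0 : R)%:C = x%:C by rewrite mulr0 addr0.
have [lchi dchi] : exists l, cder (fun t => chi (zt x t)) 0 l.
  have Pz : Pt.[x%:C + ii * (0 : R)%:C] != 0 by rewrite x0.
  have := cderM (cderM (cderJ (dal x%:C ii 0)) (dka x%:C ii 0)) (cder_inv Pz (dp Pt)).
  by eexists; eassumption.
have [lN2 dN2] : exists l, cder (fun t => N2 (zt x t)) 0 l.
  have Pz : Pt.[x%:C + ii * (0 : R)%:C] != 0 by rewrite x0.
  have := cderM (dp Dd) (cder_inv Pz (dp Pt)).
  by eexists; eassumption.
have [lr2 dr2] : exists l, cder (fun t => - Pt.[zt x t] ^+ 2 / Q.[zt x t]) 0 l.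
  have Qz : Q.[x%:C + ii * (0 : R)%:C] != 0 by rewrite x0.
  by eexists; exact: (cderM (cderN (cderM (dp Pt) (dp Pt))) (cder_inv Qz (dp Q))).
have chi0 : chi x%:C = (A x * B x * qr x / pt x)%:C.
  by rewrite /chi alE beE Q_real Pt_real conjc_real !rmorphM fmorphV mulrA.
have n20 : N2 x%:C = (dd x / pt x)%:C by rewrite /N2 DdE Pt_real rmorphM fmorphV.
pose s : R := if 0 < dd x / pt x then 1 else -1.
have s2 : s * s = 1 by rewrite /s; case: ifP; rewrite ?mulr1// mulrNN mulr1.
have sn2 : 0 < s * (dd x / pt x).
  rewrite /s; case: ifPn => [h0|]; [by rewrite mul1r|rewrite -leNgt => h0].
  by rewrite mulN1r oppr_gt0 lt_neqAle h0 andbT mulf_neq0// invr_eq0.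
have schi : 0 < s * (A x * B x * qr x / pt x).
  have dd2 : 0 < dd x ^+ 2 by rewrite lt0r sqrf_eq0 dd0 sqr_ge0.
  rewrite -(pmulr_rgt0 _ dd2).
  have -> : dd x ^+ 2 * (s * (A x * B x * qr x / pt x)) =
    (A x * B x * dd x) * qr x * (s * (dd x / pt x)) by ring.
  exact: mulr_gt0 (mulr_gt0 sg qx) sn2.
have near_all : \forall t \near (0 : R), [/\ 0 < Re (s%:C * N2 (zt x t)),
    0 < Re (- (- Pt.[zt x t] ^+ 2 / Q.[zt x t])),
    0 < Re ((s%:C * (1 + ii)) * chi (zt x t)) & 0 < Re ((s%:C * (1 - ii)) * chi (zt x t))].
  have h1 : \forall t \near (0 : R), 0 < Re (s%:C * N2 (zt x t)).
    by apply: (near_Re (cderMl _ dN2)); rewrite zt0 n20 -rmorphM.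
  have h2 : \forall t \near (0 : R), 0 < Re (- (- Pt.[zt x t] ^+ 2 / Q.[zt x t])).
    apply: (near_Re (cderN dr2)); rewrite zt0 Pt_real Q_real mulNr opprK.
    by rewrite -rmorphXn -fmorphV -rmorphM /= divr_gt0// lt0r sqrf_eq0 pt0 sqr_ge0.
  have h3 : \forall t \near (0 : R), 0 < Re ((s%:C * (1 + ii)) * chi (zt x t)).
    apply: (near_Re (cderMl _ dchi)); rewrite zt0 chi0 !ReM !ImM /=.
    by rewrite !mul0r !mulr0 !subr0 !addr0 mulr1.
  have h4 : \forall t \near (0 : R), 0 < Re ((s%:C * (1 - ii)) * chi (zt x t)).
    apply: (near_Re (cderMl _ dchi)); rewrite zt0 chi0 !ReM !ImM /=.
    by rewrite !mul0r !mulr0 !subr0 mulr1.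
  by near=> t; split; near: t.
have /nbhs_ballP[dl /= dl0 hdl] := near_all.
pose t := Num.min dl T / 2.
have m0 : 0 < Num.min dl T by rewrite lt_min dl0.
have t0 : 0 < t by rewrite divr_gt0.
have tlt : t < Num.min dl T by rewrite /t; lra.
have [tdl tT] : t < dl /\ t < T by move: tlt; rewrite lt_min => /andP[].
exists t; first by rewrite t0.
have := hdl t; rewrite /ball/= sub0r normrN gtr0_norm// => /(_ tdl) [r1 r2 r3 r4].
have z0 : 0 < Im (zt x t) by rewrite Im_zt.
have rp := rho_gt0 z0; have rs := rho_sq z0; have rE := rho2E z0.
have N2z : N2 (zt x t) != 0 by rewrite mulf_neq0 ?Dd_neq0// invr_eq0 Pt_neq0.
have rN : rho (zt x t) ^+ 2 * N2 (zt x t) = N1 (zt x t) by rewrite rs /rho2 divfK.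
have I1 := Im_N1 z0; have I2 := Im_N2 z0.
have [l0 l1 _ l3] := lam_norm z0.
have key : 0 <= Re ((al (zt x t))^*%C * (lam (zt x t) - al (zt x t))).
  have -> : (al (zt x t))^*%C * (lam (zt x t) - al (zt x t)) =
     - ii * (chi (zt x t) * rho (zt x t)).
    by rewrite /lam /rr /chi; field; exact: Pt_neq0.
  rewrite -rE -rs in r2; rewrite -rN in I1.
  move: r1 r2 r3 r4 rp I1 I2; move: (N2 _) (chi _) (rho _) => [n n'] [c c'] [p p'].
  rewrite expr2 /= !(mul0r, mulr0, mul1r, mulr1, subr0, addr0, add0r, sub0r, oppr0, mulN1r, mulNr).
  move=> r1 r2 r3 r4 rp I1 I2; rewrite mulrN1 mulNr opprK in r4.
  by have := branch_sign s2 r1 r2 r3 r4 rp I1 I2; rewrite ?opprK.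
rewrite /L; have n0 := normc_ge0 (2 * al (zt x t) - lam (zt x t)).
rewrite leNgt; apply/negP => Llt1; have Lle1 := ltW Llt1.
have h1 : normc (2 * al (zt x t) - lam (zt x t)) ^+ 2 <= normc (lam (zt x t)) ^+ 2 by lra.
have : (normc (lam (zt x t)) * normc (2 * al (zt x t) - lam (zt x t))) ^+ 2 < 1.
  rewrite exprMn; apply: le_lt_trans (_ : _ <= normc (lam (zt x t)) ^+ 2) Llt1.
  exact: (ler_piMr (sqr_ge0 _) (le_trans h1 Lle1)).
by rewrite l1 expr1n ltxx.
Unshelve. all: by end_near. Qed.

Let normc_cont (u : R -> C) t l : cder u t l -> {for t, continuous (fun s => normc (u s))}.
Proof.
move=> /cder_cont[cR cI].
have -> : (fun s => normc (u s)) = Num.sqrt \o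
    (fun s => Re (u s) * Re (u s) + Im (u s) * Im (u s)).
  by apply/funext => s /=; rewrite -!expr2; case: (u s).
apply: continuous_comp; last exact: sqrt_continuous.
by apply: cvgD; apply: cvgM.
Qed.

Let band_limit x T eps : qr x <= 0 -> 0 < T -> 0 < eps ->
  exists2 t, 0 < t < T & 1 - eps < L x t.
Proof.
move=> qx T0 eps0.
have A2 : A x ^+ 2 <= 1.
  by rewrite -subr_le0 -/(h x) hE mulr_ge0_le0// sqr_ge0.
pose D t := normc (al (zt x t)) ^+ 2 + normc (al (zt x t) ^+ 2 - 1).
have D0 : D 0 = 1.
  rewrite /D zt0 alE -rmorphXn -(rmorph1 (real_complex R)) -rmorphB !normc_real.
  by rewrite real_normK ?num_real// ler0_norm ?subr_le0//; ring.
have cD : {for (0 : R), continuous D}.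
  have c1 := normc_cont (dal x%:C ii 0).
  have c2 := normc_cont (cderB (cderM (dal x%:C ii 0) (dal x%:C ii 0)) (cder_cst 1 0)).
  have -> : D = fun t => normc (al (x%:C + ii * t%:C)) * normc (al (x%:C + ii * t%:C)) +
     normc (al (x%:C + ii * t%:C) * al (x%:C + ii * t%:C) - 1).
    by apply/funext => t; rewrite /D !expr2.
  by apply: cvgD => //; apply: cvgM.
have hn : \forall t \near (0 : R), D t < 1 + eps ^+ 2 / 2.
  by apply: (cvgr_lt _ cD); rewrite D0 ltrDl divr_gt0// exprn_gt0.
have /nbhs_ballP[dl /= dl0 hdl] := hn.
pose t := Num.min dl T / 2.
have m0 : 0 < Num.min dl T by rewrite lt_min dl0.
have t0 : 0 < t by rewrite divr_gt0.
have tlt : t < Num.min dl T by rewrite /t; lra.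
have [tdl tT] : t < dl /\ t < T by move: tlt; rewrite lt_min => /andP[].
exists t; first by rewrite t0.
have := hdl t; rewrite /ball/= sub0r normrN gtr0_norm// => /(_ tdl) hD.
have z0 : 0 < Im (zt x t) by rewrite Im_zt.
have [l0 l1 l2 _] := lam_norm z0; rewrite /L; set X := normc (lam (zt x t)) ^+ 2.
move: l2; rewrite -/X; set Y := normc (2 * _ - _) ^+ 2.
rewrite -mulrDr -/(D t) => l2.
have X0 : 0 < X by rewrite exprn_gt0.
have XY : X * Y = 1 by rewrite /X /Y -exprMn l1 expr1n.
by apply: (sum_inverse_bound X0 XY eps0); rewrite l2; lra.
Qed.

Let L_gt1_nice x t : (qr x <= 0) || (P.[x%:C] != 0) -> 0 < t -> 1 < L x t.
Proof.
move=> nice t0; rewrite ltNge; apply/negP => L1.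
have t20 : 0 < t / 2 by rewrite divr_gt0.
have t2 : t / 2 < t by lra.
have L2 : L x (t / 2) < 1 by apply: lt_le_trans L1; exact: L_incr.
have [t' /andP[t'0 t't]] : exists2 t', 0 < t' < t / 2 & 1 - (1 - L x (t / 2)) < L x t'.
  have [qx|qx] := lerP (qr x) 0; first by apply: band_limit; rewrite ?subr_gt0.
  move: nice; rewrite leNgt qx /= => Px.
  have [t' tt L'] := gap_limit qx Px t20; exists t' => //.
  by apply: lt_le_trans L'; rewrite opprB addrC subrK.
by rewrite opprB addrC subrK ltNge ltW// L_incr.
Qed.

Let L_gt1 x t : 0 < t -> 1 < L x t.
Proof.
move=> t0.
have [nice|] := boolP ((qr x <= 0) || (P.[x%:C] != 0)); first exact: L_gt1_nice.
rewrite negb_or -ltNge negbK => /andP[qx /eqP Px].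
have [i ig xa] := P_root Px.
rewrite ltNge; apply/negP => L1.
have t20 : 0 < t / 2 by rewrite divr_gt0.
have t2 : t / 2 < t by lra.
have L2 : L x (t / 2) < 1 by apply: lt_le_trans L1; exact: L_incr.
(* At a zero of [P] compare with neighbouring abscissas. *)
have z0 : 0 < Im (zt x (t / 2) + 1 * (0 : R)%:C) by rewrite mul1r addr0 Im_zt.
have cM := normc_cont (lam_cder z0).
have zE s : zt x (t / 2) + 1 * s%:C = zt (x + s) (t / 2).
  by rewrite /zt mul1r rmorphD /= addrAC.
have M1 : normc (lam (zt x (t / 2) + 1 * (0 : R)%:C)) < 1.
  rewrite mul1r addr0 -(ltr_pXn2r (n := 2))// ?nnegrE ?normc_ge0// expr1n.
  exact: L2.
have n1 : \forall s \near (0 : R), normc (lam (zt x (t / 2) + 1 * s%:C)) < 1.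
  exact: (cvgr_lt _ cM).
have /nbhs_ballP[dl /= dl0 hdl] := n1.
pose s := Num.min dl (d i - x) / 2.
have dx : 0 < d i - x by rewrite subr_gt0 xa ad.
have m0 : 0 < Num.min dl (d i - x) by rewrite lt_min dl0.
have s_gt0 : 0 < s by rewrite divr_gt0.
have slt : s < Num.min dl (d i - x) by rewrite /s; lra.
have [sdl sd] : s < dl /\ s < d i - x by move: slt; rewrite lt_min => /andP[].
have := hdl s; rewrite /ball/= sub0r normrN gtr0_norm// => /(_ sdl).
rewrite zE => hlt.
have xs : e i < x + s < d i.
  by have := ea ig; rewrite -xa => ?; apply/andP; split; lra.
have Pxs : P.[(x + s)%:C] != 0.
  apply/eqP => /(root_in_gap ig xs); rewrite -xa => /eqP.
  by rewrite -subr_eq0 addrC addKr gt_eqF.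
have := @L_gt1_nice (x + s) (t / 2); rewrite Pxs orbT => /(_ isT t20).
rewrite /L ltNge => /negP; apply.
by rewrite expr_le1// ?normc_ge0// ltW.
Qed.

Let nonreal_case E : 0 < Im E -> Im (al E) = 0 -> `|Re (al E)| <= 1 -> False.
Proof.
move=> z0 I0 R1.
have EE : E = zt (Re E) (Im E).
  by case: E {z0 I0 R1} => p r; apply: complex_ext; rewrite /zt ?ReD ?ImD ?ReM ?ImM /=; ring.
have := @L_gt1 (Re E) (Im E) z0; rewrite /L -EE => L1.
have [_ l1 l2 _] := lam_norm z0.
have aE : al E = (Re (al E))%:C by apply: complex_ext.
have A2 : Re (al E) ^+ 2 <= 1 by rewrite -[_ ^+ 2]real_normK ?num_real// expr_le1.
have nE : 2 * normc (al E) ^+ 2 + 2 * normc (al E ^+ 2 - 1) = 2.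
  rewrite aE -rmorphXn -(rmorph1 (real_complex R)) -rmorphB !normc_real.
  by rewrite real_normK ?num_real// ler0_norm ?subr_le0//; ring.
move: l2; rewrite nE; set X := normc (lam E) ^+ 2; set Y := normc (2 * _ - _) ^+ 2 => l2.
have XY : X * Y = 1 by rewrite /X /Y -exprMn l1 expr1n.
have : 0 < (X - 1) ^+ 2 by rewrite exprn_gt0// subr_gt0.
have -> : (X - 1) ^+ 2 = X * (X + Y - 2) by rewrite mulrBr mulrDr XY; ring.
by rewrite l2 subrr mulr0 ltxx.
Qed.

Theorem band_negative E : Im (al E) = 0 -> `|Re (al E)| <= 1 ->
  (al E ^+ 2 = 1 -> be E = 0) -> Im Q.[E] = 0 /\ Re Q.[E] < 0.
Proof.
move=> I0 R1 ab.
have [Eneg|Epos|E0] := ltgtP (Im E) 0.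
- exfalso; apply: (@nonreal_case (E^*)%C); rewrite ?al_conj.
  + by case: E Eneg {I0 R1 ab} => ? ? /=; rewrite oppr_gt0.
  + by case: (al E) I0 => ? ? /= ->; rewrite oppr0.
  + by case: (al E) R1.
- by case: (nonreal_case Epos I0 R1).
have EE : E = (Re E)%:C by apply: complex_ext.
rewrite EE Q_real; split=> //=; apply: real_case; first by rewrite /A -EE.
move=> A1; rewrite /B -EE ab// EE alE -rmorphXn /= A1//.
Qed.

End Band.

(** * Unitarity on a line *)

Section Unitary.
Context {R : realType}.
Local Notation C := R[i].

Lemma mx2P (A B : 'M[C]_2) : A 0 0 = B 0 0 -> A 0 1 = B 0 1 -> A 1 0 = B 1 0 ->
  A 1 1 = B 1 1 -> A = B.
Proof.
move=> h00 h01 h10 h11; apply/matrixP => i j.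
have o2 (k : 'I_2) : k = 0 \/ k = 1.
  by case: k => -[|[|//]] h; [left|right]; exact/val_inj.
by case: (o2 i) => ->; case: (o2 j) => ->.
Qed.

Lemma det2 (A : 'M[C]_2) : \det A = A 0 0 * A 1 1 - A 0 1 * A 1 0.
Proof.
rewrite (expand_det_row _ 0) !big_ord_recl big_ord0 addr0 /cofactor !det_mx11 !mxE /=.
rewrite expr0 expr1 mul1r mulN1r mulrN.
have l1 : lift 0 0 = 1 :> 'I_2 by exact/val_inj.
have l2 : lift 1 0 = 0 :> 'I_2 by exact/val_inj.
have l3 : lift ord0 ord0 = 1 :> 'I_2 by exact/val_inj.
by rewrite ?l1 ?l2 ?l3.
Qed.

Lemma SU2_entries (V : 'M[C]_2) : SU2 V ->
  V 1 1 = ((V 0 0)^*)%C /\ V 1 0 = - ((V 0 1)^*)%C /\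
  normc (V 0 0) ^+ 2 + normc (V 0 1) ^+ 2 = 1.
Proof.
move=> [/unitarymxP /matrixP VV]; rewrite det2 => detV.
have e00 := VV 0 0; have e10 := VV 1 0; have e01 := VV 0 1.
rewrite !mxE !big_ord_recl big_ord0 addr0 !mxE /= in e00.
rewrite !mxE !big_ord_recl big_ord0 addr0 !mxE /= in e10.
have l3 : lift ord0 ord0 = 1 :> 'I_2 by exact/val_inj.
rewrite l3 -[ord0]/(0 : 'I_2) in e00 e10.
move: e00 e10 detV; move: (V 0 0) (V 0 1) (V 1 0) (V 1 1) => a b c d.
rewrite -[(a^*)]/((a^*)%C) -[(b^*)]/((b^*)%C) => e00 e10 detV.
have d1 : d = (a^*)%C.
  apply: subr0_eq; transitivity (d * (1 - (a * (a^*)%C + b * (b^*)%C)) +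
    (a^*)%C * (a * d - b * c - 1) + b * (c * (a^*)%C + d * (b^*)%C)); first by ring.
  by rewrite e00 detV e10 !subrr !mulr0 !addr0.
have c1 : c = - (b^*)%C.
  apply: subr0_eq; transitivity (c * (1 - (a * (a^*)%C + b * (b^*)%C)) -
    (b^*)%C * (a * d - b * c - 1) + a * (c * (a^*)%C + d * (b^*)%C)); first by ring.
  by rewrite e00 detV e10 !subrr !mulr0 subr0 addr0.
split=> //; split=> //; rewrite !normcE2.
by case: a b e00 {e10 detV d1 c1} => p q [r s] /= [e _]; rewrite -e; ring.
Qed.

Lemma SU2_similar (T S V : 'M[C]_2) (t := \tr T / 2) : S \in unitmx -> SU2 V ->
  S *m T = V *m S -> [/\ Im t = 0, `|Re t| <= 1 & t ^+ 2 = 1 -> T = t%:M].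
Proof.
move=> Su SV ST; have [d1 [c1 n1]] := SU2_entries SV.
have TE : T = invmx S *m V *m S by rewrite -mulmxA -ST mulmxA mulVmx// mul1mx.
have trV : \tr T = V 0 0 + V 1 1.
  rewrite TE mxtrace_mulC mulmxA mulmxV// mul1mx /mxtrace !big_ord_recl big_ord0 addr0.
  by congr (_ + V _ _); exact/val_inj.
have tE : t = (Re (V 0 0))%:C.
  rewrite /t trV d1; case: (V 0 0) => p q.
  have -> : (p +i* q + ((p +i* q)^*)%C = 2 * p%:C)%C by apply: complex_ext => /=; ring.
  by rewrite mulrC mulrA mulVf ?mul1r ?pnatr_eq0.
split; first by rewrite tE.
  rewrite tE /= -(ler_pXn2r (n := 2))// ?nnegrE// expr1n real_normK ?num_real//.
  by move: n1; rewrite !normcE2 => <-; rewrite -addrA lerDl !addr_ge0 ?sqr_ge0.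
rewrite {1}tE -rmorphXn -(rmorph1 (real_complex R)) => /complexI R1.
have : Im (V 0 0) ^+ 2 + normc (V 0 1) ^+ 2 == 0.
  by apply/eqP; move: n1; rewrite normcE2 R1; lra.
rewrite paddr_eq0 ?sqr_ge0// !sqrf_eq0 normc_eq0 => /andP[/eqP I0 /eqP b0].
have VE : V = t%:M.
  have v00 : V 0 0 = t by rewrite tE; apply: complex_ext.
  apply: mx2P; rewrite !mxE /= ?mulr1n ?mulr0n ?v00 ?b0 ?c1 ?d1//.
    by rewrite b0 conjc0 oppr0.
  by rewrite v00 tE conjc_real.
by rewrite TE VE mul_mx_scalar -scalemxAl mulVmx// scalemx1.
Qed.

End Unitary.

Section PolynomialFactor.
Context {R : realType}.
Local Notation C := R[i].

Lemma poly_ext (p q : {poly C}) : (forall E, p.[E] = q.[E]) -> p = q.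
Proof.
move=> pq; apply/eqP; rewrite -subr_eq0; apply: contraT => nz.
have := max_poly_roots nz (rs := [seq k%:R | k <- iota 0 (size (p - q))]).
rewrite size_map size_iota ltnn; apply.
  by apply/allP => _ /mapP[k _ ->]; rewrite rootE hornerD hornerN pq subrr.
rewrite map_inj_uniq ?iota_uniq// => i j /eqP.
by rewrite eqr_nat => /eqP.
Qed.

Lemma prod_odd_even (T : comNzRingType) (F : nat -> T) g :
  \prod_(j < g.*2.+1) F j = F 0%N * \prod_(i < g) (F i.*2.+1 * F i.*2.+2).
Proof.
elim: g => [|g IH]; first by rewrite big_ord_recl !big_ord0.
by rewrite doubleS big_ord_recr big_ord_recr IH /= [in RHS]big_ord_recr /= !mulrA.
Qed.

Lemma real_root_factor (Q : {poly C}) g : Q \is monic -> size Q = g.*2.+2 ->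
  (forall E, root Q E -> Im E = 0) -> (forall E, root Q E -> ~~ root Q^`() E) ->
  exists (s0 : R) (d e : nat -> R), [/\
    Q = ('X - s0%:C%:P) * \prod_(i < g) (('X - (d i)%:C%:P) * ('X - (e i)%:C%:P)),
    forall i, (i < g)%N -> e i < d i, forall i, (i < g)%N -> d i < s0 &
    forall i j, (i < j < g)%N -> d j < e i].
Proof.
move=> Qm Qs Qreal Qsimple.
have [rs QE] := closed_field_poly_normal Q.
rewrite (monicP Qm) scale1r in QE.
have rsU : uniq rs.
  rewrite -separable_prod_XsubC -QE separable_poly.unlock /coprimep.
  apply: contraT => /closed_rootP[z]; rewrite root_gcd => /andP[/Qsimple/negP]; exact.
have rsR z : z \in rs -> z = (Re z)%:C.
  move=> zr; apply: complex_ext => //=; apply: Qreal.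
  by rewrite QE root_prod_XsubC.
have ReK : {in rs, cancel (@Re R) (real_complex R)} by move=> z /rsR <-.
pose s := rev (sort <=%R (map (@Re R) rs)).
have sS : sorted >%R s.
  rewrite rev_sorted sort_lt_sorted map_inj_in_uniq// => z1 z2 /rsR e1 /rsR e2 e12.
  by rewrite e1 e2 e12.
have szs : size s = g.*2.+1.
  rewrite size_rev size_sort size_map; apply: succn_inj.
  by rewrite -Qs QE size_prod_XsubC.
have dec i j : (i < j < g.*2.+1)%N -> nth 0 s j < nth 0 s i.
  move=> /andP[ij jg]; have := sorted_ltn_nth (rev_trans lt_trans) 0 sS.
  by move=> /(_ i j); rewrite !inE szs => -> //; exact: ltn_trans jg.
have prodE : Q = \prod_(j < g.*2.+1) ('X - (nth 0 s j)%:C%:P).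
  rewrite QE -szs.
  have -> : \prod_(j < size s) ('X - (nth 0 s j)%:C%:P) = \prod_(x <- s) ('X - x%:C%:P).
    by rewrite (big_nth 0) big_mkord.
  rewrite (perm_big (map (@Re R) rs)); last by rewrite perm_rev perm_sort.
  rewrite big_map big_seq [RHS]big_seq; apply: eq_bigr => z /rsR e.
  by rewrite [in LHS]e.
exists (nth 0 s 0), (fun i => nth 0 s i.*2.+1), (fun i => nth 0 s i.*2.+2); split.
- by rewrite prodE (prod_odd_even (fun j => 'X - (nth 0 s j)%:C%:P)).
- by move=> i ig; apply: dec; rewrite ltnSn /= ltnS -doubleS leq_double.
- by move=> i ig; apply: dec; rewrite /= ltnS ltn_double.
by move=> i j /andP[ij jg]; apply: dec; rewrite ltnS -doubleS leq_double ij /= ltnS ltn_double.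
Qed.

End PolynomialFactor.

Section Line.
Context {R : realType}.
Local Notation C := R[i].
Variables (q : R -> C) (K w : R) (g : nat) (ell : 'I_g -> {poly C})
  (f f1 f2 : 'I_g -> R -> C) (Q : {poly C}).
Hypotheses (cq : ccontinuous q) (qK : forall x, normc (q x) <= K) (w_gt0 : 0 < w)
  (q_per : forall x, q (x + w) = q x) (q_conj : forall x, ((q (- x))^*)%C = q x)
  (ell_size : forall i, (size (ell i) <= g)%N)
  (df : forall i x, cder (f i) x (f1 i x)) (df1 : forall i x, cder (f1 i) x (f2 i x))
  (f_per : forall i x, f i (x + w) = f i x).

Definition line_F x E : C := E ^+ g + \sum_i f i x * (ell i).[E].
Definition line_F1 x E : C := \sum_i f1 i x * (ell i).[E].
Definition line_F2 x E : C := \sum_i f2 i x * (ell i).[E].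
Definition line_G x E : C := (q x + E) * line_F x E - line_F2 x E / 2.

Hypotheses
  (dG : forall E x, cder (line_G^~ E) x (- (q x + E) * line_F1 x E))
  (F_conj : forall E x, ((line_F (- x) (E^*)%C)^*)%C = line_F x E)
  (Q_eq : forall E, Q.[E] = line_F 0 E * line_G 0 E + line_F1 0 E ^+ 2 / 4)
  (Q_real : forall E, root Q E -> Im E = 0)
  (Q_simple : forall E, root Q E -> ~~ root Q^`() E).

Lemma line_F_cder E x : cder (line_F^~ E) x (line_F1 x E).
Proof.
apply: cder_eq; last exact: add0r.
by apply: cderD (cder_cst _ _) _; apply: cder_sum => i; exact: cderMr.
Qed.

Lemma line_F1_cder E x : cder (line_F1^~ E) x (line_F2 x E).
Proof. by apply: cder_sum => i; exact: cderMr. Qed.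

Let f1_per i x : f1 i (x + w) = f1 i x.
Proof.
have := @cder_shift _ (f i) x w _ (df i (x + w)).
by under eq_fun do rewrite f_per; move=> /cder_uniq/(_ (df i x)).
Qed.

Let f2_per i x : f2 i (x + w) = f2 i x.
Proof.
have := @cder_shift _ (f1 i) x w _ (df1 i (x + w)).
by under eq_fun do rewrite f1_per; move=> /cder_uniq/(_ (df1 i x)).
Qed.

Lemma line_F1_conj E x : ((line_F1 (- x) (E^*)%C)^*)%C = - line_F1 x E.
Proof.
have := cderJ (cder_opp (line_F_cder (E^*)%C (- x))).
under eq_fun do rewrite F_conj.
by move=> /cder_uniq/(_ (line_F_cder E x)); rewrite rmorphN => <-; rewrite opprK.
Qed.

Lemma line_F2_conj E x : ((line_F2 (- x) (E^*)%C)^*)%C = line_F2 x E.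
Proof.
have := cderJ (cder_opp (line_F1_cder (E^*)%C (- x))).
under eq_fun do rewrite line_F1_conj.
move=> /cder_uniq/(_ (cderN (line_F1_cder E x))); rewrite rmorphN; exact: oppr_inj.
Qed.

Let G_conj E : ((line_G 0 (E^*)%C)^*)%C = line_G 0 E.
Proof.
have := F_conj E 0; have := line_F2_conj E 0; have := q_conj 0; rewrite oppr0 => q0 F20 F0.
by rewrite /line_G rmorphB !rmorphM rmorphD fmorphV rmorph_nat /= F0 F20 q0 conjcK.
Qed.

Let p12 : {poly C} := 'X^g + \sum_i f i 0 *: ell i.
Let p11 : {poly C} := \sum_i f1 i 0 *: ell i.
Let p22 : {poly C} := \sum_i f2 i 0 *: ell i.
Let p21 : {poly C} := ('X + (q 0)%:P) * p12 - 2^-1 *: p22.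

Let horner_sum_ell (h : 'I_g -> C) E :
  (\sum_i h i *: ell i).[E] = \sum_i h i * (ell i).[E].
Proof. by rewrite horner_sum; apply: eq_bigr => i _; rewrite hornerZ. Qed.

Let F0p E : line_F 0 E = p12.[E].
Proof. by rewrite /p12 hornerD hornerXn horner_sum_ell. Qed.

Let F10p E : line_F1 0 E = p11.[E].
Proof. by rewrite horner_sum_ell. Qed.

Let G0p E : line_G 0 E = p21.[E].
Proof.
rewrite /p21 (hornerD (('X + _) * p12)) hornerN hornerZ horner_sum_ell.
by rewrite hornerM -F0p hornerD hornerX hornerC /line_G [2^-1 * _]mulrC [E + _]addrC.
Qed.

Let QE : Q = p12 * p21 + 4^-1 *: p11 ^+ 2.
Proof.
apply: poly_ext => E; rewrite (hornerD (p12 * p21)) (hornerM p12) hornerZ horner_exp.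
by rewrite Q_eq F0p F10p G0p [4^-1 * _]mulrC.
Qed.

Let size_sum_ell (h : 'I_g -> C) : (size (\sum_i h i *: ell i)%R <= g)%N.
Proof.
apply: (leq_trans (size_sum _ _ _)); apply/bigmax_leqP => i _.
exact: leq_trans (size_scale_leq _ _) (ell_size i).
Qed.

Let p12_size : size p12 = g.+1.
Proof. by rewrite /p12 size_polyDl size_polyXn// ltnS. Qed.

Let p12_monic : p12 \is monic.
Proof. by rewrite monicE lead_coefDl ?lead_coefXn// size_polyXn ltnS. Qed.

Let Xq_monic : 'X + (q 0)%:P \is monic.
Proof. by rewrite -[(q 0)%:P]opprK -polyCN monicXsubC. Qed.

Let Xq_size : size ('X + (q 0)%:P) = 2%N.
Proof. by rewrite -[(q 0)%:P]opprK -polyCN size_XsubC. Qed.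

Let main_size : size (('X + (q 0)%:P) * p12) = g.+2.
Proof. by rewrite size_monicM ?monic_neq0// Xq_size p12_size. Qed.

Let small_p22 : (size (- (2^-1 *: p22))%R < size (('X + (q 0)%:P) * p12)%R)%N.
Proof.
rewrite main_size size_polyN; apply: leq_ltn_trans (size_scale_leq _ _) _.
by apply: leq_ltn_trans (size_sum_ell _) _; rewrite ltnS leqnSn.
Qed.

Let p21_size : size p21 = g.+2. Proof. by rewrite /p21 size_polyDl. Qed.

Let p21_monic : p21 \is monic.
Proof. by rewrite monicE lead_coefDl// -monicE monicMr. Qed.

Let main_size2 : size (p12 * p21) = g.*2.+2.
Proof. by rewrite size_monicM ?monic_neq0// p12_size p21_size addSn addnS addnS /= addnn. Qed.

Let small_p11 : (size (4^-1 *: p11 ^+ 2)%R < size (p12 * p21)%R)%N.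
Proof.
rewrite main_size2; apply: leq_ltn_trans (size_scale_leq _ _) _.
apply: leq_ltn_trans (size_poly_exp_leq _ _) _; rewrite ltnS.
have := size_sum_ell (fun i => f1 i 0); rewrite -/p11 => h.
by rewrite ltnS (leq_trans (leq_mul (leq_pred _) (leqnn 2)))// muln2 leq_double.
Qed.

Let Q_monic : Q \is monic.
Proof. by rewrite QE monicE lead_coefDl// -monicE monicMr. Qed.

Let Q_size : size Q = g.*2.+2.
Proof. by rewrite QE size_polyDl. Qed.

Theorem line_negative E (y y1 : 'I_2 -> R -> C) (M S : 'M[C]_2) :
  (forall i x, cder (y i) x (y1 i x)) ->
  (forall i x, cder (y1 i) x ((q x + E) * y i x)) ->
  y 0 0 * y1 1 0 - y 1 0 * y1 0 0 != 0 ->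
  (forall i x, y i (x + w) = \sum_j M i j * y j x) ->
  S \in unitmx -> SU2 (S *m M *m invmx S) ->
  Im Q.[E] = 0 /\ Re Q.[E] < 0.
Proof.
move=> dy dy1 Wr yper Su SV.
have [c [c1 [s [s1 sol]]]] := fundamental_solutions cq qK.
have c0 E' : c E' 0 = 1 by case: (sol E') => -[[]].
have c10 E' : c1 E' 0 = 0 by case: (sol E') => -[[]].
have s0 E' : s E' 0 = 0 by case: (sol E') => -[_ []].
have s10 E' : s1 E' 0 = 1 by case: (sol E') => -[_ []].
have dc E' : forall x, cder (c E') x (c1 E' x) by case: (sol E').
have dc1 E' : forall x, cder (c1 E') x ((q x + E') * c E' x) by case: (sol E').
have ds E' : forall x, cder (s E') x (s1 E' x) by case: (sol E').
have ds1 E' : forall x, cder (s1 E') x ((q x + E') * s E' x) by case: (sol E').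
have dF1' E' x : cder (line_F1^~ E') x (2 * ((q x + E') * line_F x E' - line_G x E')).
  by apply: cder_eq (line_F1_cder E' x) _; rewrite /line_G; field.
have per0 h : (forall i x, h i (x + w) = h i x) -> forall i : 'I_g, h i w = h i 0 :> C.
  by move=> hp i; rewrite -[w]add0r hp.
have F_per E' : line_F w E' = line_F 0 E'.
  by rewrite /line_F; under eq_bigr do rewrite (per0 _ f_per).
have F1_per E' : line_F1 w E' = line_F1 0 E'.
  by rewrite /line_F1; under eq_bigr do rewrite (per0 _ f1_per).
have G_per E' : line_G w E' = line_G 0 E'.
  rewrite /line_G F_per -[in q w](add0r w) q_per /line_F2.
  by under eq_bigr do rewrite (per0 _ f2_per).
have Fc0 E' : ((line_F 0 (E'^*)%C)^*)%C = line_F 0 E' by have := F_conj E' 0; rewrite oppr0.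
have F1c0 E' : ((line_F1 0 (E'^*)%C)^*)%C = - line_F1 0 E' by have := line_F1_conj E' 0; rewrite oppr0.
have cf i : ccontinuous (f i) := cder_ccontinuous (df i).
have /choice[If IfP] : forall i, exists U : R -> C, U 0 = 0 /\ forall x, cder U x (f i x).
  by move=> i; exact: cprimitive_exists.
pose P : {poly C} := w%:C *: 'X^g + \sum_i If i w *: ell i.
have wC0 : (w%:C : C) != 0 by rewrite fmorph_eq0 gt_eqF.
have wXg : size (w%:C *: 'X^g : {poly C}) = g.+1 by rewrite size_scale// size_polyXn.
have P_size : size P = g.+1 by rewrite /P size_polyDl wXg// ltnS.
have P_lead : lead_coef P = w%:C.
  by rewrite lead_coefDl ?wXg ?ltnS// lead_coefZ lead_coefXn mulr1.
have P_int E' (U : R -> C) : U 0 = 0 -> (forall x, cder U x (line_F x E')) -> U w = P.[E'].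
  move=> U0 dU; pose V x := x%:C * E' ^+ g + \sum_i If i x * (ell i).[E'].
  have dV x : cder V x (line_F x E').
    apply: cder_eq.
      apply: cderD (cderMr (E' ^+ g) (cder_id x)) _.
      by apply: cder_sum => i; apply: cderMr; exact: (IfP i).2.
    by rewrite mul1r.
  have := @cder0_cst _ (fun x => U x - V x) w 0 (fun x => cder_eq (cderB (dU x) (dV x)) (subrr _)).
  have V0 : V 0 = 0 by rewrite /V mul0r add0r big1// => i _; rewrite (IfP i).1 mul0r.
  rewrite U0 V0 subrr => /eqP; rewrite subr_eq0 => /eqP ->.
  by rewrite /V /P hornerD hornerZ hornerXn horner_sum_ell.
have [z0 [d [e [Qfac ed ds0 de]]]] := real_root_factor Q_monic Q_size Q_real Q_simple.
pose al := half_trace w c s1.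
pose be := transfer_coef w c c1 s s1 line_F line_F1 line_G.
have [es ec1 ed'] := transfer_coefE c0 c10 s0 s10 dc dc1 ds ds1 line_F_cder dF1' dG F0p F10p G0p QE
  Q_simple F_per F1_per G_per E.
have y1per i x : y1 i (x + w) = \sum_j M i j * y1 j x.
  have := @cder_shift _ (y i) x w _ (dy i (x + w)); under eq_fun do rewrite yper.
  by move=> /cder_uniq; apply; apply: cder_sum => j; exact: cderMl.
pose T : 'M[C]_2 := \matrix_(i, j) (if i == 0 then if j == 0 then c E w else c1 E w
  else if j == 0 then s E w else s1 E w).
pose W : 'M[C]_2 := \matrix_(i, j) (if j == 0 then y i 0 else y1 i 0).
have MW : M *m W = W *m T.
  apply/matrixP => i j; rewrite !mxE [RHS]big_ord_recl big_ord1 !mxE /=.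
  have [h h1] := solution_expand qK c0 c10 s0 s10 dc dc1 ds ds1 (dy i) (dy1 i) w.
  have yw := yper i 0; have y1w := y1per i 0; rewrite add0r in yw y1w.
  have [->|j0] := eqVneq j 0; rewrite /=.
    by rewrite -h yw; apply: eq_bigr => k _; rewrite mxE.
  by rewrite -h1 y1w; apply: eq_bigr => k _; rewrite mxE (negPf j0).
have Wu : W \in unitmx.
  by rewrite unitmxE unitfE det2 !mxE /= mulrC [y1 0 0 * _]mulrC mulrC.
have SWu : S *m W \in unitmx by rewrite unitmx_mul Su.
have SWT : (S *m W) *m T = (S *m M *m invmx S) *m (S *m W).
  by rewrite -mulmxA -MW !mulmxA mulmxKV.
have [] := SU2_similar SWu SV SWT.
have -> : \tr T / 2 = al E.
  by rewrite /mxtrace big_ord_recl big_ord1 !mxE.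
move=> aI aR aT.
have ab : al E ^+ 2 = 1 -> be E = 0.
  move=> /aT /matrixP TE; apply: contra_eq (erefl (0 : C)) => be0.
  have s_0 : s E w = 0 by have := TE 1 0; rewrite !mxE.
  have c1_0 : c1 E w = 0 by have := TE 0 1; rewrite !mxE.
  have cs1 : s1 E w - c E w = 0.
    by have := TE 0 0; have := TE 1 1; rewrite !mxE /= => -> ->; rewrite subrr.
  have zero (a : C) : be E * a = 0 -> a = 0.
    by move=> /eqP; rewrite mulf_eq0 (negPf be0) => /eqP.
  have z1 : line_F 0 E = 0 by apply: zero; rewrite -es.
  have z2 : line_G 0 E = 0 by apply: zero; rewrite -ec1.
  have z3 : line_F1 0 E = 0 by apply: zero; rewrite -ed'.
  by case: (lax_neq0 F0p F10p G0p QE Q_simple z1 z2 z3).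
apply: (@band_negative R al be P Q g z0 w d e _ _ _ _ _ _ _ _ _ _ _ _ _ E aI aR ab).
- exact: (half_trace_cder qK w_gt0 c0 c10 s0 s10 dc dc1 ds ds1 line_F_cder dF1' dG F0p F10p G0p QE
    Q_simple F_per F1_per G_per P_int).
- exact: (transfer_trace_cder qK w_gt0 c0 c10 s0 s10 dc dc1 ds ds1 line_F_cder dF1' dG F0p F10p G0p QE
    Q_simple F_per F1_per G_per P_int).
- exact: (pell c0 c10 s0 s10 dc dc1 ds ds1 line_F_cder dF1' dG F0p F10p G0p QE
    Q_simple F_per F1_per G_per).
- exact: (transfer_coef_zero qK w_gt0 c0 c10 s0 s10 dc dc1 ds ds1 line_F_cder dF1' dG F0p F10p G0p QE
    Q_simple F_per F1_per G_per P_int).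
- exact: (half_trace_conj qK q_per q_conj c0 c10 s0 s10 dc dc1 ds ds1).
- exact: (transfer_coef_conj qK q_per q_conj c0 c10 s0 s10 dc dc1 ds ds1 line_F_cder dF1' dG F0p F10p G0p QE
    Q_simple F_per F1_per G_per Fc0 F1c0 G_conj).
- exact: Qfac.
- exact: P_size.
- exact: P_lead.
- exact: w_gt0.
- exact: ed.
- exact: ds0.
- exact: de.
Qed.

End Line.

(** * Conjugation and periods of the Weierstrass function *)

Section ComplexLimits.
Context {R : realType}.
Local Notation C := R[i].

Lemma complex_gt0 (z : C) : 0 < z -> 0 < Re z /\ z = (Re z)%:C.
Proof. by rewrite ltcE /= => /andP[/eqP I0 R0]; split=> //; apply: complex_ext. Qed.

Lemma cvg_normcP {T : Type} {F : set_system T} {FF : Filter F} (u : T -> C) (l : C) :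
  ((u : T -> R[i]^o) @ F --> (l : R[i]^o)) <->
  (forall e : R, 0 < e -> \forall x \near F, normc (u x - l) <= e).
Proof.
split=> [/cvgrPdist_le h e e0|h].
  have e0' : (0 : C) < e%:C by rewrite ltcR.
  by apply: filterS (h _ e0') => x; rewrite distrC normC_normc lecR.
apply/cvgrPdist_le => e /complex_gt0[e0 ->].
by apply: filterS (h _ e0) => x; rewrite distrC normC_normc lecR.
Qed.

Lemma nbhs_normcP (z : C) (P : set C) :
  nbhs (z : R[i]^o) P <-> exists2 d : R, 0 < d & forall v, normc (v - z) < d -> P v.
Proof.
split=> [/nbhs_ballP[d /= /complex_gt0[d0 dE] h]|[d d0 h]].
  exists (Re d) => // v vd; apply: h.
  by rewrite /ball/= distrC normC_normc dE ltcR.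
apply/nbhs_ballP; exists d%:C; first by rewrite /= ltcR.
by move=> v; rewrite /ball/= distrC normC_normc ltcR; exact: h.
Qed.

Lemma dnbhs_normcP (z : C) (P : set C) :
  nbhs ((z : R[i]^o)^') P <->
  exists2 d : R, 0 < d & forall v, normc (v - z) < d -> v != z -> P v.
Proof. by rewrite /dnbhs /within /=; exact: nbhs_normcP. Qed.

Lemma cdiffP (f : C -> C) z l : cdiff f z l <-> cderivable f z /\ cderive f z = l.
Proof.
have quotient k (m : C) : k != 0 ->
    k^-1 *: ((f \o shift z) (k *: (1 : C)) - f z) - m = k^-1 * (f (z + k) - f z - k * m).
  by move=> k0; rewrite /= /GRing.scale/= mulr1 [k + z]addrC; field.
pose G (m : C) := (fun k : R[i]^o => k^-1 *: ((f \o shift z) (k *: (1 : C)) - f z) : R[i]^o)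
  @ (0 : R[i]^o)^' --> (m : R[i]^o).
have GP m : G m <-> cdiff f z m.
  split=> [/cvg_normcP h e e0|h].
    have /dnbhs_normcP[d d0 hd] := h e e0; exists d => // k kd.
    have [->|k0] := eqVneq k 0.
      by rewrite addr0 subrr mul0r subrr ComplexField.Normc.normc0 mulr0.
    have := hd k; rewrite subr0 => /(_ kd k0); rewrite quotient// normcM.
    rewrite ComplexField.Normc.normcV mulrC ler_pdivrMr ?normc_gt0//.
  apply/cvg_normcP => e e0; have [d d0 hd] := h e e0.
  apply/dnbhs_normcP; exists d => // k; rewrite subr0 => kd k0.
  by rewrite quotient// normcM ComplexField.Normc.normcV mulrC ler_pdivrMr ?normc_gt0// hd.
split=> [/GP h|[dfz <-]]; last first.
  by apply/GP; have := dfz; rewrite /cderive derive1E; apply.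
have dfz : cderivable f z by apply/cvg_ex; exists l.
split=> //; rewrite /cderive derive1E; exact: (cvg_lim (@norm_hausdorff _ R[i]^o) h).
Qed.

Definition conj_fun (f : C -> C) (z : C) : C := ((f (z^*)%C)^*)%C.

Lemma conj_funK f : conj_fun (conj_fun f) = f.
Proof. by apply/funext => z; rewrite /conj_fun !conjcK. Qed.

Lemma cdiff_conj f z l : cdiff f (z^*)%C l -> cdiff (conj_fun f) z (l^*)%C.
Proof.
move=> h e e0; have [d d0 hd] := h e e0; exists d => // k kd.
have := hd (k^*)%C; rewrite normcJ => /(_ kd).
rewrite /conj_fun rmorphD /= -normcJ !rmorphB rmorphM /= conjcK; exact.
Qed.

(* Also where [f] is not derivable, both sides being then the default value. *)
Lemma cderive_conj f : cderive (conj_fun f) = conj_fun (cderive f).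
Proof.
apply/funext => z; rewrite /conj_fun.
have [fz|nfz] := pselect (cderivable f (z^*)%C).
  by have /cdiffP[] : cdiff (conj_fun f) z (((cderive f (z^*)%C))^*)%C by apply/cdiff_conj/cdiffP.
have nfz' : ~ cderivable (conj_fun f) z.
  move=> fz; apply: nfz; rewrite -(conj_funK f).
  have : cdiff (conj_fun f) (((z^*)%C)^*)%C (cderive (conj_fun f) z) by rewrite conjcK; exact/cdiffP.
  by move=> /cdiff_conj/cdiffP[].
have def g v : ~ cderivable g v -> cderive g v = 0.
  by rewrite /cderivable /derivable => /dvgP ng; rewrite /cderive derive1E; exact: ng.
by rewrite !def// conjc0.
Qed.

Lemma cderivable_conj f z : cderivable f (z^*)%C -> cderivable (conj_fun f) z.
Proof.
move=> fz; suff /cdiffP[] : cdiff (conj_fun f) z ((cderive f (z^*)%C)^*)%C by [].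
exact/cdiff_conj/cdiffP.
Qed.

Lemma meromorphic_conj f : meromorphic f -> meromorphic (conj_fun f).
Proof.
move=> mf a; have [m [g [gd fg]]] := mf (a^*)%C.
have conj_dist v : normc ((v^*)%C - (a^*)%C) = normc (v - a) by rewrite -rmorphB normcJ.
have cd (x y : C) k : ((x / y ^+ k)^*)%C = (x^*)%C / ((y^*)%C) ^+ k.
  by rewrite rmorphM fmorphV rmorphXn.
have cb (x y : C) : ((x - (y^*)%C)^*)%C = (x^*)%C - y by rewrite rmorphB /= conjcK.
exists m, (conj_fun g); split.
  have /nbhs_normcP[d d0 hd] := gd; apply/nbhs_normcP; exists d => // v vd.
  by apply: cderivable_conj; apply: hd; rewrite conj_dist.
have /dnbhs_normcP[d d0 hd] := fg; apply/dnbhs_normcP; exists d => // v vd va.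
rewrite /conj_fun hd ?conj_dist//; last first.
  by apply: contraNneq va => /(congr1 conjc); rewrite !conjcK => ->.
by rewrite cd cb conjcK.
Qed.

Lemma cvg_conj (u : nat -> C) (l : C) :
  (u : nat -> R[i]^o) @ \oo --> (l : R[i]^o) ->
  (fun N => (u N)^*%C : R[i]^o) @ \oo --> ((l^*)%C : R[i]^o).
Proof.
move=> /cvg_normcP h; apply/cvg_normcP => e /h; apply: filterS => N.
by rewrite -rmorphB normcJ.
Qed.

Lemma lim_conj (u : nat -> C) :
  lim ((fun N => (u N)^*%C : R[i]^o) @ \oo) = ((lim ((u : nat -> R[i]^o) @ \oo))^*)%C :> C.
Proof.
have [cu|ncu] := pselect (cvg ((u : nat -> R[i]^o) @ \oo)).
  exact: (cvg_lim (@norm_hausdorff _ R[i]^o) (cvg_conj cu)).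
have ncu' : ~ cvg ((fun N => (u N)^*%C : R[i]^o) @ \oo).
  move=> cu'; apply: ncu; apply/cvg_ex; exists ((lim ((fun N => (u N)^*%C : R[i]^o) @ \oo))^*)%C.
  have := cvg_conj cu'; under eq_fun do rewrite conjcK; exact.
have -> := dvgP ncu; have -> := dvgP ncu'; exact/esym/conjc0.
Qed.

Lemma lim_asymptotic (u v : nat -> C) :
  (fun N => u N - v N : R[i]^o) @ \oo --> (0 : R[i]^o) ->
  lim ((u : nat -> R[i]^o) @ \oo) = lim ((v : nat -> R[i]^o) @ \oo) :> C.
Proof.
move=> uv.
have half (u' v' : nat -> C) : (fun N => u' N - v' N : R[i]^o) @ \oo --> (0 : R[i]^o) ->
    forall l : R[i]^o, (v' : nat -> R[i]^o) @ \oo --> l -> (u' : nat -> R[i]^o) @ \oo --> l.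
  move=> h l cv; have -> : (u' : nat -> R[i]^o) = (fun N => (u' N - v' N) + v' N).
    by apply/funext => N; rewrite subrK.
  by rewrite -[l]add0r; exact: (cvgD h cv).
have vu : (fun N => v N - u N : R[i]^o) @ \oo --> (0 : R[i]^o).
  apply/cvg_normcP => e; move/cvg_normcP: uv => /(_ e) h /h; apply: filterS => N.
  by rewrite !subr0 -normcN opprB.
have [cv|ncv] := pselect (cvg ((v : nat -> R[i]^o) @ \oo)).
  exact: (cvg_lim (@norm_hausdorff _ R[i]^o) (half _ _ uv _ cv)).
have ncu : ~ cvg ((u : nat -> R[i]^o) @ \oo).
  move=> cu; apply: ncv; apply/cvg_ex; eexists; exact: (half _ _ vu _ cu).
by have -> := dvgP ncu; have -> := dvgP ncv.
Qed.

End ComplexLimits.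

Section WeierstrassP.
Context {R : realType}.
Local Notation C := R[i].
Variables (tau : C).
Hypotheses (tau_re : Re tau = 0) (tau_im : 0 < Im tau).

Lemma tau_conj : (tau^*)%C = - tau.
Proof. by case: tau tau_re => p q /= ->; apply: complex_ext; rewrite /= ?oppr0. Qed.

Lemma conj_int (a : int) : ((a%:~R : C)^*)%C = a%:~R.
Proof. exact: (rmorph_int conjc a). Qed.

Lemma lattice_conj (a b : int) : ((lattice_pt tau a b)^*)%C = lattice_pt tau a (- b).
Proof.
by rewrite /lattice_pt rmorphD rmorphM /= !conj_int tau_conj mulrN rmorphN mulNr.
Qed.

Lemma Re_int (a : int) : Re (a%:~R : C) = a%:~R.
Proof. by have -> : (a%:~R : C) = (a%:~R)%:C by rewrite rmorph_int. Qed.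

Lemma Im_int (a : int) : Im (a%:~R : C) = 0.
Proof. by have -> : (a%:~R : C) = (a%:~R)%:C by rewrite rmorph_int. Qed.

Lemma Re_lattice (a b : int) : Re (lattice_pt tau a b) = a%:~R.
Proof. by rewrite /lattice_pt ReD ReM Re_int Im_int tau_re mulr0 mul0r subr0 addr0. Qed.

Lemma Im_lattice (a b : int) : Im (lattice_pt tau a b) = b%:~R * Im tau.
Proof. by rewrite /lattice_pt ImD ImM Re_int !Im_int mul0r addr0 add0r. Qed.

Lemma lattice_eq0 (a b : int) : (lattice_pt tau a b == 0) = (a == 0) && (b == 0).
Proof.
apply/eqP/andP => [h|[/eqP -> /eqP ->]]; last by rewrite /lattice_pt mul0r addr0.
have := congr1 (@Re R) h; have := congr1 (@Im R) h.
rewrite Re_lattice Im_lattice /= => /eqP; rewrite mulf_eq0 (gt_eqF tau_im) orbF intr_eq0 => ->.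
by move=> /eqP; rewrite intr_eq0 => ->.
Qed.

Lemma wp_conj z : ((wp tau z)^*)%C = wp tau (z^*)%C.
Proof.
rewrite /wp -lim_conj.
suff -> : (fun N => (wp_partial tau z N)^*%C) = wp_partial tau (z^*)%C by [].
apply/funext => N; rewrite /wp_partial.
rewrite rmorphD fmorphV rmorphXn rmorph_sum /=; congr (_ + _).
apply: eq_bigr => i _; rewrite rmorph_sum /= (reindex_inj rev_ord_inj) /=.
have revE (j : 'I_N.*2.+1) : (rev_ord j)%:Z - N%:Z = - (j%:Z - N%:Z).
  have -> : (rev_ord j)%:Z = (N.*2)%:Z - j%:Z by rewrite /= subSS subzn// -ltnS.
  have -> : (N.*2)%:Z = N%:Z + N%:Z by rewrite -addnn PoszD.
  by ring.
under eq_bigl do rewrite revE lattice_eq0 oppr_eq0 -lattice_eq0.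
apply: eq_bigr => j _; rewrite revE rmorphB !fmorphV !rmorphXn rmorphB /=.
by rewrite !lattice_conj opprK.
Qed.

Let term z (a b : int) : C := ((z - lattice_pt tau a b) ^+ 2)^-1.

Let wp_partialE z N : wp_partial tau z N =
  \sum_(i < N.*2.+1) \sum_(j < N.*2.+1) term z (i%:Z - N%:Z) (j%:Z - N%:Z) -
  \sum_(i < N.*2.+1) \sum_(j < N.*2.+1 | lattice_pt tau (i%:Z - N%:Z) (j%:Z - N%:Z) != 0)
    ((lattice_pt tau (i%:Z - N%:Z) (j%:Z - N%:Z)) ^+ 2)^-1.
Proof.
rewrite /wp_partial; under eq_bigr do rewrite sumrB.
rewrite sumrB addrA; congr (_ - _).
have NN : (N < N.*2.+1)%N by rewrite ltnS -addnn leq_addr.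
pose o := Ordinal NN.
have zero (i j : 'I_N.*2.+1) : (lattice_pt tau (i%:Z - N%:Z) (j%:Z - N%:Z) == 0) = (i == o) && (j == o).
  by rewrite lattice_eq0 !subr_eq0 !eqz_nat.
rewrite [RHS](bigD1 o)//= [in RHS](bigD1 o)//=.
rewrite [X in _ + X = _](bigD1 o)//= addrA; congr (_ + _).
  congr (_ + _).
    by rewrite /term subrr /lattice_pt mul0r addr0 subr0.
  by apply: eq_bigl => j; rewrite (zero o j) eqxx.
apply: eq_bigr => i io; apply: eq_bigl => j.
by rewrite zero (negPf io).
Qed.

Let term_bound z (a k : int) (c : R) : 0 < c -> c <= `|Im z - k%:~R * Im tau| ->
  normc (term z a k) <= (c ^+ 2)^-1.
Proof.
move=> c0 hc; rewrite /term ComplexField.Normc.normcV expr2 normcM -expr2.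
have h : c <= normc (z - lattice_pt tau a k).
  by apply: le_trans hc _; rewrite -(Im_lattice a) -ImN -ImD normc_Im.
rewrite lef_pV2 ?posrE ?exprn_gt0//; last exact: lt_le_trans h.
by rewrite ler_pXn2r// nnegrE ?normc_ge0// ltW.
Qed.

Let normc_sum n (F : 'I_n -> C) (c : R) : (forall i, normc (F i) <= c) ->
  normc (\sum_(i < n) F i) <= n%:R * c.
Proof.
elim: n F => [|n IH] F hF.
  by rewrite big_ord0 ComplexField.Normc.normc0 mul0r.
rewrite big_ord_recr -natr1 mulrDl mul1r.
by apply: le_trans (normcD _ _) _; rewrite lerD// IH.
Qed.

(* Translating the square of periods by [tau] only exchanges two boundary rows,
   of [2N+1] terms of size [O(1/N^2)] each; no convergence is needed. *)
Lemma wp_tau z : wp tau (z + tau) = wp tau z.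
Proof.
apply: lim_asymptotic; apply/cvg_normcP => e e0.
pose T := Im tau; pose Y := `|Im z|; have T0 : 0 < T := tau_im.
have Y0 : 0 <= Y := normr_ge0 _.
have diffE N : wp_partial tau (z + tau) N - wp_partial tau z N =
    \sum_(i < N.*2.+1) (term z (i%:Z - N%:Z) (- (N%:Z + 1)) - term z (i%:Z - N%:Z) N%:Z).
  rewrite !wp_partialE opprB addrA subrK -sumrB; apply: eq_bigr => i _; rewrite -sumrB.
  pose h (j : nat) := term z (i%:Z - N%:Z) (j%:Z - 1 - N%:Z).
  have -> : \sum_(j < N.*2.+1) (term (z + tau) (i%:Z - N%:Z) (j%:Z - N%:Z) -
      term z (i%:Z - N%:Z) (j%:Z - N%:Z)) = - \sum_(0 <= j < N.*2.+1) (h j.+1 - h j).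
    rewrite big_mkord -sumrN; apply: eq_bigr => j _; rewrite opprB /h /term.
    have -> : (j.+1)%:Z - 1 - N%:Z = j%:Z - N%:Z by rewrite -addn1 PoszD addrK.
    have -> : j%:Z - 1 - N%:Z = j%:Z - N%:Z - 1 by rewrite addrAC.
    congr (_ - _); congr ((_ ^+ 2)^-1); rewrite /lattice_pt [in RHS]rmorphB /=; ring.
  rewrite telescope_sumr// opprB /h; congr (_ - _); congr term.
    by rewrite sub0r opprD addrC.
  by rewrite -addn1 PoszD addrK -addnn PoszD addrK.
have [N0 N0P] : exists N0 : nat, forall N, (N0 <= N)%N ->
    [/\ (0 < N)%N, 2 * Y <= N%:R * T & 24 / T ^+ 2 <= e * N%:R].
  pose X := (2 * Y) / T + 24 / T ^+ 2 / e + 1.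
  exists (Num.truncn X).+1 => N hN.
  have XN : X < N%:R by apply: lt_le_trans (truncnS_gt X) _; rewrite ler_nat.
  have x1 : 0 <= 2 * Y / T by apply: divr_ge0; [exact: mulr_ge0 | exact: ltW].
  have x2 : 0 <= 24 / T ^+ 2 / e by apply: divr_ge0; [apply: divr_ge0 => //; exact/exprn_ge0/ltW | exact: ltW].
  split; first exact: leq_trans hN.
    by rewrite -ler_pdivrMr//; move: XN; rewrite /X; lra.
  by rewrite [e * _]mulrC -ler_pdivrMr//; move: XN; rewrite /X; lra.
near=> N.
have [|Npos NY Ne] := N0P N; first by near: N; exact: nbhs_infty_ge.
rewrite subr0 diffE.
have NR : (1 : R) <= N%:R by rewrite ler1n.
pose c := N%:R * T / 2.
have c0 : 0 < c by rewrite divr_gt0// mulr_gt0// ltr0n.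
have big (k : int) : N%:R <= `|k%:~R : R| -> c <= `|Im z - k%:~R * Im tau|.
  move=> kN; have h : N%:R * T <= `|k%:~R * T| by rewrite normrM [`|T|]gtr0_norm// ler_wpM2r// ltW.
  have := ler_normD (k%:~R * T - Im z) (Im z); rewrite subrK => h2.
  by rewrite distrC -/T /c; move: NY; rewrite /Y; lra.
have row : normc (\sum_(i < N.*2.+1)
    (term z (i%:Z - N%:Z) (- (N%:Z + 1)) - term z (i%:Z - N%:Z) N%:Z)) <=
    N.*2.+1%:R * (2 * (c ^+ 2)^-1).
  apply: normc_sum => i; apply: le_trans (normcB _ _) _.
  rewrite mulr_natl mulr2n lerD// term_bound//; apply: big.
    by rewrite rmorphN normrN rmorphD /= -pmulrn ger0_norm ?addr_ge0// lerDl.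
  by rewrite -pmulrn ger0_norm.
apply: le_trans row _.
have c2 : (c ^+ 2)^-1 = 4 / (T ^+ 2 * N%:R ^+ 2).
  by rewrite /c; field; rewrite !gt_eqF// ltr0n.
have N3 : (N.*2.+1%:R : R) <= 3 * N%:R.
  by rewrite -natr1 -muln2 natrM; lra.
rewrite c2.
have -> : e = (e * N%:R) / N%:R by rewrite mulfK// gt_eqF// ltr0n.
apply: le_trans (_ : 24 / T ^+ 2 / N%:R <= _); last by rewrite ler_wpM2r// invr_ge0.
apply: le_trans (_ : 3 * N%:R * (2 * (4 / (T ^+ 2 * N%:R ^+ 2))) <= _).
  by rewrite ler_wpM2r// !mulr_ge0// invr_ge0 mulr_ge0// exprn_ge0// ltW.
rewrite le_eqVlt; apply/orP; left; apply/eqP.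
by field; rewrite !gt_eqF// ltr0n.
Unshelve. all: by end_near. Qed.

End WeierstrassP.

Section Periodic.
Context {R : realType}.
Local Notation C := R[i].

Lemma cder_neq0_near (u : R -> C) x l :
  cder u x l -> u x != 0 -> \forall t \near x, u t != 0.
Proof.
move=> /cder_cont[cR cI] ux0.
have [R0|R0] := eqVneq (Re (u x)) 0; last first.
  apply: filterS (cvgr_neq0 _ cR R0) => t; apply: contraNneq => -> //.
have I0 : Im (u x) != 0 by apply: contraNneq ux0 => I0; apply/eqP/complex_ext.
by apply: filterS (cvgr_neq0 _ cI I0) => t; apply: contraNneq => ->.
Qed.

Lemma periodic_bounded (f : R -> R) (w : R) : 0 < w -> continuous f ->
  (forall x, f (x + w) = f x) -> exists K, forall x, f x <= K.
Proof.
move=> w0 cf per.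
have pern (k : nat) x : f (x + k%:R * w) = f x.
  elim: k x => [|k IH] x; first by rewrite mul0r addr0.
  by rewrite -natr1 mulrDl mul1r addrA per IH.
have perz (k : int) x : f (x + k%:~R * w) = f x.
  case: k => k; first exact: pern.
  have -> : x + (Negz k)%:~R * w = x - k.+1%:R * w by rewrite -mulNr.
  by rewrite -(pern k.+1) subrK.
have [|c _ cP] := @EVT_max R f 0 w (ltW w0); first exact: continuous_subspaceT.
exists (f c) => x.
have /andP[h1 h2] := floor_itv (x / w).
rewrite -(subrK ((Num.floor (x / w))%:~R * w) x) perz; apply: cP.
rewrite in_itv /= subr_ge0 -ler_pdivlMr// h1 /= lerBlDr.
by move: h2; rewrite ltr_pdivrMr// intrD mulrDl mul1r addrC => /ltW.
Qed.

Lemma cperiodic_bounded (q : R -> C) (w : R) : 0 < w -> ccontinuous q ->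
  (forall x, q (x + w) = q x) -> exists K, forall x, normc (q x) <= K.
Proof.
move=> w0 [cR cI] per.
have bounded (p : C -> R) : continuous (p \o q) -> exists K, forall x, `|p (q x)| <= K.
  move=> cp; apply: (periodic_bounded w0); last by move=> x; rewrite per.
  by move=> x; apply: cvg_norm; exact: cp.
have [K1 h1] := bounded (@Re R) cR; have [K2 h2] := bounded (@Im R) cI.
exists (K1 + K2) => x; apply: le_trans (normc_le_ReIm _) _; exact: lerD.
Qed.

End Periodic.

Section PotentialLine.
Context {R : realType}.
Local Notation C := R[i].
Variables (q : R -> C) (w : R) (g : nat) (ell : 'I_g -> {poly C})
  (f f1 f2 f3 : 'I_g -> R -> C) (Q : {poly C}).
Hypotheses (w_gt0 : 0 < w)
  (ell_size : forall i, (size (ell i) <= g)%N)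
  (df : forall i x, cder (f i) x (f1 i x)) (df1 : forall i x, cder (f1 i) x (f2 i x))
  (df2 : forall i x, cder (f2 i) x (f3 i x))
  (f_per : forall i x, f i (x + w) = f i x).

Local Notation F := (line_F ell f).
Local Notation F1 := (line_F1 ell f1).
Local Notation F2 := (line_F2 ell f2).
Local Notation F3 := (line_F2 ell f3).
Local Notation G := (line_G q ell f f2).

Hypothesis Q_eq : forall x E, Q.[E] = F x E * G x E + F1 x E ^+ 2 / 4.

Let dF E x : cder (F^~ E) x (F1 x E) := line_F_cder ell df E x.
Let dF1 E x : cder (F1^~ E) x (F2 x E) := line_F1_cder ell df1 E x.

Let dF2 E x : cder (F2^~ E) x (F3 x E).
Proof. by apply: cder_sum => i; exact: cderMr. Qed.

Let sum_ell (h : 'I_g -> R -> C) x := \sum_i h i x *: ell i.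

Let sum_ellE h x E : (sum_ell h x).[E] = \sum_i h i x * (ell i).[E].
Proof. by rewrite horner_sum; apply: eq_bigr => i _; rewrite hornerZ. Qed.

Let P x : {poly C} := 'X^g + sum_ell f x.

Let PE x E : (P x).[E] = F x E.
Proof. by rewrite /P hornerD hornerXn sum_ellE. Qed.

Let P_neq0 x : P x != 0.
Proof.
apply: monic_neq0; rewrite monicE lead_coefDl ?lead_coefXn// size_polyXn ltnS.
apply: (leq_trans (size_sum _ _ _)); apply/bigmax_leqP => i _.
exact: leq_trans (size_scale_leq _ _) (ell_size i).
Qed.

Let nonroot x : exists E, F x E != 0.
Proof. by have /closed_nonrootP[E] := P_neq0 x; rewrite rootE PE; exists E. Qed.

Let q_formula x E : F x E != 0 ->
  q x = (Q.[E] - F1 x E ^+ 2 / 4 + F x E * F2 x E / 2) / F x E ^+ 2 - E.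
Proof. by move=> F0; rewrite (Q_eq x) /line_G; field. Qed.

Lemma line_q_cder x : exists l, cder q x l.
Proof.
have [E FE] := nonroot x.
have FF : F x E ^+ 2 != 0 by rewrite expf_neq0.
eexists; apply: (@cder_near _ (fun t => (Q.[E] - F1 t E ^+ 2 / 4 + F t E * F2 t E / 2) *
    (F t E ^+ 2)^-1 - E)).
  by apply: filterS (cder_neq0_near (dF E x) FE) => t /q_formula.
have dsq (u : R -> C) v : cder u x v -> cder (fun t => u t ^+ 2) x (v * u x + u x * v).
  by move=> du; exact: cderM.
apply: cderB (cder_cst _ _); apply: cderM.
  apply: cderD.
    by apply: cderB (cder_cst _ _) _; apply: cderMr; apply: dsq; exact: dF1.
  by apply: cderMr; apply: cderM; [exact: dF|exact: dF2].
apply: cder_inv => //; apply: dsq; exact: dF.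
Qed.

Lemma line_G_cder E x : cder (G^~ E) x (- (q x + E) * F1 x E).
Proof.
have [q1 dq] := line_q_cder x.
have dG E' : cder (G^~ E') x
    ((q1 + 0) * F x E' + (q x + E') * F1 x E' - F3 x E' / 2).
  apply: cderB; last exact: cderMr.
  by apply: cderM; [exact: cderD dq (cder_cst _ _)|exact: dF].
pose T := q1 *: P x + (2 *: ('X + (q x)%:P)) * sum_ell f1 x - 2^-1 *: sum_ell f3 x.
have TE E' : T.[E'] = q1 * F x E' + 2 * (q x + E') * F1 x E' - F3 x E' / 2.
  rewrite /T hornerD hornerN (hornerD (q1 *: _)) hornerM !hornerZ PE !sum_ellE.
  by rewrite hornerD hornerX hornerC [E' + _]addrC [2^-1 * _]mulrC.
have PT : P x * T = 0.
  apply: poly_ext => E'; rewrite hornerM PE horner0 TE.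
  have := cderD (cderM (dF E' x) (dG E')) (cderMr 4^-1
    (cderM (dF1 E' x) (dF1 E' x))).
  under eq_fun do rewrite -expr2 -Q_eq.
  move=> /cder_uniq/(_ (cder_cst _ _)) h; rewrite -[RHS]h /line_G; by field.
have T0 : T = 0 by move/eqP: PT; rewrite mulf_eq0 (negPf (P_neq0 x)) => /eqP.
apply: cder_eq (dG E) _; have := TE E; rewrite T0 horner0 => h.
by apply/eqP; rewrite -subr_eq0 [X in _ == X]h; apply/eqP; ring.
Qed.

Let F1_per x E : F1 (x + w) E = F1 x E.
Proof.
have := @cder_shift _ (F^~ E) x w _ (dF E (x + w)).
have -> : (fun t => F (t + w) E) = F^~ E.
  by apply/funext => t; rewrite /line_F; under eq_bigr do rewrite f_per.
by move=> /cder_uniq/(_ (dF E x)).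
Qed.

Let F2_per x E : F2 (x + w) E = F2 x E.
Proof.
have := @cder_shift _ (F1^~ E) x w _ (dF1 E (x + w)).
by under eq_fun do rewrite F1_per; move=> /cder_uniq/(_ (dF1 E x)).
Qed.

Lemma line_q_per x : q (x + w) = q x.
Proof.
have [E FE] := nonroot x.
have Fw : F (x + w) E = F x E by rewrite /line_F; under eq_bigr do rewrite f_per.
by rewrite (@q_formula x E)// (@q_formula _ E) ?Fw// F1_per F2_per.
Qed.

Lemma line_q_ccontinuous : ccontinuous q.
Proof. by have /choice[q1 h] := line_q_cder; exact: cder_ccontinuous h. Qed.

Lemma line_q_bounded : exists K, forall x, normc (q x) <= K.
Proof. exact: cperiodic_bounded w_gt0 line_q_ccontinuous line_q_per. Qed.

Lemma line_F_neq0 (Q_simple : forall E, root Q E -> ~~ root Q^`() E) E :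
  ~ (forall x, F x E = 0).
Proof.
move=> F0.
have F10 x : F1 x E = 0.
  have := dF E x; under eq_fun do rewrite F0.
  by move=> /cder_uniq; apply; exact: cder_cst.
have F20 : F2 0 E = 0.
  have := dF1 E 0; under eq_fun do rewrite F10.
  by move=> /cder_uniq; apply; exact: cder_cst.
have G0 : G 0 E = 0 by rewrite /line_G F0 F20; ring.
have F0p E' : F 0 E' = (P 0).[E'] by rewrite PE.
have F10p E' : F1 0 E' = (sum_ell f1 0).[E'] by rewrite sum_ellE.
have G0p E' : G 0 E' = (('X + (q 0)%:P) * P 0 - 2^-1 *: sum_ell f2 0).[E'].
  rewrite hornerD hornerN hornerM hornerZ PE sum_ellE hornerD hornerX hornerC.
  by rewrite /line_G [2^-1 * _]mulrC [E' + _]addrC.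
apply: (lax_neq0 F0p F10p G0p _ Q_simple (F0 0) G0 (F10 0)).
apply: poly_ext => E'; rewrite hornerD hornerM hornerZ horner_exp.
by rewrite (Q_eq 0) F0p F10p G0p [4^-1 * _]mulrC.
Qed.

Hypotheses
  (F_conj : forall E x, ((F (- x) (E^*)%C)^*)%C = F x E)
  (Q_conj : forall E, ((Q.[(E^*)%C])^*)%C = Q.[E])
  (Q_real : forall E, root Q E -> Im E = 0)
  (Q_simple : forall E, root Q E -> ~~ root Q^`() E).

Let F1_conj E x : ((F1 (- x) (E^*)%C)^*)%C = - F1 x E := line_F1_conj df F_conj E x.
Let F2_conj E x : ((F2 (- x) (E^*)%C)^*)%C = F2 x E := line_F2_conj df df1 F_conj E x.

Lemma line_q_conj x : ((q (- x))^*)%C = q x.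
Proof.
have [E FE] := nonroot x.
have FE' : F (- x) (E^*)%C != 0.
  by apply: contraNneq FE => h; rewrite -F_conj h conjc0.
have cE (a b c d e : C) : (((a - b ^+ 2 / 4 + c * d / 2) / c ^+ 2 - e)^*)%C =
    ((a^*)%C - (b^*)%C ^+ 2 / 4 + (c^*)%C * (d^*)%C / 2) / (c^*)%C ^+ 2 - (e^*)%C.
  by rewrite !expr2 conjB conjM conjV conjD conjB !(conj_nat, conjM, conjV).
by rewrite (q_formula FE') (q_formula FE) cE conjcK Q_conj F_conj F1_conj F2_conj sqrrN.
Qed.

Theorem periodic_negative E (y y1 : 'I_2 -> R -> C) (M S : 'M[C]_2) :
  (forall i x, cder (y i) x (y1 i x)) ->
  (forall i x, cder (y1 i) x ((q x + E) * y i x)) ->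
  y 0 0 * y1 1 0 - y 1 0 * y1 0 0 != 0 ->
  (forall i x, y i (x + w) = \sum_j M i j * y j x) ->
  S \in unitmx -> SU2 (S *m M *m invmx S) ->
  Im Q.[E] = 0 /\ Re Q.[E] < 0.
Proof.
have [K qK] := line_q_bounded.
exact: (line_negative line_q_ccontinuous qK w_gt0 line_q_per line_q_conj ell_size df df1
  f_per line_G_cder F_conj (Q_eq 0) Q_real Q_simple).
Qed.

End PotentialLine.

Section HalfPeriods.
Context {R : realType}.
Local Notation C := R[i].
Variables (tau : C) (n : 'I_4 -> nat).
Hypotheses (tau_re : Re tau = 0) (tau_im : 0 < Im tau).

Lemma omega_lattice k : exists a b : int, omega tau k = lattice_pt tau a b.
Proof.
have l00 : lattice_pt tau 0 0 = 0 by rewrite /lattice_pt mul0r addr0.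
have l10 : lattice_pt tau 1 0 = 1 by rewrite /lattice_pt mul0r addr0.
have l01 : lattice_pt tau 0 1 = tau by rewrite /lattice_pt mul1r add0r.
have l11 : lattice_pt tau 1 1 = 1 + tau by rewrite /lattice_pt mul1r.
rewrite /omega; case: k => -[|[|[|[|//]]]] ?; rewrite (tnth_nth 0) /=.
- by exists 0, 0.
- by exists 1, 0.
- by exists 0, 1.
- by exists 1, 1.
Qed.

Lemma latticeD a b a' b' :
  lattice_pt tau a b + lattice_pt tau a' b' = lattice_pt tau (a + a') (b + b').
Proof. by rewrite /lattice_pt !rmorphD /=; ring. Qed.

Lemma latticeN a b : - lattice_pt tau a b = lattice_pt tau (- a) (- b).
Proof. by rewrite /lattice_pt !rmorphN /=; ring. Qed.

Lemma regular_ptD z a b : regular_pt tau n z -> regular_pt tau n (z + lattice_pt tau a b).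
Proof.
move=> rz k nk a' b' h; apply: (rz k nk (a' - a) (b' - b)).
rewrite -latticeD -latticeN -h; ring.
Qed.

Lemma regular_ptN z : regular_pt tau n z -> regular_pt tau n (- z).
Proof.
move=> rz k nk a b h; have [a' [b' o]] := omega_lattice k.
apply: (rz k nk (a' - a) (b' - b)).
by rewrite -latticeD -latticeN -h -o; field.
Qed.

Lemma regular_pt_conj z : regular_pt tau n z -> regular_pt tau n (z^*)%C.
Proof.
move=> rz k nk a b h; have [a' [b' o]] := omega_lattice k.
apply: (rz k nk a (b' - b)).
have := congr1 conjc h; rewrite rmorphD fmorph_div rmorph_nat /= conjcK o.
rewrite !lattice_conj// => {}h.
have -> : z = lattice_pt tau a (- b) - lattice_pt tau a' (- b') / 2 by rewrite -h addrK.
by rewrite /lattice_pt !rmorphD !rmorphN /=; field.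
Qed.

Lemma Re_half (z : C) : Re (z / 2) = Re z / 2.
Proof.
have -> : z / 2 = z * (2^-1)%:C by rewrite rmorphV ?unitfE ?pnatr_eq0// rmorph_nat.
by rewrite ReM /= mulr0 subr0.
Qed.

Lemma Im_half (z : C) : Im (z / 2) = Im z / 2.
Proof.
have -> : z / 2 = z * (2^-1)%:C by rewrite rmorphV ?unitfE ?pnatr_eq0// rmorph_nat.
by rewrite ImM /= mulr0 add0r.
Qed.

Lemma regular_pt_Re z : (forall m : int, Re z <> m%:~R / 2) -> regular_pt tau n z.
Proof.
move=> hz k _ a b; have [a' [b' ->]] := omega_lattice k.
move=> /(congr1 (@Re R)); rewrite ReD Re_half !Re_lattice// => h.
apply: (hz (2 * a - a')); by rewrite rmorphB rmorphM /= -h; field.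
Qed.

Lemma regular_pt_Im z : (forall m : int, Im z <> m%:~R * (Im tau / 2)) ->
  regular_pt tau n z.
Proof.
move=> hz k _ a b; have [a' [b' ->]] := omega_lattice k.
move=> /(congr1 (@Im R)); rewrite ImD Im_half !Im_lattice// => h.
apply: (hz (2 * b - b')); rewrite rmorphB rmorphM /=.
have -> : Im z = b%:~R * Im tau - b'%:~R * Im tau / 2 by rewrite -h addrK.
by field.
Qed.

Lemma wp_half_conj k z : ((wp tau (z + omega tau k / 2))^*)%C = wp tau ((z^*)%C + omega tau k / 2).
Proof.
have [a [b o]] := omega_lattice k.
have wpt m u : wp tau (u + m%:R * tau) = wp tau u.
  elim: m u => [|m IH] u; first by rewrite mul0r addr0.
  by rewrite -natr1 mulrDl mul1r addrA wp_tau.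
rewrite wp_conj// rmorphD fmorph_div rmorph_nat /= o lattice_conj//.
have [[m]|[m]] : (exists m : nat, b = m%:Z) \/ (exists m : nat, b = - m%:Z).
- by case: b {o} => m; [left; exists m|right; exists m.+1; rewrite NegzE].
- move=> ->; rewrite -[LHS](wpt m); congr wp.
  by rewrite /lattice_pt !rmorphN /=; field.
- move=> ->; rewrite -[RHS](wpt m); congr wp.
  by rewrite /lattice_pt !rmorphN /=; field.
Qed.

Lemma potential_conj E z :
  ((potential tau n E z)^*)%C = potential tau n (E^*)%C (z^*)%C.
Proof.
rewrite /potential rmorphD rmorph_sum /=; congr (_ + _); apply: eq_bigr => k _.
by rewrite rmorphM /= wp_half_conj; congr (_ * _); exact: (rmorph_nat conjc).
Qed.

End HalfPeriods.

(** * The spectral polynomial on horizontal and vertical lines *)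

Section SpectralLine.
Context {R : realType}.
Local Notation C := R[i].
Variables (tau : C) (n : 'I_4 -> nat) (c0 : {poly C})
  (b : forall k : 'I_4, 'I_(n k) -> {poly C}) (Q : {poly C}).
Arguments b : clear implicits.
Hypotheses (c0_monic : c0 \is monic) (b_size : forall k j, (size (b k j) < size c0)%N)
  (Phi3 : forall E, third_order_solution tau n E (Phi tau c0 b E))
  (Q_eq : forall E z, regular_pt tau n z -> Q.[E] = potential tau n E z * Phi tau c0 b E z ^+ 2
              + 4^-1 * cderive (Phi tau c0 b E) z ^+ 2
              - 2^-1 * Phi tau c0 b E z * cderive (cderive (Phi tau c0 b E)) z).

Definition Phi_poly (z : C) : {poly C} :=
  c0 + \sum_(k < 4) \sum_(j < n k) wp tau (z + omega tau k / 2) ^+ (n k - j) *: b k j.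

Lemma Phi_polyE z E : (Phi_poly z).[E] = Phi tau c0 b E z.
Proof.
rewrite /Phi_poly /Phi hornerD horner_sum; congr (_ + _); apply: eq_bigr => k _.
by rewrite horner_sum; apply: eq_bigr => j _; rewrite hornerZ mulrC.
Qed.

Let tail_size z :
  (size (\sum_(k < 4) \sum_(j < n k) wp tau (z + omega tau k / 2) ^+ (n k - j) *: b k j)%R
   < size c0)%N.
Proof.
have c00 : (0 < size c0)%N by rewrite size_poly_gt0 monic_neq0.
rewrite -(prednK c00) ltnS.
apply: (leq_trans (size_sum _ _ _)); apply/bigmax_leqP => k _.
apply: (leq_trans (size_sum _ _ _)); apply/bigmax_leqP => j _.
by apply: leq_trans (size_scale_leq _ _) _; rewrite -ltnS prednK.
Qed.

Lemma Phi_poly_size z : size (Phi_poly z) = size c0.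
Proof. by rewrite /Phi_poly size_polyDl. Qed.

Lemma Phi_poly_monic z : Phi_poly z \is monic.
Proof. by rewrite monicE /Phi_poly lead_coefDl. Qed.

Variables (z0 zeta : C) (eps w : R).
Local Notation z x := (z0 + zeta * x%:C).
Hypotheses (zeta2 : zeta ^+ 2 = eps%:C) (eps2 : eps * eps = 1)
  (reg : forall x, regular_pt tau n (z x))
  (per : forall E x, Phi tau c0 b E (z (x + w)) = Phi tau c0 b E (z x)).

Definition line_potential x : C := eps%:C * potential tau n 0 (z x).
Definition line_Q : {poly C} := eps%:C *: (Q \Po (eps%:C *: 'X)).

Lemma line_QE E : line_Q.[E] = eps%:C * Q.[eps%:C * E].
Proof. by rewrite hornerZ horner_comp hornerZ hornerX. Qed.

Let g := (size c0).-1.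

Let epsC : (eps%:C : C) * eps%:C = 1.
Proof. by rewrite -rmorphM eps2 rmorph1. Qed.

Let eps_neq0 : (eps%:C : C) != 0.
Proof. by apply: contra_eq_neq epsC => ->; rewrite mul0r eq_sym oner_eq0. Qed.

Let remainder x : {poly C} := eps%:C ^+ g *: (Phi_poly (z x) \Po (eps%:C *: 'X)) - 'X^g.

Let sX_size : size (eps%:C *: 'X : {poly C}) = 2%N.
Proof. by rewrite size_scale// size_polyX. Qed.

Let remainder_size x : (size (remainder x) <= g)%N.
Proof.
have gE : size c0 = g.+1 by rewrite prednK// size_poly_gt0 monic_neq0.
set p := Phi_poly (z x) \Po (eps%:C *: 'X).
have p_size : size p = g.+1.
  have := size_comp_poly (Phi_poly (z x)) (eps%:C *: 'X).
  rewrite sX_size muln1 Phi_poly_size -/g -/p => <-.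
  by rewrite prednK// size_poly_gt0 comp_poly2_eq0 ?sX_size// monic_neq0 ?Phi_poly_monic.
apply/leq_sizeP => j; rewrite leq_eqVlt => /orP[/eqP <-|gj]; last first.
  rewrite coefB coefZ coefXn gtn_eqF// subr0.
  by rewrite [p`_j]nth_default ?mulr0// p_size.
rewrite coefB coefZ coefXn eqxx.
have -> : p`_g = lead_coef p by rewrite lead_coefE p_size.
rewrite lead_coef_comp ?sX_size// (monicP (Phi_poly_monic _)) mul1r.
rewrite lead_coefZ lead_coefX mulr1 Phi_poly_size -/g -exprMn epsC expr1n.
exact: subrr.
Qed.

Let Phi_cder E x : cder (fun t => Phi tau c0 b E (z t)) x
  (zeta * cderive (Phi tau c0 b E) (z x)).
Proof.
apply: (@cdiff_cder _ (Phi tau c0 b E) z0 zeta _ x); apply/cdiffP.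
have [h _ _ _] := Phi3 E (@reg x).
by split; [exact: h | exact: erefl].
Qed.

Let Phi1_cder E x : cder (fun t => cderive (Phi tau c0 b E) (z t)) x
  (zeta * cderive (cderive (Phi tau c0 b E)) (z x)).
Proof.
apply: (@cdiff_cder _ (cderive (Phi tau c0 b E)) z0 zeta _ x); apply/cdiffP.
have [_ h _ _] := Phi3 E (@reg x).
by split; [exact: h | exact: erefl].
Qed.

Let Phi2_cder E x : cder (fun t => cderive (cderive (Phi tau c0 b E)) (z t)) x
  (zeta * cderive (cderive (cderive (Phi tau c0 b E))) (z x)).
Proof.
apply: (@cdiff_cder _ (cderive (cderive (Phi tau c0 b E))) z0 zeta _ x); apply/cdiffP.
have [_ _ h _] := Phi3 E (@reg x).
by split; [exact: h | exact: erefl].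
Qed.

(* Lagrange interpolation in [E] exhibits the coefficients of [Phi] as
   combinations of the solutions [Phi i], hence differentiable. *)
Lemma spectral_line : exists (ell : 'I_g -> {poly C}) (f f1 f2 f3 : 'I_g -> R -> C),
  [/\ [/\ (forall i, (size (ell i) <= g)%N), (forall i x, cder (f i) x (f1 i x)),
     (forall i x, cder (f1 i) x (f2 i x)), (forall i x, cder (f2 i) x (f3 i x)) &
     forall i x, f i (x + w) = f i x],
  (forall E x, line_F ell f x E = eps%:C ^+ g * Phi tau c0 b (eps%:C * E) (z x)) &
  forall x E, line_Q.[E] = line_F ell f x E * line_G line_potential ell f f2 x E
     + line_F1 ell f1 x E ^+ 2 / 4].
Proof.
have [ell [ell_size ellP]] : exists ell : 'I_g -> {poly C},
    (forall i, (size (ell i) <= g)%N) /\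
    forall p : {poly C}, (size p <= g)%N -> p = \sum_(i < g) p.[i%:R] *: ell i.
  have [->|g0] := posnP g.
    exists (fun=> 0); split=> [i|p]; first by rewrite size_poly0.
    by rewrite size_poly_leq0 big_ord0 => /eqP.
  have inj : injective (fun i : nat => i%:R : C) by move=> i j /eqP; rewrite eqr_nat => /eqP.
  exists (fun i => tnth (lagrange g (fun i : nat => i%:R)) i); split=> [i|p p_size].
    by rewrite size_lagrange_.
  rewrite {1}(lagrange_gen g0 inj p_size); apply: eq_bigr => i _; exact: mul_polyC.
pose a i : C := eps%:C * i%:R.
pose f (i : 'I_g) x : C := eps%:C ^+ g * Phi tau c0 b (a i) (z x) - i%:R ^+ g.
pose f1 (i : 'I_g) x : C := eps%:C ^+ g * (zeta * cderive (Phi tau c0 b (a i)) (z x)).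
pose f2 (i : 'I_g) x : C :=
  eps%:C ^+ g * (zeta * (zeta * cderive (cderive (Phi tau c0 b (a i))) (z x))).
pose f3 (i : 'I_g) x : C :=
  eps%:C ^+ g * (zeta * (zeta * (zeta * cderive (cderive (cderive (Phi tau c0 b (a i)))) (z x)))).
have df i x : cder (f i) x (f1 i x).
  by apply: cder_eq; [exact: cderB (cderMl _ (Phi_cder _ x)) (cder_cst _ _)|exact: subr0].
have df1 i x : cder (f1 i) x (f2 i x) by do 2!apply: cderMl; exact: Phi1_cder.
have df2 i x : cder (f2 i) x (f3 i x) by do 3!apply: cderMl; exact: Phi2_cder.
have FE E x : line_F ell f x E = eps%:C ^+ g * Phi tau c0 b (eps%:C * E) (z x).
  have remE E' : (remainder x).[E'] = eps%:C ^+ g * Phi tau c0 b (eps%:C * E') (z x) - E' ^+ g.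
    rewrite hornerD hornerN hornerZ horner_comp hornerZ hornerX hornerXn.
    by rewrite Phi_polyE.
  have := remE E; rewrite {1}(ellP _ (remainder_size x)) horner_sum => /esym h.
  rewrite /line_F -[RHS](subrK (E ^+ g)) h addrC; congr (_ + _).
  by apply: eq_bigr => i _; rewrite hornerZ remE.
have F1E E x : line_F1 ell f1 x E =
    eps%:C ^+ g * (zeta * cderive (Phi tau c0 b (eps%:C * E)) (z x)).
  have := line_F_cder ell df E x; under eq_fun do rewrite FE.
  by move=> /cder_uniq; apply; apply: cderMl; exact: Phi_cder.
have F2E E x : line_F2 ell f2 x E =
    eps%:C ^+ g * (zeta * (zeta * cderive (cderive (Phi tau c0 b (eps%:C * E))) (z x))).
  have := line_F1_cder ell df1 E x; under eq_fun do rewrite F1E.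
  by move=> /cder_uniq; apply; do 2!apply: cderMl; exact: Phi1_cder.
exists ell, f, f1, f2, f3; split; [|exact: FE|].
  split; [exact: ell_size|exact: df|exact: df1|exact: df2|].
  by move=> i x; rewrite /f per.
move=> x E; rewrite line_QE (Q_eq _ (@reg x)) /line_G /line_potential FE F1E F2E.
have eg : eps%:C ^+ g * eps%:C ^+ g = 1 :> C by rewrite -exprMn epsC expr1n.
have -> : potential tau n (eps%:C * E) (z x) = potential tau n 0 (z x) + eps%:C * E.
  by rewrite /potential addr0.
have zz : zeta * zeta = eps%:C by rewrite -expr2.
have key (e p p1 p2 v : C) : e * e = 1 ->
    e * p * ((eps%:C * v + E) * (e * p) - e * (zeta * (zeta * p2)) / 2) +
    (e * (zeta * p1)) ^+ 2 / 4 =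
    eps%:C * ((v + eps%:C * E) * p ^+ 2 + 4^-1 * p1 ^+ 2 - 2^-1 * p * p2).
  move=> ee.
  have -> : e * p * ((eps%:C * v + E) * (e * p) - e * (zeta * (zeta * p2)) / 2) +
      (e * (zeta * p1)) ^+ 2 / 4 = (e * e) * (((eps%:C * v + (eps%:C * eps%:C) * E) * p ^+ 2) -
      (zeta * zeta) * p * p2 / 2 + (zeta * zeta) * p1 ^+ 2 / 4) by rewrite epsC; field.
  by rewrite ee zz; field.
by rewrite key.
Qed.

Hypothesis w_gt0 : 0 < w.

Lemma line_potential_bounded : exists K, forall x, normc (line_potential x) <= K.
Proof.
have [ell [f [f1 [f2 [f3 [[es d d1 d2 p] _ qe]]]]]] := spectral_line.
exact: line_q_bounded w_gt0 es d d1 d2 p qe.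
Qed.

Hypothesis Q_simple : forall E, root Q E -> ~~ root Q^`() E.

Let lQ_simple E : root line_Q E -> ~~ root line_Q^`() E.
Proof.
rewrite rootE line_QE mulf_eq0 (negPf eps_neq0) /= => /Q_simple.
apply: contra; rewrite derivZ deriv_comp derivZ derivX rootE hornerZ hornerM horner_comp.
by rewrite !hornerZ hornerX hornerC mulr1 !mulf_eq0 (negPf eps_neq0) /= orbF.
Qed.

Lemma Phi_line_neq0 E : ~ (forall x, Phi tau c0 b E (z x) = 0).
Proof.
have [ell [f [f1 [f2 [f3 [[es d d1 d2 p] fe qe]]]]]] := spectral_line.
move=> P0; apply: (line_F_neq0 d d1 qe lQ_simple (E := eps%:C * E)) => x.
by rewrite fe mulrA epsC mul1r P0 mulr0.
Qed.

Hypotheses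
  (Phi_conj : forall E x, ((Phi tau c0 b (E^*)%C (z (- x)))^*)%C = Phi tau c0 b E (z x))
  (Q_conj : forall E, ((Q.[(E^*)%C])^*)%C = Q.[E])
  (Q_real : forall E, root Q E -> Im E = 0).

Theorem spectral_line_negative E (y y1 : 'I_2 -> R -> C) (M S : 'M[C]_2) :
  (forall i x, cder (y i) x (y1 i x)) ->
  (forall i x, cder (y1 i) x (zeta ^+ 2 * potential tau n E (z x) * y i x)) ->
  y 0 0 * y1 1 0 - y 1 0 * y1 0 0 != 0 ->
  (forall i x, y i (x + w) = \sum_j M i j * y j x) ->
  S \in unitmx -> SU2 (S *m M *m invmx S) ->
  Im Q.[E] = 0 /\ eps * Re Q.[E] < 0.
Proof.
move=> dy dy1 W yper Su SM.
have [ell [f [f1 [f2 [f3 [[es d d1 d2 p] fe qe]]]]]] := spectral_line.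
have realJ (a : R) (u : C) : ((a%:C * u)^*)%C = a%:C * (u^*)%C.
  by rewrite rmorphM; congr (_ * _); exact: conjc_real.
have epsJ (u : C) : ((eps%:C * u)^*)%C = eps%:C * (u^*)%C by exact: realJ.
have fc E' x : ((line_F ell f (- x) (E'^*)%C)^*)%C = line_F ell f x E'.
  have epsXJ (u : C) : ((eps%:C ^+ g * u)^*)%C = eps%:C ^+ g * (u^*)%C.
    by rewrite -rmorphXn; exact: realJ.
  by rewrite !fe epsXJ -(epsJ E') Phi_conj.
have qc E' : ((line_Q.[(E'^*)%C])^*)%C = line_Q.[E'].
  by rewrite !line_QE epsJ -(epsJ E') Q_conj.
have qr E' : root line_Q E' -> Im E' = 0.
  rewrite rootE line_QE mulf_eq0 (negPf eps_neq0) /= => /Q_real.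
  rewrite ImM /= mul0r addr0 => /eqP; rewrite mulf_eq0 => /orP[/eqP e0|/eqP//].
  by move: eps_neq0; rewrite e0 eqxx.
have dy1' i x : cder (y1 i) x ((line_potential x + eps%:C * E) * y i x).
  apply: cder_eq (dy1 i x) _; rewrite zeta2 /line_potential -mulrDr; congr (_ * _ * _).
  by rewrite /potential addr0.
have := periodic_negative w_gt0 es d d1 d2 p qe fc qc qr lQ_simple dy dy1' W yper Su SM.
rewrite line_QE mulrA epsC mul1r ImM ReM /= !mul0r subr0 addr0 => -[h1 h2]; split=> //.
move/eqP: h1; rewrite mulf_eq0 => /orP[/eqP e0|/eqP//].
by move: eps_neq0; rewrite e0 eqxx.
Qed.

End SpectralLine.

Lemma singular_kernel (K : idomainType) (a0 a1 d0 d1 : K) : a0 * d1 - a1 * d0 = 0 ->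
  ~ (forall s t, s * a0 + t * a1 = 0 -> s * d0 + t * d1 = 0 -> s = 0 /\ t = 0).
Proof.
move=> W0 free; have [||a10 a00] := free a1 (- a0); first by ring.
  by rewrite -[RHS]oppr0 -W0; ring.
move/eqP: a00; rewrite oppr_eq0 => /eqP a00.
have [||d10 d00] := free d1 (- d0); [by rewrite a10 a00; ring|by ring|].
move/eqP: d00; rewrite oppr_eq0 => /eqP d00.
have [||/eqP + _] := free 1 0; rewrite ?a10 ?a00 ?d10 ?d00 ?mulr0 ?mul0r ?addr0//.
by rewrite oner_eq0.
Qed.

Section Monodromy.
Context {R : realType}.
Local Notation C := R[i].
Variables (tau : C) (n : 'I_4 -> nat) (c0 : {poly C})
  (b : forall k : 'I_4, 'I_(n k) -> {poly C}) (Q : {poly C}).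
Arguments b : clear implicits.
Hypotheses (tau_re : Re tau = 0) (tau_im : 0 < Im tau)
  (coefs : is_Phi_coefs tau c0 b)
  (Q_eq : forall E z, regular_pt tau n z -> Q.[E] = potential tau n E z * Phi tau c0 b E z ^+ 2
              + 4^-1 * cderive (Phi tau c0 b E) z ^+ 2
              - 2^-1 * Phi tau c0 b E z * cderive (cderive (Phi tau c0 b E)) z)
  (Q_real : forall E, root Q E -> Im E = 0)
  (Q_simple : forall E, root Q E -> ~~ root Q^`() E).

Local Notation PhiE := (Phi tau c0 b).
Local Notation T := (Im tau).

Let c0_monic : c0 \is monic. Proof. by case: coefs. Qed.
Let b_size k j : (size (b k j) < size c0)%N. Proof. by case: coefs => _ h _ _ _; exact: h. Qed.
Let Phi3 E : third_order_solution tau n E (PhiE E).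
Proof. by case: coefs => _ _ _ h _; case: (h E). Qed.
Let Phi_ell E : even_elliptic tau n (PhiE E).
Proof. by case: coefs => _ _ _ h _; case: (h E). Qed.
Let Phi_uniq E f : even_elliptic tau n f -> third_order_solution tau n E f ->
  exists c : C, forall z, regular_pt tau n z -> f z = c * PhiE E z.
Proof. by case: coefs => _ _ _ _ h; exact: h. Qed.

Let tauE : tau = 'i%C * T%:C.
Proof. by apply: complex_ext; rewrite ?ReM ?ImM /= ?tau_re; ring. Qed.

Record good_line (z0 zeta : C) (eps w : R) : Prop := GoodLine {
  gl_zeta : zeta ^+ 2 = eps%:C;
  gl_eps : eps * eps = 1;
  gl_w : 0 < w;
  gl_reg : forall x : R, regular_pt tau n (z0 + zeta * x%:C);
  gl_per : forall E (x : R), PhiE E (z0 + zeta * (x + w)%:C) = PhiE E (z0 + zeta * x%:C) }.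

Lemma horizontal_line z0 : (forall m : int, Im z0 <> m%:~R * (T / 2)) ->
  good_line z0 1 1 1.
Proof.
move=> hz; have reg x : regular_pt tau n (z0 + 1 * x%:C).
  by apply: regular_pt_Im => // m; rewrite mul1r ImD /= addr0; exact: hz.
split; [by rewrite expr1n|by rewrite mulr1|exact: ltr01|exact: reg|].
move=> E x; have [_ /(_ _ (reg x))[h _ _]] := Phi_ell E.
by rewrite -[RHS]h; congr (PhiE E _); rewrite rmorphD rmorph1; ring.
Qed.

Lemma vertical_line z0 : (forall m : int, Re z0 <> m%:~R / 2) ->
  good_line z0 'i%C (- 1) T.
Proof.
move=> hz; have reg x : regular_pt tau n (z0 + 'i%C * x%:C).
  apply: regular_pt_Re => // m.
  by rewrite ReD ReM /= mul0r mulr0 subr0 addr0; exact: hz.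
split; [by rewrite sqr_i rmorphN rmorph1|by rewrite mulrNN mulr1|exact: tau_im|exact: reg|].
move=> E x; have [_ /(_ _ (reg x))[_ h _]] := Phi_ell E.
by rewrite -[RHS]h; congr (PhiE E _); rewrite rmorphD [in RHS]tauE; ring.
Qed.

Lemma quarter_neq_half (m : int) : 4^-1 <> m%:~R / 2 :> R.
Proof.
move=> h; have : ((2 * m)%:~R : R) = 1%:~R by rewrite intrM; move: h; lra.
by move=> /eqP; rewrite eqr_int => /eqP; lia.
Qed.

Let quarter_neq_halfT (m : int) : T / 4 <> m%:~R * (T / 2).
Proof.
move=> h; apply: (@quarter_neq_half m); apply: (mulfI (lt0r_neq0 tau_im)).
by rewrite h; ring.
Qed.

Let p0 : C := tau / 4.
Let p1 : C := (4^-1)%:C.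

Let Im_p0 : Im p0 = T / 4.
Proof. by rewrite /p0 tauE -mulrA ImM /=; field. Qed.

Let Re_p0 : Re p0 = 0.
Proof. by rewrite /p0 tauE -mulrA ReM /=; field. Qed.

Let horizontal0 z0 : Im z0 = T / 4 -> good_line z0 1 1 1.
Proof.
by move=> z0E; apply: horizontal_line => m; rewrite z0E; exact: quarter_neq_halfT.
Qed.

Let vertical0 z0 : Re z0 = 4^-1 -> good_line z0 'i%C (- 1) T.
Proof. by move=> z0E; apply: vertical_line => m; rewrite z0E; exact: quarter_neq_half. Qed.

Lemma Phi_neq0 E : ~ (forall z, regular_pt tau n z -> PhiE E z = 0).
Proof.
move=> P0; have [z2 e2 _ reg per] := horizontal0 Im_p0.
apply: (Phi_line_neq0 c0_monic b_size Phi3 Q_eq z2 e2 reg per Q_simple (E := E)) => x.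
exact: P0.
Qed.

Let conjPhi E : C -> C := conj_fun (PhiE (E^*)%C).

Lemma conj_even_elliptic E : even_elliptic tau n (conjPhi E).
Proof.
have [mer per] := Phi_ell (E^*)%C; split; first exact: meromorphic_conj.
move=> z /(regular_pt_conj tau_re) rz; have [h1 h2 h3] := per _ rz.
have rz' : regular_pt tau n ((z^*)%C - tau).
  have := regular_ptD (a := 0) (b := -1) rz.
  by rewrite /lattice_pt add0r rmorphN1 mulN1r.
have conj_eq u u' : PhiE (E^*)%C (u^*)%C = PhiE (E^*)%C (u'^*)%C -> conjPhi E u = conjPhi E u'.
  exact: congr1.
have z1 : ((z + 1)^*)%C = (z^*)%C + 1 by rewrite rmorphD; congr (_ + _); exact: conjc1.
have zt : ((z + tau)^*)%C = (z^*)%C - tau by rewrite rmorphD /= (tau_conj tau_re).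
have zN : ((- z)^*)%C = - (z^*)%C by rewrite rmorphN.
have [_ h4 _] := per _ rz'; rewrite subrK in h4.
split; apply: conj_eq; [rewrite z1; exact: h1|rewrite zt; exact/esym/h4|rewrite zN; exact: h3].
Qed.

Lemma conj_third_order E : third_order_solution tau n E (conjPhi E).
Proof.
move=> z /(regular_pt_conj tau_re) rz.
have [d1 d2 d3 eq] := Phi3 (E^*)%C rz.
have VE : potential tau n E = conj_fun (potential tau n (E^*)%C).
  by apply/funext => u; rewrite /conj_fun potential_conj// !conjcK.
rewrite /conjPhi VE !cderive_conj; split; try exact: cderivable_conj.
have conj_eq (x1 x2 x3 x4 x5 : C) :
    ((x1 - 4 * x2 * x3 - 2 * x4 * x5)^*)%C = (x1^*)%C - 4 * (x2^*)%C * (x3^*)%C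
      - 2 * (x4^*)%C * (x5^*)%C.
  by rewrite !(conj_nat, conjB, conjM).
by rewrite /conj_fun -conj_eq eq conjc0.
Qed.

Let conj_poly z : {poly C} := map_poly conjc (Phi_poly tau c0 b (z^*)%C).

Let conj_polyE z E : (conj_poly z).[E] = conjPhi E z.
Proof. by rewrite /conj_poly -{1}[E]conjcK horner_map /= Phi_polyE. Qed.

(* [conjPhi E] is a multiple of [PhiE E], by a ratio of monic polynomials in [E]
   that does not depend on the point; a root of its denominator would make
   [PhiE E] vanish identically. *)
Lemma conj_Phi E z : regular_pt tau n z -> conjPhi E z = PhiE E z.
Proof.
move=> rz; pose p := Phi_poly tau c0 b z; pose p' := conj_poly z.
have p_monic : p \is monic by exact: Phi_poly_monic.
have p'_monic : p' \is monic by rewrite /p' map_monic; exact: Phi_poly_monic.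
have cross u : regular_pt tau n u -> conj_poly u * p = p' * Phi_poly tau c0 b u.
  move=> ru; apply: poly_ext => E'; rewrite !hornerM !conj_polyE !Phi_polyE.
  have [c cE] := Phi_uniq (conj_even_elliptic E') (@conj_third_order E').
  by rewrite (cE _ ru) (cE _ rz); ring.
pose d := gcdp p p'; pose a := p %/ d; pose a' := p' %/ d.
have d0 : d != 0 by rewrite gcdp_eq0 (negPf (monic_neq0 p_monic)).
have pE : p = a * d by rewrite divpK// dvdp_gcdl.
have p'E : p' = a' * d by rewrite divpK// dvdp_gcdr.
have cop : coprimep a a' by apply: coprimep_div_gcd; rewrite (monic_neq0 p_monic).
have a_dvd u : regular_pt tau n u -> a %| Phi_poly tau c0 b u.
  move=> /cross; rewrite {1}pE p'E mulrA [a' * d * _]mulrAC => /(mulIf d0) h.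
  by rewrite -(Gauss_dvdpr _ cop) -h dvdp_mull.
have a1 : size a = 1%N.
  apply/eqP; apply: contraT => /closed_rootP[r ar].
  case: (@Phi_neq0 r) => u ru; rewrite -Phi_polyE; apply/eqP; rewrite -rootE.
  by have /dvdpP[k ->] := a_dvd _ ru; rewrite rootM ar orbT.
have pp' : p %| p'.
  have pd : p %| d by rewrite pE -{2}[d]mul1r (dvdp_mul2r _ _ d0) dvdp1 a1.
  exact: dvdp_trans pd (dvdp_gcdr p p').
have : p %= p'.
  rewrite -dvdp_size_eqp//; apply/eqP; rewrite /p' /conj_poly size_map_poly.
  by rewrite !Phi_poly_size.
rewrite eqp_monic// => /eqP pE'.
by rewrite -conj_polyE -/p' -pE' Phi_polyE.
Qed.

Lemma cderive_line (f h : C -> C) z0 zeta : zeta != 0 ->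
  (forall x : R, cderivable f (z0 + zeta * x%:C)) ->
  (forall x : R, cderivable h (z0 + zeta * x%:C)) ->
  (forall x : R, f (z0 + zeta * x%:C) = h (z0 + zeta * x%:C)) ->
  forall x : R, cderive f (z0 + zeta * x%:C) = cderive h (z0 + zeta * x%:C).
Proof.
move=> zeta0 df dh fh x; apply: (mulfI zeta0).
have der (v : C -> C) : (forall x : R, cderivable v (z0 + zeta * x%:C)) ->
    cder (fun t => v (z0 + zeta * t%:C)) x (zeta * cderive v (z0 + zeta * x%:C)).
  move=> dv; apply: (@cdiff_cder _ v z0 zeta _ x); apply/cdiffP.
  by split; [exact: dv|exact: erefl].
have := der _ df; under eq_fun do rewrite fh.
by move=> /cder_uniq; apply; exact: der.
Qed.

Lemma Q_conj E : ((Q.[(E^*)%C])^*)%C = Q.[E].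
Proof.
have [_ _ _ reg _] := horizontal0 Im_p0.
have dc x := conj_third_order E (reg x).
have dP x := Phi3 E (reg x).
have e0 x : conjPhi E (p0 + 1 * x%:C) = PhiE E (p0 + 1 * x%:C) by apply: conj_Phi.
have e1 : forall x : R, cderive (conjPhi E) (p0 + 1 * x%:C) = cderive (PhiE E) (p0 + 1 * x%:C).
  apply: cderive_line; [exact: oner_neq0| | |exact: e0].
    by move=> x; have [h _ _ _] := dc x; exact: h.
  by move=> x; have [h _ _ _] := dP x; exact: h.
have e2 : forall x : R, cderive (cderive (conjPhi E)) (p0 + 1 * x%:C) =
    cderive (cderive (PhiE E)) (p0 + 1 * x%:C).
  apply: cderive_line; [exact: oner_neq0| | |exact: e1].
    by move=> x; have [_ h _ _] := dc x; exact: h.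
  by move=> x; have [_ h _ _] := dP x; exact: h.
have := e0 0; have := e1 0; have := e2 0; rewrite /conjPhi !cderive_conj => {}e2 {}e1 {}e0.
have r0 := reg 0; have rc := regular_pt_conj tau_re r0.
have conj_eq (x1 x2 x3 x4 : C) :
    ((x1 * x2 ^+ 2 + 4^-1 * x3 ^+ 2 - 2^-1 * x2 * x4)^*)%C =
    (x1^*)%C * (x2^*)%C ^+ 2 + 4^-1 * (x3^*)%C ^+ 2 - 2^-1 * (x2^*)%C * (x4^*)%C.
  by rewrite !expr2 conjB conjD !(conj_nat, conjM, conjV).
rewrite (Q_eq _ rc) (Q_eq _ r0) conj_eq potential_conj// !conjcK.
have assemble (v x2 x3 x4 y2 y3 y4 : C) : x2 = y2 -> x3 = y3 -> x4 = y4 ->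
    v * x2 ^+ 2 + 4^-1 * x3 ^+ 2 - 2^-1 * x2 * x4 = v * y2 ^+ 2 + 4^-1 * y3 ^+ 2 - 2^-1 * y2 * y4.
  by move=> -> -> ->.
exact: (assemble _ _ _ _ _ _ _ e0 e1 e2).
Qed.

Section Solutions.
Variables (E : C) (y : 'I_2 -> C -> C).
Hypothesis y_basis : lame_basis tau n E y.

Let y_sol i z : regular_pt tau n z -> [/\ cderivable (y i) z, cderivable (cderive (y i)) z &
  cderive (cderive (y i)) z = potential tau n E z * y i z].
Proof. by case: y_basis => h _ _; case: (h i) => _; exact. Qed.

Section Line.
Variables (z0 zeta : C) (eps w : R).
Hypothesis line : good_line z0 zeta eps w.
Local Notation z x := (z0 + zeta * x%:C).

Let dy i x : cder (fun t => y i (z t)) x (zeta * cderive (y i) (z x)).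
Proof.
apply: (@cdiff_cder _ (y i) z0 zeta _ x); apply/cdiffP.
have [h _ _] := y_sol i (gl_reg line (x := x)).
by split; [exact: h|exact: erefl].
Qed.

Let dy1 i x : cder (fun t => zeta * cderive (y i) (z t)) x
  (zeta ^+ 2 * potential tau n E (z x) * y i (z x)).
Proof.
have [_ h e] := y_sol i (gl_reg line (x := x)).
rewrite expr2 -!mulrA; apply: cderMl; rewrite -e.
apply: (@cdiff_cder _ (cderive (y i)) z0 zeta _ x); apply/cdiffP.
by split; [exact: h|exact: erefl].
Qed.

Let zeta0 : zeta != 0.
Proof.
case: line => z2 e2 _ _ _; apply: contra_eq_neq z2 => ->.
rewrite expr0n /= eq_sym fmorph_eq0.
by apply: contra_eq_neq e2 => ->; rewrite mulr0 eq_sym oner_eq0.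
Qed.

Lemma zero_along_line (c : 'I_2 -> C) :
  \sum_i c i * y i z0 = 0 -> \sum_i c i * cderive (y i) z0 = 0 ->
  forall x : R, \sum_i c i * y i (z x) = 0 /\ \sum_i c i * cderive (y i) (z x) = 0.
Proof.
move=> u0 v0 x; case: (line) => z2 e2 w0 reg per.
have [K VK] := line_potential_bounded c0_monic b_size Phi3 Q_eq z2 e2 reg per w0.
have z00 : z 0 = z0 by rewrite rmorph0 mulr0 addr0.
pose u t := \sum_i c i * y i (z t).
pose v t := \sum_i c i * (zeta * cderive (y i) (z t)).
have vE t : v t = zeta * \sum_i c i * cderive (y i) (z t).
  by rewrite mulr_sumr; apply: eq_bigr => i _; rewrite mulrCA.
have du t : cder u t (v t) by apply: cder_sum => i; apply: cderMl; exact: dy.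
have dv t : cder v t (zeta ^+ 2 * potential tau n E (z t) * u t).
  apply: cder_eq; first by apply: cder_sum => i; apply: cderMl; exact: dy1.
  by rewrite mulr_sumr; apply: eq_bigr => i _; rewrite mulrCA.
have bound t : normc (zeta ^+ 2 * potential tau n E (z t)) <= K + normc (eps%:C * E).
  have -> : zeta ^+ 2 * potential tau n E (z t) =
      line_potential tau n z0 zeta eps t + eps%:C * E.
    by rewrite z2 /line_potential -mulrDr; congr (_ * _); rewrite /potential addr0.
  by apply: le_trans (normcD _ _) _; rewrite lerD2r.
have u00 : u 0 = 0 by rewrite /u z00.
have v00 : v 0 = 0 by rewrite vE z00 v0 mulr0.
have [ux vx] := ode_unique bound du dv u00 v00 x; split; first exact: ux.
by move/eqP: vx; rewrite vE mulf_eq0 (negPf zeta0) => /eqP.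
Qed.

Lemma line_unitary_negative (M S : 'M[C]_2) :
  (forall E x, ((PhiE (E^*)%C (z (- x)))^*)%C = PhiE E (z x)) ->
  y 0 z0 * cderive (y 1) z0 - y 1 z0 * cderive (y 0) z0 != 0 ->
  (forall i (x : R), y i (z (x + w)) = \sum_j M i j * y j (z x)) ->
  S \in unitmx -> SU2 (S *m M *m invmx S) ->
  eps * Re Q.[E] < 0.
Proof.
move=> Pc W yper Su SM; case: (line) => z2 e2 w0 reg per.
have z00 : z 0 = z0 by rewrite rmorph0 mulr0 addr0.
have W' : y 0 (z 0) * (zeta * cderive (y 1) (z 0)) -
    y 1 (z 0) * (zeta * cderive (y 0) (z 0)) != 0.
  rewrite z00 ![_ * (zeta * _)]mulrCA -mulrBr mulf_neq0//.
by have [] := spectral_line_negative c0_monic b_size Phi3 Q_eq z2 e2 reg per w0 Q_simple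
  Pc Q_conj Q_real dy dy1 W' yper Su SM.
Qed.

End Line.

Let zero_all (c : 'I_2 -> C) p : Im p = T / 4 ->
  \sum_i c i * y i p = 0 -> \sum_i c i * cderive (y i) p = 0 ->
  forall z, regular_pt tau n z -> \sum_i c i * y i z = 0.
Proof.
move=> pI u0 v0.
pose zero z := \sum_i c i * y i z = 0 /\ \sum_i c i * cderive (y i) z = 0.
have along z0 zeta eps w z : good_line z0 zeta eps w -> zero z0 ->
    (exists x : R, z = z0 + zeta * x%:C) -> zero z.
  by move=> l [h1 h2] [x ->]; exact: (zero_along_line l h1 h2 x).
have hor z0 z : (forall m : int, Im z0 <> m%:~R * (T / 2)) -> zero z0 -> Im z = Im z0 -> zero z.
  move=> /horizontal_line l h zI; apply: along l h _; exists (Re z - Re z0).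
  by rewrite mul1r; apply: complex_ext; rewrite ?ReD ?ImD /= ?addr0// addrC subrK.
have ver z0 z : (forall m : int, Re z0 <> m%:~R / 2) -> zero z0 -> Re z = Re z0 -> zero z.
  move=> /vertical_line l h zR; apply: along l h _; exists (Im z - Im z0).
  by apply: complex_ext; rewrite ?ReD ?ImD ?ReM ?ImM /= ?zR; ring.
have all_T4 z : Im z = T / 4 -> zero z.
  by move=> zI; apply: (hor p) => //; rewrite pI.
have all_ver z : (forall m : int, Re z <> m%:~R / 2) -> zero z.
  move=> zR; have h : zero (Re z +i* (T / 4))%C by exact: all_T4.
  exact: (ver (Re z +i* (T / 4))%C z zR h erefl).
have all_hor z : (forall m : int, Im z <> m%:~R * (T / 2)) -> zero z.
  move=> zI; have h : zero (4^-1 +i* Im z)%C by apply: all_ver; exact: quarter_neq_half.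
  exact: (hor (4^-1 +i* Im z)%C z zI h erefl).
move=> z rz.
have [zR|/existsNP[m /contrapT zR]] := pselect (forall m : int, Re z <> m%:~R / 2).
  by case: (all_ver _ zR).
apply/eqP; apply: contraT => uz.
have du : cder (fun t => \sum_i c i * y i (z + 1 * t%:C)) 0
    (\sum_i c i * (1 * cderive (y i) z)).
  apply: cder_sum => i; apply: cderMl; have [h _ _] := y_sol i rz.
  apply: (@cdiff_cder _ (y i) z 1 _ 0); rewrite rmorph0 mulr0 addr0; apply/cdiffP.
  by split; [exact: h|exact: erefl].
have := cder_neq0_near du; rewrite rmorph0 mulr0 addr0 => /(_ uz) /nbhs_ballP[d /= d0 hd].
pose t := Num.min (d / 2) 4^-1.
have t0 : 0 < t by rewrite lt_min divr_gt0//= invr_gt0.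
have td : t < d by rewrite gt_min ltr_pdivrMr// ltr_pMr// ltr1n.
have t4 : t <= 4^-1 by rewrite ge_min lexx orbT.
have [|h _] := all_ver (z + 1 * t%:C).
  move=> m'; rewrite mul1r ReD zR /= => h.
  have h1 : ((m' - m)%:~R : R) = 2 * t by rewrite intrB; move: h; lra.
  have h2 : (0 : R) < (m' - m)%:~R by rewrite h1; lra.
  have h3 : ((m' - m)%:~R : R) < 1%:~R by rewrite h1 /=; lra.
  by move: h2 h3; rewrite ltr0z ltr_int; lia.
have := hd t; rewrite h eqxx; apply.
by rewrite /ball /= sub0r normrN gtr0_norm.
Qed.

Lemma wronskian_neq0 p : Im p = T / 4 \/ Re p = 4^-1 ->
  y 0 p * cderive (y 1) p - y 1 p * cderive (y 0) p != 0.
Proof.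
move=> hp; apply/negP => /eqP W0.
have free (c : 'I_2 -> C) : \sum_i c i * y i p = 0 -> \sum_i c i * cderive (y i) p = 0 ->
    forall i, c i = 0.
  move=> u0 v0; case: y_basis => _ ind _; apply: ind.
  case: hp => hp; first exact: zero_all hp u0 v0.
  have [] := zero_along_line (vertical0 hp) u0 v0 (T / 4 - Im p).
  apply: zero_all; rewrite ImD ImM /=; ring.
pose vec (s t : C) (i : 'I_2) : C := if i == 0 then s else t.
have vecP s t : s * y 0 p + t * y 1 p = 0 ->
    s * cderive (y 0) p + t * cderive (y 1) p = 0 -> s = 0 /\ t = 0.
  move=> u0 v0; have h := free (vec s t).
  have sum2 (F : 'I_2 -> C) : \sum_i F i = F 0 + F 1.
    by rewrite big_ord_recl big_ord1; congr (_ + F _); exact: val_inj.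
  have h' : forall i, vec s t i = 0 by apply: h; rewrite sum2.
  by split; [exact: (h' 0)|exact: (h' 1)].
exact: singular_kernel W0 vecP.
Qed.

Theorem not_unitary (rho : int -> int -> 'M[C]_2) :
  (forall (a b : int) z, regular_pt tau n z ->
    forall i, y i (z + lattice_pt tau a b) = \sum_j rho a b i j * y j z) ->
  ~ unitary_rep rho.
Proof.
move=> yper [P [Pu PS]].
have hl := horizontal0 Im_p0.
have vl : good_line p1 'i%C (- 1) T by exact: vertical0.
have Pc E' z : regular_pt tau n z -> ((PhiE (E'^*)%C (z^*)%C)^*)%C = PhiE E' z.
  exact: conj_Phi.
have ReJ (u : C) : Re (u^*)%C = Re u by case: u.
have ImJ (u : C) : Im (u^*)%C = - Im u by case: u.
have neg : 1 * Re Q.[E] < 0.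
  apply: (line_unitary_negative hl (M := rho 1 0) (S := P)) => //.
  - move=> E' x; 
    have [_ /(_ _ (gl_reg hl (x := x)))[_ _ <-]] := Phi_ell E'.
    rewrite -(Pc E' _ (regular_ptN (gl_reg hl (x := x)))); congr (conjc (PhiE _ _)).
    by apply: complex_ext; rewrite ?ReJ ?ImJ ?ReN ?ImN ?ReD ?ImD ?mul1r ?Re_p0 ?Im_p0 /=; ring.
  - by apply: wronskian_neq0; left; exact: Im_p0.
  - move=> i x; rewrite -(yper 1 0 _ (gl_reg hl (x := x))); congr (y i _).
    by rewrite /lattice_pt rmorphD rmorph1; ring.
have : - 1 * Re Q.[E] < 0.
  apply: (line_unitary_negative vl (M := rho 0 1) (S := P)) => //.
  - move=> E' x; rewrite -(Pc E' _ (gl_reg vl (x := x))); congr (conjc (PhiE _ _)).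
    by apply: complex_ext; rewrite ?ReJ ?ImJ ?ReD ?ImD ?ReM ?ImM /=; ring.
  - by apply: wronskian_neq0; right.
  - move=> i x; rewrite -(yper 0 1 _ (gl_reg vl (x := x))); congr (y i _).
    by rewrite /lattice_pt rmorphD [in RHS]tauE; ring.
by move: neg; lra.
Qed.

End Solutions.

End Monodromy.

Lemma mup1_deriv (K : fieldType) (p : {poly K}) x :
  p != 0 -> mup x p = 1%N -> root p x -> ~~ root p^`() x.
Proof.
move=> p0 m1 /factor_theorem[k pE]; apply/negP => rx.
have /factor_theorem[k' kE] : root k x.
  move: rx; rewrite pE derivM derivXsubC mulr1 !rootE hornerD hornerM hornerXsubC.
  by rewrite subrr mulr0 add0r.
have : (2 <= mup x p)%N by rewrite mup_geq// pE kE -mulrA dvdp_mull.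
by rewrite m1.
Qed.

Theorem theorem3p4 (R : realType) (tau : R[i])
    (tau_re : complex.Re tau = 0) (tau_im : 0 < complex.Im tau)
    (n : 'I_4 -> nat) (n_max : (1 <= \max_(k < 4) n k)%N)
    (Q : {poly R[i]}) (Q_spec : is_spectral_poly tau n Q)
    (Q_real : forall E : R[i], root Q E -> complex.Im E = 0)
    (Q_distinct : forall E : R[i], root Q E -> mup E Q = 1%N) :
  forall (E : R[i]) (rho : int -> int -> 'M[R[i]]_2),
    is_monodromy tau n E rho -> ~ unitary_rep rho.
Proof.
move=> E rho [y [y_basis yper]]; have [c0 [b [coefs Q_eq]]] := Q_spec.
have Q0 : Q != 0.
  apply/negP => /eqP Q0; have := Q_real 'i%C.
  by rewrite Q0 root0 => /(_ isT)/eqP; rewrite /= oner_eq0.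
have Q_simple E' : root Q E' -> ~~ root Q^`() E'.
  by move=> rE; exact: mup1_deriv Q0 (Q_distinct _ rE) rE.
exact: (not_unitary tau_re tau_im coefs Q_eq Q_real Q_simple y_basis yper).
Qed.
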